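(* Let $\gamma\in(0,1)$, $a=1-2\gamma$, $s=\frac n2+\gamma$. Let $(X^{n+1},g^+)$ be an asymptotically hyperbolic manifold with conformal infinity $(M^n,[\hat h])$, let $\rho$ be the geodesic defining function associated with the representative $\hat h$, and $\bar g=\rho^2g^+$. Suppose that $U$ is a nonnegative solution of $$-\mathrm{div}\left(\rho^a\nabla U\right)+E(\rho)U=0\quad\text{in }(X^{n+1},\bar g),\qquad U|_{\rho=0}=f\quad\text{on }M^n.$$ Let $p_0\in M^n=\partial X^{n+1}$ and let $B_r$ denote the geodesic ball of radius $r$ centered at $p_0$ in $M^n$. Then, for sufficiently small $r_0>0$, if $U(q_0)=0$ for some $q_0\in B_{r_0}\setminus\overline{B_{\frac12r_0}}$ and $U>0$ on $\partial B_{\frac12r_0}$, then $$\rho^a\partial_\rho U\big|_{q_0}>0.$$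
   Context: $X^{n+1}$ ($n\ge3$) is a smooth manifold with smooth compact boundary $M^n=\partial X$. A defining function of $M$ is a function $\rho$ with $\rho>0$ in $X$, $\rho=0$ on $M$, $d\rho\ne0$ on $M$. $g^+$ is conformally compact if for some defining function $\rho$ the metric $\rho^2g^+$ extends to $\bar X$ so that $(\bar X,\rho^2g^+)$ is a compact Riemannian manifold; the conformal class of $\rho^2g^+|_{TM}$ is the conformal infinity. $g^+$ is asymptotically hyperbolic if it is conformally compact and its sectional curvature tends to $-1$ at infinity. The geodesic defining function associated with $\hat h$ is the one for which $\bar g=\rho^2g^+=d\rho^2+h_\rho$ near $M$, with $h_\rho=\hat h+O(\rho)$ a one-parameter family of metrics on $M$. Divergence and gradient are taken with respect to $\bar g$, and $$E(\rho)=\rho^{-1-s}\left(-\Delta_{g^+}-s(n-s)\right)\rho^{n-s}.$$ Geodesic balls in $M$ are taken with respect to $\hat h$, and $\rho^a\partial_\rho U|_{q_0}$ denotes the limit of $\rho^a\partial_\rho U$ as $\rho\to0$ at $q_0$. *)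

(* Defs.v *)
From HB Require Import structures.
From mathcomp Require Import all_boot all_order all_algebra.
From mathcomp Require Import all_classical all_reals all_analysis.
Set Implicit Arguments.
Unset Strict Implicit.
Unset Printing Implicit Defensive.
Import Order.TTheory GRing.Theory Num.Theory.
Import numFieldNormedType.Exports.
Local Open Scope classical_set_scope.
Local Open Scope ring_scope.

(* Points of R^{n+1} are 'rV[R]_n.+1; the
   coordinate of index ord0 is the normal one at the boundary, and the
   coordinates lift ord0 k, for k : 'I_n, are the tangential ones. *)

Section Calculus.
Context {R : realType}.

Definition basis_vec m (j : 'I_m) : 'rV[R]_m := delta_mx 0 j.

Fixpoint iter_partial m (s : seq 'I_m) (f : 'rV[R]_m -> R) : 'rV[R]_m -> R :=
  if s is j :: s' then fun x => 'D_(basis_vec j) (iter_partial s' f) x else f.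

(* V is meant to be open. *)
Definition Ck m (k : nat) (V : set 'rV[R]_m) (f : 'rV[R]_m -> R) : Prop :=
  forall (s : seq 'I_m) x, (size s <= k)%N -> V x ->
    {for x, continuous (iter_partial s f)} /\
    ((size s < k)%N ->
      forall j, derivable (iter_partial s f) x (basis_vec j)).

(* Smoothness on an arbitrary subset of R^m: near each of its points, f is the
   restriction of a smooth function defined on an open set.  This is used on
   relatively open subsets of the half-space and of its bounding hyperplane. *)
Definition smooth_on m (A : set 'rV[R]_m) (f : 'rV[R]_m -> R) : Prop :=
  forall x, A x -> exists V (g : 'rV[R]_m -> R),
    [/\ open V, V x, (forall k, Ck k V g) & {in V `&` A, f =1 g}].

Definition half_space n : set 'rV[R]_n.+1 := [set x | 0 <= x ord0 ord0].

(* The j-th partial derivative relative to the half-space: the usual one where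
   it makes sense, and the one-sided one in the normal direction at the
   boundary. *)
Definition pd n (j : 'I_n.+1) (f : 'rV[R]_n.+1 -> R) (x : 'rV[R]_n.+1) : R :=
  lim ((fun t : R => t^-1 * (f (x + t *: basis_vec j) - f x)) @
       within [set t : R | @half_space n (x + t *: basis_vec j)] 0^').

Definition jac n (F : 'rV[R]_n.+1 -> 'rV[R]_n.+1) (x : 'rV[R]_n.+1) :
    'M[R]_n.+1 :=
  \matrix_(k, l) pd l (fun y => F y ord0 k) x.

Definition tangential n (B : 'M[R]_n.+1) : 'M[R]_n :=
  row' ord0 (col' ord0 B).

Definition form m (G : 'M[R]_m) (u v : 'rV[R]_m) : R :=
  (u *m G *m v^T) ord0 ord0.

Definition inner_product m (G : 'M[R]_m) : Prop :=
  G^T = G /\ forall v : 'rV[R]_m, v != 0 -> 0 < form G v v.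

End Calculus.

(* Riemannian geometry in one chart, for the metric with components
   G x i j at the point x of an open subset of R^m. *)
Section LocalGeometry.
Context {R : realType} {m : nat}.
Variable G : 'rV[R]_m -> 'M[R]_m.

Definition gradient (u : 'rV[R]_m -> R) (x : 'rV[R]_m) : 'rV[R]_m :=
  \row_k \sum_(l < m) invmx (G x) k l * 'D_(basis_vec l) u x.

Definition divergence (V : 'rV[R]_m -> 'rV[R]_m) (x : 'rV[R]_m) : R :=
  (Num.sqrt (\det (G x)))^-1 *
  \sum_(k < m) 'D_(basis_vec k)
     (fun y => Num.sqrt (\det (G y)) * V y ord0 k) x.

Definition laplacian (u : 'rV[R]_m -> R) (x : 'rV[R]_m) : R :=
  divergence (gradient u) x.

(* Gamma^k_{ij} *)
Definition christoffel (k i j : 'I_m) (x : 'rV[R]_m) : R :=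
  2^-1 * \sum_(l < m) invmx (G x) k l *
    ('D_(basis_vec i) (fun y => G y j l) x
     + 'D_(basis_vec j) (fun y => G y i l) x
     - 'D_(basis_vec l) (fun y => G y i j) x).

(* The component along d_l of R(d_i, d_j) d_k, for the convention
   R(X, Y) Z = nabla_X nabla_Y Z - nabla_Y nabla_X Z - nabla_[X, Y] Z. *)
Definition riemann (l i j k : 'I_m) (x : 'rV[R]_m) : R :=
  'D_(basis_vec i) (christoffel l j k) x
  - 'D_(basis_vec j) (christoffel l i k) x
  + \sum_(q < m) (christoffel l i q x * christoffel q j k x
                  - christoffel l j q x * christoffel q i k x).

Definition curvature (u v w : 'rV[R]_m) (x : 'rV[R]_m) : 'rV[R]_m :=
  \row_l \sum_(i < m) \sum_(j < m) \sum_(k < m)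
    u ord0 i * v ord0 j * w ord0 k * riemann l i j k x.

Definition sectional_curvature (x u v : 'rV[R]_m) : R :=
  form (G x) (curvature u v v x) u /
  (form (G x) u u * form (G x) v v - form (G x) u v ^+ 2).

End LocalGeometry.

(* A smooth structure, with boundary, of dimension n+1 on the space T, which
   plays the part of the closure of X; `point i` is the inverse of the chart
   `coord i : dom i -> half_space`. *)
Record bmanifold (R : realType) (n : nat) (T : topologicalType) := BManifold {
  chart : Type;
  dom : chart -> set T;
  coord : chart -> T -> 'rV[R]_n.+1;
  point : chart -> 'rV[R]_n.+1 -> T;
  bm_hausdorff : hausdorff_space T;
  bm_second_countable : @second_countable T;
  dom_cover : forall p, exists i, dom i p;
  dom_open : forall i, open (dom i);
  coordK : forall i p, dom i p -> point i (coord i p) = p;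
  coord_open : forall i, exists2 O : set 'rV[R]_n.+1,
    open O & coord i @` dom i = O `&` @half_space R n;
  coord_continuous : forall i, {within dom i, continuous (coord i)};
  point_continuous : forall i,
    {within coord i @` dom i, continuous (point i)};
  transition_smooth : forall i j (k : 'I_n.+1),
    smooth_on (coord i @` (dom i `&` dom j))
              (fun x => coord j (point i x) ord0 k)
}.

Section Manifold.
Context {R : realType} {n : nat} {T : topologicalType}.
Variable A : bmanifold R n T.

(* M *)
Definition bdry : set T := [set p | exists2 i : chart A, dom i p & coord i p ord0 ord0 = 0].

(* X *)
Definition inner : set T := ~` bdry.

Definition smooth_fun (D : set T) (u : T -> R) : Prop :=
  forall i : chart A, smooth_on (coord i @` (dom i `&` D)) (u \o point i).

Definition transition_jac (i j : chart A) (p : T) : 'M[R]_n.+1 :=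
  jac (coord j \o point i) (coord i p).

(* Covariant symmetric 2-tensors are given by their components in each chart.
   A metric on the m-dimensional manifold D, where J gives the Jacobian matrices
   of the coordinate changes of D. *)
Definition metric_field m (D : set T) (J : chart A -> chart A -> T -> 'M[R]_m)
    (g : chart A -> 'rV[R]_n.+1 -> 'M[R]_m) : Prop :=
  [/\ forall i k l, smooth_on (coord i @` (dom i `&` D)) (fun x => g i x k l),
      forall i p, dom i p -> D p -> inner_product (g i (coord i p)) &
      forall i j p, dom i p -> dom j p -> D p ->
        g i (coord i p) = (J i j p)^T *m g j (coord j p) *m J i j p].

(* Metrics on D = inner or on D = [set: T]. *)
Definition riemannian (D : set T) (g : chart A -> 'rV[R]_n.+1 -> 'M[R]_n.+1) :=
  metric_field D transition_jac g.

(* Metrics on M; their components are only meaningful at coordinates of points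
   of M. *)
Definition bdry_riemannian (h : chart A -> 'rV[R]_n.+1 -> 'M[R]_n) :=
  metric_field bdry (fun i j p => tangential (transition_jac i j p)) h.

Definition defining_function (rho : T -> R) : Prop :=
  [/\ smooth_fun [set: T] rho,
      forall p, inner p -> 0 < rho p,
      forall p, bdry p -> rho p = 0 &
      forall (i : chart A) p, dom i p -> bdry p ->
        exists k, pd k (rho \o point i) (coord i p) != 0].

Definition extends (gp : chart A -> 'rV[R]_n.+1 -> 'M[R]_n.+1) (rho : T -> R)
    (gbar : chart A -> 'rV[R]_n.+1 -> 'M[R]_n.+1) : Prop :=
  riemannian [set: T] gbar /\
  forall i p, dom i p -> inner p ->
    gbar i (coord i p) = rho p ^+ 2 *: gp i (coord i p).

Definition conformally_compact (gp : chart A -> 'rV[R]_n.+1 -> 'M[R]_n.+1) :=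
  [/\ compact [set: T], riemannian inner gp &
      exists rho gbar, defining_function rho /\ extends gp rho gbar].

(* hhat belongs to the conformal infinity of gp. *)
Definition conformal_infinity (gp : chart A -> 'rV[R]_n.+1 -> 'M[R]_n.+1)
    (hhat : chart A -> 'rV[R]_n.+1 -> 'M[R]_n) : Prop :=
  bdry_riemannian hhat /\
  exists rho gbar (w : T -> R),
    [/\ defining_function rho, extends gp rho gbar, smooth_fun bdry w &
        forall i p, dom i p -> bdry p ->
          hhat i (coord i p) =
          expR (w p) *: tangential (gbar i (coord i p))].

Definition asymptotically_hyperbolic
    (gp : chart A -> 'rV[R]_n.+1 -> 'M[R]_n.+1) : Prop :=
  conformally_compact gp /\
  forall e : R, 0 < e -> exists K : set T,
    [/\ compact K, K `<=` inner &
        forall i p (u v : 'rV[R]_n.+1), dom i p -> inner p -> ~ K p ->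
          row_free (col_mx u v) ->
          `|sectional_curvature (gp i) (coord i p) u v + 1| < e].

(* Phi identifies M x [0, eps[ with a neighbourhood of M in the closure of X. *)
Definition strip (eps : R) : set (T * R) :=
  [set z | bdry z.1 /\ 0 <= z.2 < eps].

(* M x [0, eps[ has the local coordinates coord i q + t e_0, since the normal
   coordinate of q in M vanishes. *)
Definition collar_coord (Phi : T -> R -> T) (i j : chart A)
    (y : 'rV[R]_n.+1) : 'rV[R]_n.+1 :=
  coord j (Phi (point i (y - y ord0 ord0 *: basis_vec ord0)) (y ord0 ord0)).

Definition collar_dom (Phi : T -> R -> T) (eps : R) (i j : chart A) :
    set 'rV[R]_n.+1 :=
  [set y | exists q t, [/\ strip eps (q, t), dom i q, dom j (Phi q t) &
                           y = coord i q + t *: basis_vec ord0]].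

(* rho is the geodesic defining function associated with hhat, and through
   Phi : M x [0, eps[ -> X-closure one has gbar = rho^2 gp = drho^2 + h_rho with
   h_0 = hhat.  Phi is a diffeomorphism onto its image because it is injective
   and has invertible differential, by the formula for the pullback of gbar.
   The derivative d_rho at Phi q t is the derivative along t' |-> Phi q t'. *)
Definition geodesic_defining_function
    (gp : chart A -> 'rV[R]_n.+1 -> 'M[R]_n.+1)
    (hhat : chart A -> 'rV[R]_n.+1 -> 'M[R]_n) (rho : T -> R)
    (gbar : chart A -> 'rV[R]_n.+1 -> 'M[R]_n.+1)
    (eps : R) (Phi : T -> R -> T)
    (h : R -> chart A -> 'rV[R]_n.+1 -> 'M[R]_n) : Prop :=
  [/\ defining_function rho /\ extends gp rho gbar,
      [/\ 0 < eps,
          {within strip eps, continuous (fun z => Phi z.1 z.2)},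
          set_inj (strip eps) (fun z => Phi z.1 z.2),
          open ((fun z => Phi z.1 z.2) @` strip eps) &
          forall i j (k : 'I_n.+1),
            smooth_on (collar_dom Phi eps i j)
                      (fun y => collar_coord Phi i j y ord0 k)],
      (forall q, bdry q -> Phi q 0 = q) /\
      (forall q t, strip eps (q, t) -> rho (Phi q t) = t),
      (forall t, 0 <= t < eps -> bdry_riemannian (h t)) /\
      (forall i q, dom i q -> bdry q -> h 0 i (coord i q) = hhat i (coord i q)) &
      forall i j q t, strip eps (q, t) -> dom i q -> dom j (Phi q t) ->
        let J := jac (collar_coord Phi i j) (coord i q + t *: basis_vec ord0) in
        J^T *m gbar j (coord j (Phi q t)) *m J = lift0_mx (h t i (coord i q))].

(* Curves in M need not be regular, so that restricting the definition of the
   distance to C^1 curves (instead of piecewise C^1 ones) and to curves defined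
   on the whole of R does not change the infimum. *)
Definition C1_curve (c : R -> T) : Prop :=
  [/\ forall t, bdry (c t), continuous c &
      forall (i : chart A) t (k : 'I_n.+1), dom i (c t) ->
        derivable (fun s => coord i (c s) ord0 k) t 1 /\
        {for t, continuous (derive1 (fun s => coord i (c s) ord0 k))}].

Definition velocity (c : R -> T) (i : chart A) (t : R) : 'rV[R]_n :=
  \row_k derive1 (fun s => coord i (c s) ord0 (lift ord0 k)) t.

(* The value does not depend on the chart used. *)
Definition speed (h : chart A -> 'rV[R]_n.+1 -> 'M[R]_n) (c : R -> T) (t : R) :
    R :=
  xget 0 [set r | exists2 i, dom i (c t) &
    r = Num.sqrt (form (h i (coord i (c t))) (velocity c i t) (velocity c i t))].

Definition curve_length (h : chart A -> 'rV[R]_n.+1 -> 'M[R]_n) (c : R -> T) :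
    \bar R :=
  \int[lebesgue_measure]_(t in `[0, 1]) (speed h c t)%:E.

Definition geodesic_distance (h : chart A -> 'rV[R]_n.+1 -> 'M[R]_n)
    (p q : T) : \bar R :=
  ereal_inf (curve_length h @` [set c | [/\ C1_curve c, c 0 = p & c 1 = q]]).

Definition geodesic_ball (h : chart A -> 'rV[R]_n.+1 -> 'M[R]_n)
    (p : T) (r : R) : set T :=
  [set q | bdry q /\ (geodesic_distance h p q < r%:E)%E].

(* The topological boundary relative to M, which is closed in T. *)
Definition bdry_frontier (B : set T) : set T :=
  closure B `&` closure (bdry `\` B).

(* E(rho), computed in the chart i. *)
Definition Erho (gp : chart A -> 'rV[R]_n.+1 -> 'M[R]_n.+1) (rho : T -> R)
    (s : R) (i : chart A) (x : 'rV[R]_n.+1) : R :=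
  let r := rho \o point i in
  let v := fun y => r y `^ (n%:R - s) in
  r x `^ (- 1 - s) * (- laplacian (gp i) v x - s * (n%:R - s) * v x).

(* Classical solutions, continuous up to M. *)
Definition solution (gp gbar : chart A -> 'rV[R]_n.+1 -> 'M[R]_n.+1)
    (rho : T -> R) (a s : R) (f U : T -> R) : Prop :=
  [/\ continuous U,
      forall i : chart A, Ck 2 (coord i @` (dom i `&` inner)) (U \o point i),
      forall i p, dom i p -> inner p ->
        - divergence (gbar i) (fun y =>
            (rho (point i y) `^ a) *: gradient (gbar i) (U \o point i) y)
            (coord i p)
        + Erho gp rho s i (coord i p) * U p = 0 &
      forall q, bdry q -> U q = f q].

End Manifold.

(* Main.v *)
From HB Require Import structures.
Require Import Defs.
From mathcomp Require Import all_boot all_order all_algebra.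
From mathcomp Require Import all_classical all_reals all_analysis.
From mathcomp Require Import ring lra.
Import Order.TTheory GRing.Theory Num.Theory.
Import numFieldNormedType.Exports.
Local Open Scope classical_set_scope.
Local Open Scope ring_scope.

(** Near M the metric is gbar = drho^2 + h_rho, so |grad rho| = 1 there, and the
    conformal change from gp to gbar turns the potential into
    E(rho) = -(n - s) rho^(a - 1) Laplacian(rho) ([potential_formula]).  The
    theorem is then a Hopf lemma for the degenerate operator
    div(rho^a grad .) - E, and rests on one comparison principle for
    nonnegative solutions, applied twice ([comparison]).

    In the interior, the exponential barrier on an annulus shows that a solution
    which is positive at the centre of a coordinate ball is positive in the whole
    ball ([positivity_ball]); so positivity propagates along connected subsets of
    the interior of the collar ([connected_positivity]).  A curve of M from the
    centre p0 to q0 crosses the frontier of the ball of radius r0 / 2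
    ([frontier_on_curve]), where U > 0; pushing this curve inside along the
    normal geodesics shows that U > 0 on the normal geodesic of q0, close to M.

    At the boundary, rho^(2 gamma) is the solution of the model equation whose
    weighted normal derivative is a positive constant.  It is perturbed to
    rho^(2 gamma) (1 + B rho - M psi), with psi the squared coordinate distance to
    q0.  Since a + 2 gamma = 1, the field rho^a grad of this function is a
    combination of grad rho and grad psi with coefficients that are smooth up to
    M ([divergence_barrier]); hence it is a subsolution for B large, while the
    term in M makes it nonpositive on the lateral side of a small half ball.
    Comparison gives U >= kap rho^(2 gamma) on the normal geodesic of q0, for
    some kap > 0 ([boundary_lower_bound]), and by the mean value theorem the
    limit of rho^a d_rho U is then positive ([weighted_limit_pos]). *)

Set Implicit Arguments.
Unset Strict Implicit.
Unset Printing Implicit Defensive.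

(** * Functions of class C^1 and C^2 *)

Section C1.
Context {R : realType} {m : nat}.
Implicit Types (V : set 'rV[R]_m) (f g : 'rV[R]_m -> R) (x : 'rV[R]_m).

(** A one-constructor inductive type rather than a definition: when two instances
    are compared, unification stops at [C1] and does not unfold it into limits. *)
Variant C1 V f : Prop := C1_def of forall x, V x ->
  [/\ {for x, continuous f}, forall j, derivable f x (basis_vec j) &
      forall j, {for x, continuous ('D_(basis_vec j) f)}].

Lemma C1E V f : C1 V f -> forall x, V x ->
  [/\ {for x, continuous f}, forall j, derivable f x (basis_vec j) &
      forall j, {for x, continuous ('D_(basis_vec j) f)}].
Proof. by case. Qed.

Variant C2 V f : Prop := C2_def of C1 V f & forall j, C1 V ('D_(basis_vec j) f).

Lemma Ck_C1 V f : Ck 1 V f -> C1 V f.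
Proof.
move=> fV; split=> x Vx; split.
- by have [] := fV [::] x isT Vx.
- by have [_ /(_ isT)] := fV [::] x isT Vx.
- by move=> j; have [] := fV [:: j] x isT Vx.
Qed.

Lemma Ck_C2 V f : Ck 2 V f -> C2 V f.
Proof.
move=> fV; split.
  split=> x Vx; split.
  - by have [] := fV [::] x isT Vx.
  - by have [_ /(_ isT)] := fV [::] x isT Vx.
  - by move=> j; have [] := fV [:: j] x isT Vx.
move=> j; split=> x Vx; split.
- by have [] := fV [:: j] x isT Vx.
- by have [_ /(_ isT)] := fV [:: j] x isT Vx.
- by move=> k; have [] := fV [:: k; j] x isT Vx.
Qed.

Lemma C1_sub V V' f : V' `<=` V -> C1 V f -> C1 V' f.
Proof. by move=> VV [fV]; split=> x /VV; apply: fV. Qed.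

Lemma C2_sub V V' f : V' `<=` V -> C2 V f -> C2 V' f.
Proof. by move=> VV [f1 f2]; split; [exact: (C1_sub VV f1)|move=> j; exact: (C1_sub VV (f2 j))]. Qed.

Lemma C1_continuous V f x : C1 V f -> V x -> {for x, continuous f}.
Proof. by move=> [fV] /fV[]. Qed.

Lemma C1_derivable V f x j : C1 V f -> V x -> derivable f x (basis_vec j).
Proof. by move=> [fV] /fV[]. Qed.

Lemma C1_continuousD V f x j : C1 V f -> V x ->
  {for x, continuous ('D_(basis_vec j) f)}.
Proof. by move=> [fV] /fV[]. Qed.

Lemma C2_C1 V f : C2 V f -> C1 V f. Proof. by case. Qed.

Lemma C2_D V f j : C2 V f -> C1 V ('D_(basis_vec j) f). Proof. by case. Qed.

Lemma near_eq_on V f g x : open V -> V x -> {in V, f =1 g} ->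
  \near x, f x = g x.
Proof.
by move=> oV Vx fg; apply: filterS (open_nbhs_nbhs (conj oV Vx)) => y Vy;
  apply: fg; rewrite inE.
Qed.

Lemma continuous_ext_on V f g x : open V -> V x -> {in V, f =1 g} ->
  {for x, continuous f} -> {for x, continuous g}.
Proof.
move=> oV Vx fg cf; rewrite /prop_for /continuous_at -fg ?inE//.
exact: (cvg_trans (near_eq_cvg (near_eq_on oV Vx fg)) cf).
Qed.

Lemma derive_ext_on V f g x v : open V -> V x -> {in V, f =1 g} ->
  'D_v f x = 'D_v g x.
Proof.
move=> oV Vx fg; apply: near_eq_derive.
exact: near_eq_on oV Vx fg.
Qed.

Lemma derivable_ext_on V f g x v : open V -> V x -> {in V, f =1 g} ->
  derivable f x v -> derivable g x v.
Proof.
move=> oV Vx fg; apply: near_eq_derivable.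
exact: near_eq_on oV Vx fg.
Qed.

Lemma C1_ext V f g : open V -> {in V, f =1 g} -> C1 V f -> C1 V g.
Proof.
move=> oV fg [fV]; split=> x Vx; have [cf df cdf] := fV x Vx; split.
- exact: (continuous_ext_on oV Vx fg cf).
- by move=> j; exact: (derivable_ext_on oV Vx fg (df j)).
- move=> j; apply: (continuous_ext_on oV Vx _ (cdf j)) => y /set_mem Vy.
  exact: (derive_ext_on _ oV Vy fg).
Qed.

Lemma C2_ext V f g : open V -> {in V, f =1 g} -> C2 V f -> C2 V g.
Proof.
move=> oV fg [f1 f2]; split; first exact: (C1_ext oV fg f1).
move=> j; apply: (C1_ext oV _ (f2 j)) => y /set_mem Vy.
exact: (derive_ext_on _ oV Vy fg).
Qed.

Lemma C1I V f (df : 'I_m -> 'rV[R]_m -> R) : open V ->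
  (forall x, V x -> {for x, continuous f}) ->
  (forall x j, V x -> is_derive x (basis_vec j) f (df j x)) ->
  (forall x j, V x -> {for x, continuous (df j)}) -> C1 V f.
Proof.
move=> oV cf dfP cdf; split=> x Vx; split=> [|j|j]; first exact: cf.
  by have [] := dfP x j Vx.
apply: (continuous_ext_on oV Vx _ (cdf x j Vx)) => y /set_mem Vy.
by have [_ ->] := dfP y j Vy.
Qed.

Lemma C1_cst V c : C1 V (fun=> c).
Proof.
split=> x Vx; split=> [|j|j]; first exact: cst_continuous.
  exact: derivable_cst.
have -> : 'D_(basis_vec j) (fun=> c) = fun=> 0 :> R.
  by apply/funext => y; exact: derive_cst.
exact: cst_continuous.
Qed.

Lemma C1D V f g : open V -> C1 V f -> C1 V g -> C1 V (fun x => f x + g x).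
Proof.
move=> oV fV gV; apply: (@C1I _ _ (fun j x => 'D_(basis_vec j) f x + 'D_(basis_vec j) g x)) => //.
- by move=> x Vx; apply: continuousD; [exact: C1_continuous fV Vx|exact: C1_continuous gV Vx].
- by move=> x j Vx; apply: is_deriveD; apply/derivableP;
    [exact: C1_derivable fV Vx|exact: C1_derivable gV Vx].
- by move=> x j Vx; apply: continuousD; [exact: C1_continuousD fV Vx|exact: C1_continuousD gV Vx].
Qed.

Lemma C1M V f g : open V -> C1 V f -> C1 V g -> C1 V (fun x => f x * g x).
Proof.
move=> oV fV gV; apply: (@C1I _ _ (fun j x => f x * 'D_(basis_vec j) g x + g x * 'D_(basis_vec j) f x)) => //.
- by move=> x Vx; apply: continuousM; [exact: C1_continuous fV Vx|exact: C1_continuous gV Vx].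
- by move=> x j Vx; apply: is_deriveM; apply/derivableP;
    [exact: C1_derivable fV Vx|exact: C1_derivable gV Vx].
- move=> x j Vx; have [cf _ cdf] := C1E fV Vx; have [cg _ cdg] := C1E gV Vx.
  exact: (continuousD (continuousM cf (cdg j)) (continuousM cg (cdf j))).
Qed.

Lemma is_derive_line f (x v : 'rV[R]_m) (t d : R) :
  is_derive (t *: v + x) v f d -> is_derive t 1 (fun s => f (s *: v + x)) d.
Proof.
have E : (fun h : R => h^-1 *: (f (h *: v + (t *: v + x)) - f (t *: v + x))) =
    (fun h : R => h^-1 *: (f ((h *: 1 + t) *: v + x) - f (t *: v + x))).
  by apply/funext => h; rewrite [h *: 1]mulr1 scalerDl addrA.
by move=> [fd fD]; split; [move: fd|move: fD]; rewrite /derivable /derive /= E.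
Qed.

Lemma is_derive_line0 f (x v : 'rV[R]_m) (d : R) :
  is_derive (0 : R) 1 (fun s => f (s *: v + x)) d -> is_derive x v f d.
Proof.
have E : (fun h : R => h^-1 *: (f (h *: v + x) - f x)) =
    (fun h : R => h^-1 *: (f ((h *: 1 + 0) *: v + x) - f (0 *: v + x))).
  by apply/funext => h; rewrite [h *: 1]mulr1 addr0 scale0r add0r.
by move=> [fd fD]; split; [move: fd|move: fD]; rewrite /derivable /derive /= -E.
Qed.

Lemma C1_comp V f (phi dphi : R -> R) : open V -> C1 V f ->
  (forall x, V x -> is_derive (f x) 1 phi (dphi (f x))) ->
  (forall x, V x -> {for f x, continuous dphi}) ->
  C1 V (fun x => phi (f x)) /\
  (forall x j, V x -> 'D_(basis_vec j) (fun x => phi (f x)) x = dphi (f x) * 'D_(basis_vec j) f x).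
Proof.
move=> oV fV dP dC.
have main x j : V x -> is_derive x (basis_vec j) (fun x => phi (f x)) (dphi (f x) * 'D_(basis_vec j) f x).
  move=> Vx; apply: is_derive_line0.
  apply: (@is_derive1_comp _ phi (fun s : R => f (s *: basis_vec j + x))).
    by rewrite scale0r add0r; exact: dP.
  apply: is_derive_line; rewrite scale0r add0r; apply/derivableP; exact: C1_derivable fV Vx.
split; last by move=> x j Vx; have [_ ->] := main x j Vx.
apply: C1I main _ => // [x Vx|x j Vx].
- apply: (@continuous_comp _ _ _ f phi); first exact: C1_continuous fV Vx.
  by apply: differentiable_continuous; apply/derivable1_diffP; have [] := dP x Vx.
- apply: continuousM; last exact: C1_continuousD fV Vx.
  apply: (@continuous_comp _ _ _ f dphi); first exact: C1_continuous fV Vx.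
  exact: dC.
Qed.

Lemma derive_mul V f g x j : C1 V f -> C1 V g -> V x ->
  'D_(basis_vec j) (fun y => f y * g y) x =
  f x * 'D_(basis_vec j) g x + g x * 'D_(basis_vec j) f x.
Proof.
move=> fV gV Vx; have [_ fd _] := C1E fV Vx; have [_ gd _] := C1E gV Vx.
exact: (deriveM (fd j) (gd j)).
Qed.

Lemma derive_add V f g x j : C1 V f -> C1 V g -> V x ->
  'D_(basis_vec j) (fun y => f y + g y) x =
  'D_(basis_vec j) f x + 'D_(basis_vec j) g x.
Proof.
move=> fV gV Vx; have [_ fd _] := C1E fV Vx; have [_ gd _] := C1E gV Vx.
exact: (deriveD (fd j) (gd j)).
Qed.

Lemma derive_scale V c f x j : C1 V f -> V x ->
  'D_(basis_vec j) (fun y => c * f y) x = c * 'D_(basis_vec j) f x.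
Proof.
move=> fV Vx; have [_ fd _] := C1E fV Vx; exact: (deriveZ c (fd j)).
Qed.

Lemma C1_sum V I (r : seq I) (P : pred I) (F : I -> 'rV[R]_m -> R) : open V ->
  (forall i, P i -> C1 V (F i)) -> C1 V (fun x => \sum_(i <- r | P i) F i x).
Proof.
move=> oV FV; rewrite (_ : (fun x => _) = \big[(fun f g x => f x + g x)/(fun=> 0)]_(i <- r | P i) F i).
  by elim/big_rec : _ => [|i f Pi fV]; [exact: C1_cst|apply: C1D => //; exact: FV].
by apply/funext => x; elim/big_rec2 : _ => // i y f _ ->.
Qed.

Lemma C1_prod V I (r : seq I) (P : pred I) (F : I -> 'rV[R]_m -> R) : open V ->
  (forall i, P i -> C1 V (F i)) -> C1 V (fun x => \prod_(i <- r | P i) F i x).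
Proof.
move=> oV FV; rewrite (_ : (fun x => _) = \big[(fun f g x => f x * g x)/(fun=> 1)]_(i <- r | P i) F i).
  by elim/big_rec : _ => [|i f Pi fV]; [exact: C1_cst|apply: C1M => //; exact: FV].
by apply/funext => x; elim/big_rec2 : _ => // i y f _ ->.
Qed.

Lemma C1Z V c f : open V -> C1 V f -> C1 V (fun x => c * f x).
Proof. by move=> oV fV; apply: C1M => //; exact: C1_cst. Qed.

Lemma is_derive_coord x v k : is_derive x v (fun y => y ord0 k) (v ord0 k).
Proof.
apply: is_derive_line0.
have H1 := is_deriveM (is_derive_id (0 : R) (1 : R)) (is_derive_cst (v ord0 k) (0 : R) (1 : R)).
have H := is_deriveD H1 (is_derive_cst (x ord0 k) (0 : R) (1 : R)).
rewrite (_ : (fun s : R => _) = ((@id R) * cst (v ord0 k)) + cst (x ord0 k)); last first.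
  by apply/funext => s; rewrite !mxE.
apply: (is_derive_eq H).
by rewrite /= scaler0 add0r addr0 [_ *: 1]mulr1.
Qed.

Lemma C1_coord V k : open V -> C1 V (fun y => y ord0 k).
Proof.
move=> oV; apply: (C1I (df := fun j _ => basis_vec j ord0 k) oV).
- by move=> x _; exact: coord_continuous.
- by move=> x j _; exact: is_derive_coord.
- by move=> x j _; exact: cst_continuous.
Qed.

Lemma C1_inv V f : open V -> C1 V f -> (forall x, V x -> f x != 0) ->
  C1 V (fun x => (f x)^-1).
Proof.
move=> oV fV f0.
apply: (proj1 (@C1_comp _ _ (fun t => t^-1) (fun t => - t ^- 2) oV fV _ _)).
- move=> x Vx; have fx := f0 x Vx; apply: DeriveDef.
    by apply: (@derivableV _ _ id) => //; exact: derivable_id.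
  by rewrite (@deriveV _ _ id)// derive_id [_ *: _]mulr1.
- move=> x Vx; apply: continuousN; apply: (@continuousV _ _ (fun t : R => t ^+ 2)).
    by rewrite expf_neq0// f0.
  exact: exprn_continuous.
Qed.

Lemma C1_powR V f p : open V -> C1 V f -> (forall x, V x -> 0 < f x) ->
  C1 V (fun x => f x `^ p) /\
  (forall x j, V x -> 'D_(basis_vec j) (fun x => f x `^ p) x = p * f x `^ (p - 1) * 'D_(basis_vec j) f x).
Proof.
move=> oV fV f0.
apply: (@C1_comp _ _ (fun t => t `^ p) (fun t => p * t `^ (p - 1)) oV fV _ _).
- by move=> x Vx; apply: is_derive1_powR; exact: f0.
- move=> x Vx; apply: continuousM; first exact: cst_continuous.
  apply: differentiable_continuous; apply/derivable1_diffP.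
  by have [] := is_derive1_powR (p - 1) (f0 x Vx).
Qed.

Lemma C1_sqrt V f : open V -> C1 V f -> (forall x, V x -> 0 < f x) ->
  C1 V (fun x => Num.sqrt (f x)).
Proof.
move=> oV fV f0; apply: C1_ext (proj1 (C1_powR 2^-1 oV fV f0)) => //.
by move=> x /set_mem Vx /=; rewrite powR12_sqrt// ltW// f0.
Qed.

Lemma C1_det k V (A : 'rV[R]_m -> 'M[R]_k) : open V ->
  (forall i j, C1 V (fun x => A x i j)) -> C1 V (fun x => \det (A x)).
Proof.
move=> oV AV; apply: C1_sum => // s _; apply: C1Z => //.
by apply: C1_prod => // i _; exact: AV.
Qed.

Lemma C1_invmx k V (A : 'rV[R]_m -> 'M[R]_k) : open V ->
  (forall i j, C1 V (fun x => A x i j)) ->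
  (forall x, V x -> \det (A x) != 0) ->
  forall i j, C1 V (fun x => invmx (A x) i j).
Proof.
move=> oV AV A0 i j.
apply: (@C1_ext _ (fun x => (\det (A x))^-1 * \adj (A x) i j)) => //.
  by move=> x /set_mem Vx; rewrite /invmx unitmxE unitfE A0// [RHS]mxE.
apply: C1M => //; first by apply: C1_inv => //; exact: C1_det.
rewrite (_ : (fun x => _) = fun x => (-1) ^+ (j + i) * \det (row' j (col' i (A x)))).
  apply: C1Z => //; apply: C1_det => // a b.
  rewrite (_ : (fun x => _) = fun x => A x (lift j a) (lift i b)) //.
  by apply/funext => x; rewrite !mxE.
by apply/funext => x; rewrite mxE.
Qed.

Lemma C2_cst V c : C2 V (fun=> c).
Proof.
split; first exact: C1_cst.
move=> j; have -> : 'D_(basis_vec j) (fun=> c) = fun=> 0 :> R.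
  by apply/funext => y; exact: derive_cst.
exact: C1_cst.
Qed.

Lemma C2_coord V k : open V -> C2 V (fun y => y ord0 k).
Proof.
move=> oV; split=> [|j]; first exact: C1_coord.
apply: (C1_ext oV _ (C1_cst V (basis_vec j ord0 k))) => y _.
by have [_ ->] := is_derive_coord y (basis_vec j) k.
Qed.

Lemma C2D V f g : open V -> C2 V f -> C2 V g -> C2 V (fun x => f x + g x).
Proof.
move=> oV [f1 f2] [g1 g2]; split=> [|j]; first exact: C1D.
apply: (C1_ext oV _ (C1D oV (f2 j) (g2 j))) => y /set_mem Vy.
by rewrite (derive_add j f1 g1 Vy).
Qed.

Lemma C2M V f g : open V -> C2 V f -> C2 V g -> C2 V (fun x => f x * g x).
Proof.
move=> oV [f1 f2] [g1 g2]; split=> [|j]; first exact: C1M.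
apply: (C1_ext oV _ (C1D oV (C1M oV f1 (g2 j)) (C1M oV g1 (f2 j)))) => y /set_mem Vy.
by rewrite (derive_mul j f1 g1 Vy).
Qed.

Lemma C2Z V c f : open V -> C2 V f -> C2 V (fun x => c * f x).
Proof. by move=> oV fV; apply: C2M => //; exact: C2_cst. Qed.

Lemma C2B V f g : open V -> C2 V f -> C2 V g -> C2 V (fun x => f x - g x).
Proof.
move=> oV fV gV; apply: (C2_ext oV _ (C2D oV fV (C2Z (-1) oV gV))) => y _.
by rewrite mulN1r.
Qed.

Lemma C2_sum V I (r : seq I) (P : pred I) (F : I -> 'rV[R]_m -> R) : open V ->
  (forall i, P i -> C2 V (F i)) -> C2 V (fun x => \sum_(i <- r | P i) F i x).
Proof.
move=> oV FV; rewrite (_ : (fun x => _) = \big[(fun f g x => f x + g x)/(fun=> 0)]_(i <- r | P i) F i).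
  by elim/big_rec : _ => [|i f Pi fV]; [exact: C2_cst|apply: C2D => //; exact: FV].
by apply/funext => x; elim/big_rec2 : _ => // i y f _ ->.
Qed.

Lemma C2_powR V f p : open V -> C2 V f -> (forall x, V x -> 0 < f x) ->
  C2 V (fun x => f x `^ p).
Proof.
move=> oV [f1 f2] f0; have [p1 pD] := C1_powR p oV f1 f0; split => // j.
have [q1 _] := C1_powR (p - 1) oV f1 f0.
apply: (C1_ext oV _ (C1M oV (C1Z p oV q1) (f2 j))) => y /set_mem Vy.
by rewrite pD.
Qed.

Lemma C1_expR V f : open V -> C1 V f ->
  C1 V (fun x => expR (f x)) /\
  (forall x j, V x -> 'D_(basis_vec j) (fun x => expR (f x)) x = expR (f x) * 'D_(basis_vec j) f x).
Proof.
move=> oV fV; apply: (@C1_comp V f expR expR oV fV) => x Vx.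
exact: continuous_expR.
Qed.

Lemma C2_expR V f : open V -> C2 V f -> C2 V (fun x => expR (f x)).
Proof.
move=> oV [f1 f2]; have [e1 eD] := C1_expR oV f1; split => // j.
apply: (C1_ext oV _ (C1M oV e1 (f2 j))) => y /set_mem Vy.
by rewrite eD.
Qed.

End C1.

(** * Differentiability and the second derivative test *)

Section Diff.
Context {R : realType} {m : nat}.
Implicit Types (V : set 'rV[R]_m) (f g : 'rV[R]_m -> R) (x h : 'rV[R]_m).

(** The mean value inequality for [fun t => g t - t * d], on a segment with the
    endpoint 0 and another endpoint [c] of any sign. *)
Lemma increment_le (g dg : R -> R) (c d e : R) :
  (forall t : R, `|t| <= `|c| -> is_derive t 1 g (dg t) /\ `|dg t - d| <= e) ->
  `|g c - g 0 - c * d| <= e * `|c|.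
Proof.
move=> gP.
have gi (t : R) : `|t| <= `|c| -> is_derive t 1 g (dg t) by move=> /gP[].
have gb (t : R) : `|t| <= `|c| -> `|dg t - d| <= e by move=> /gP[].
have gder (t : R) : `|t| <= `|c| -> derivable g t 1 by move=> /gP[[]].
have [c0|c0|c0] := ltrgt0P c; last by rewrite c0 subrr mul0r subr0 normr0 mulr0.
- have gd t : t \in `]0, c[%R -> is_derive t 1 g (dg t).
    by rewrite in_itv/= => /andP[t0 tc]; apply: gi; rewrite !gtr0_norm// ltW.
  have cg : {within `[0, c], continuous g}.
    apply: derivable_within_continuous => t; rewrite in_itv/= => /andP[t0 tc].
    by apply: gder; rewrite (gtr0_norm c0) ger0_norm.
  have [t] := MVT_segment (ltW c0) gd cg.
  rewrite in_itv/= => /andP[t0 tc] ->.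
  rewrite subr0 [dg t * c]mulrC -mulrBr normrM (gtr0_norm c0) mulrC.
  apply: ler_wpM2r; first exact: ltW.
  by apply: gb; rewrite (gtr0_norm c0) ger0_norm.
- have gd t : t \in `]c, 0[%R -> is_derive t 1 g (dg t).
    by rewrite in_itv/= => /andP[t0 tc]; apply: gi; rewrite !ltr0_norm// lerN2 ltW.
  have cg : {within `[c, 0], continuous g}.
    apply: derivable_within_continuous => t; rewrite in_itv/= => /andP[t0 tc].
    by apply: gder; rewrite (ltr0_norm c0) ler0_norm// lerN2.
  have [t] := MVT_segment (ltW c0) gd cg.
  rewrite in_itv/= => /andP[t0 tc] E.
  have -> : g c - g 0 - c * d = c * (dg t - d).
    by rewrite -[g c - g 0]opprB E sub0r; ring.
  rewrite normrM (ltr0_norm c0) mulrC.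
  apply: ler_wpM2r; first by rewrite oppr_ge0 ltW.
  by apply: gb; rewrite (ltr0_norm c0) ler0_norm// lerN2.
Qed.

Definition truncv h (k : nat) : 'rV[R]_m :=
  \row_j if (j < k)%N then h ord0 j else 0.

Lemma truncvS h (k : 'I_m) :
  truncv h k.+1 = h ord0 k *: basis_vec k + truncv h k.
Proof.
apply/rowP => j; rewrite !mxE eqxx /= ltnS leq_eqVlt.
rewrite -val_eqE /=; case: (ltngtP j k) => [||/val_inj ->]; rewrite ?mulr0 ?add0r ?mulr1 ?addr0//.
Qed.

(** The coordinates are changed one at a time, and the mean value theorem is
    applied on each segment.  For the sup norm, all the intermediate points stay
    in every ball around [x] that contains [h + x]. *)
Lemma C1_increment V f x (e : R) : open V -> V x -> C1 V f -> 0 < e ->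
  \forall h \near (0 : 'rV[R]_m),
   `|f (h + x) - f x - \sum_k h ord0 k * 'D_(basis_vec k) f x| <= e * `|h|.
Proof.
move=> oV Vx fV e0.
have em : 0 < e / m.+1%:R by rewrite divr_gt0.
have : \forall y \near x, V y /\ forall k, `|'D_(basis_vec k) f y - 'D_(basis_vec k) f x| <= e / m.+1%:R.
  near=> y; split; first by near: y; exact: open_nbhs_nbhs.
  near: y; apply: filter_forall => k.
  have /cvgrPdist_le/(_ _ em) := C1_continuousD (j := k) fV Vx.
  by apply: filterS => y; rewrite distrC.
move=> /nbhs_ballP[d /= d0 dP].
have coordle h k : `|h ord0 k| <= `|h|.
  rewrite [leRHS]mx_normrE; apply/le_trans/(@le_bigmax _ _ _ _ _ (ord0, k)) => //=.
have nd := @nbhs0_lt R 'rV[R]_m d d0.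
near=> h.
have hd : `|h| < d by near: h; exact: nd.
have inball (k : 'I_m) (t : R) : `|t| <= `|h ord0 k| ->
    ball x d (t *: basis_vec k + (truncv h k + x)).
  move=> tk; rewrite -ball_normE /ball_ /= addrA opprD addrCA subrr addr0.
  rewrite normrN; apply: le_lt_trans hd.
  rewrite [leLHS]mx_normrE; apply/bigmax_leP; split => //= -[i j] _ /=.
  rewrite /basis_vec !mxE (ord1 i) eqxx /=.
  have [->|jk] := eqVneq j k; first by rewrite ltnn mulr1 addr0 (le_trans tk).
  rewrite mulr0 add0r; case: ifP => _; first exact: coordle.
  by rewrite normr0.
have -> : f (h + x) - f x = \sum_(0 <= k < m) (f (truncv h k.+1 + x) - f (truncv h k + x)).
  rewrite telescope_sumr//; congr (f _ - f _).
    by congr (_ + _); apply/rowP => j; rewrite mxE ltn_ord.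
  by rewrite [truncv h 0](_ : _ = 0) ?add0r//; apply/rowP => j; rewrite !mxE.
rewrite big_mkord -sumrB (le_trans (ler_norm_sum _ _ _))//.
apply: (@le_trans _ _ (\sum_(k < m) e / m.+1%:R * `|h|)).
  apply: ler_sum => k _; rewrite truncvS -addrA.
  apply: (@le_trans _ _ (e / m.+1%:R * `|h ord0 k|)); last by rewrite ler_wpM2l// ltW.
  rewrite -[f (truncv h k + x)](congr1 f (add0r _)) -{1}(scale0r (basis_vec k)) -addrA addrA.
  apply: (@increment_le (fun t => f (t *: basis_vec k + (truncv h k + x)))
    (fun t => 'D_(basis_vec k) f (t *: basis_vec k + (truncv h k + x)))).
  move=> t tk; have [Vy] := dP _ (inball k t tk); move=> /(_ k) ?; split => //.
  by apply: is_derive_line; apply/derivableP; exact: C1_derivable fV Vy.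
rewrite sumr_const card_ord -[leLHS]mulr_natl mulrA ler_wpM2r//.
rewrite mulrCA -ler_pdivlMl// mulVf ?gt_eqF// ler_pdivrMr// mul1r ler_nat.
exact: leqnSn.
Unshelve. all: by end_near. Qed.

Lemma C1_differentiable_D V f x : open V -> V x -> C1 V f ->
  differentiable f x /\
  'd f x = (fun h : 'rV[R]_m => \sum_k h ord0 k * 'D_(basis_vec k) f x) :> (_ -> _).
Proof.
move=> oV Vx fV.
pose d h := \sum_k h ord0 k * 'D_(basis_vec k) f x.
have lin_d : linear d.
  move=> c u v; rewrite /d scaler_sumr -big_split /=; apply: eq_bigr => k _.
  by rewrite !mxE mulrDl scalerAl.
pose dM := GRing.isLinear.Build _ _ _ _ _ lin_d.
pose dL : {linear _ -> _} := HB.pack d dM.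
have cd : continuous d.
  move=> y; apply: (@C1_continuous _ _ setT) => //; apply: C1_sum => [|k _].
    exact: openT.
  by apply: C1M; [exact: openT|apply: C1_coord; exact: openT|exact: C1_cst].
have dE : f \o shift x = cst (f x) + dL +o_ (0 : 'rV[R]_m) id.
  apply/eqaddoP => e e0.
  have := C1_increment oV Vx fV e0; apply: filterS => h.
  by rewrite /= opprD addrA.
have dfE := diff_unique (df := dL) cd dE.
by split => //; apply/diff_locallyP; rewrite dfE; split.
Qed.

Lemma C1_is_derive V f x v : open V -> V x -> C1 V f ->
  is_derive x v f (\sum_k v ord0 k * 'D_(basis_vec k) f x).
Proof.
move=> oV Vx fV; have [fd fD] := C1_differentiable_D oV Vx fV.
by apply: DeriveDef; [exact: diff_derivable|rewrite deriveE// fD].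
Qed.

Lemma C1_is_derive_curve V f (c : R -> 'rV[R]_m) (t : R) (dc : 'rV[R]_m) :
  open V -> V (c t) -> C1 V f ->
  (forall k, is_derive t 1 (fun s => c s ord0 k) (dc ord0 k)) ->
  is_derive t 1 (fun s => f (c s)) (\sum_k dc ord0 k * 'D_(basis_vec k) f (c t)).
Proof.
move=> oV Vx fV cP.
have [fd fD] := C1_differentiable_D oV Vx fV.
have cder : derivable c t 1.
  by apply/derivable_mxP => i j; rewrite (ord1 i); have [] := cP j.
have cdiff : differentiable c t by apply/derivable1_diffP.
have Dc : 'D_1 c t = dc.
  rewrite derive_mx//; apply/rowP => j; rewrite mxE.
  by have [_ <-] := cP j.
apply: DeriveDef.
  by apply/derivable1_diffP; apply: (@differentiable_comp _ _ _ _ c f).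
have fcd : differentiable (f \o c) t by exact: differentiable_comp.
rewrite -[fun s => _]/(f \o c) deriveE// diff_comp//= fD.
by rewrite -deriveE// Dc.
Qed.

Lemma is_derive_fsum n (F : 'I_n -> 'rV[R]_m -> R) (dF : 'I_n -> R) x v :
  (forall i, is_derive x v (F i) (dF i)) ->
  is_derive x v (fun y => \sum_(i < n) F i y) (\sum_(i < n) dF i).
Proof.
move=> FP; rewrite (_ : (fun y => _) = \sum_(i < n) F i); first exact: is_derive_sum.
by apply/funext => y; rewrite fct_sumE.
Qed.

(** The first derivative vanishes at the minimum; if [d] were negative, then [g1]
    would be negative on some interval at the right of 0, and by the mean value
    theorem [g] would take there values below [g 0]. *)
Lemma second_derivative_min (g g1 : R -> R) (d e : R) : 0 < e ->
  (forall t : R, `|t| < e -> is_derive t 1 g (g1 t)) ->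
  is_derive (0 : R) 1 g1 d -> (forall t, `|t| < e -> g 0 <= g t) ->
  g1 0 = 0 /\ 0 <= d.
Proof.
move=> e0 gP g1P gmin.
have ine t : t \in `]- e, e[%R -> `|t| < e by rewrite in_itv/= ltr_norml.
have g10 : g1 0 = 0.
  have D0 : is_derive (0 : R) 1 g 0.
    apply: (@derive1_at_min _ g (- e) e).
    - by rewrite ge0_cp// ltW.
    - by move=> t /ine te; have [] := gP t te.
    - by rewrite in_itv/= oppr_lt0 e0.
    - by move=> t /ine; exact: gmin.
  have [|_ <-] := gP 0; first by rewrite normr0.
  by have [_ ->] := D0.
split => //; rewrite leNgt; apply/negP => d0.
have [g1d g1D] := g1P.
have d20 : 0 < - (d / 2) by lra.
have [r /= r0 rP] : \forall h \near (0 : R)^', h^-1 *: (g1 (h *: 1 + 0) - g1 0) < d / 2.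
  have cv : (fun h : R => h^-1 *: (g1 (h *: 1 + 0) - g1 0)) @ (0 : R)^' --> d.
    by rewrite -g1D; exact: g1d.
  have /cvgrPdist_lt/(_ _ d20) := cv; apply: filterS => h.
  by rewrite ltr_norml => /andP[+ _]; lra.
have g1neg (h : R) : 0 < h -> h < r -> g1 h < 0.
  move=> h0 hr; have := rP h; rewrite /= sub0r normrN gtr0_norm// => /(_ hr).
  rewrite gt_eqF// => /(_ isT); rewrite [h *: 1]mulr1 addr0 g10 subr0 => H.
  by have : h * (h^-1 * g1 h) < 0; [rewrite pmulr_rlt0//; apply: lt_trans H _; lra|rewrite mulVKf ?gt_eqF].
pose b := Num.min r e / 2.
have b0 : 0 < b by rewrite divr_gt0// lt_min r0.
have [br be] : b < r /\ b < e.
  have : Num.min r e <= r /\ Num.min r e <= e by rewrite !ge_min !lexx orbT.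
  by move: b0; rewrite /b; lra.
have gc : {within `[0, b], continuous g}.
  apply: derivable_within_continuous => t; rewrite in_itv/= => /andP[t0 tb].
  by have [] := gP t; rewrite ?ger0_norm//; lra.
have gi t : t \in `]0, b[%R -> is_derive t 1 g (g1 t).
  by rewrite in_itv/= => /andP[t0 tb]; apply: gP; rewrite gtr0_norm//; lra.
have [c] := MVT b0 gi gc; rewrite in_itv/= => /andP[c0 cb] E.
have := gmin b; rewrite gtr0_norm// => /(_ be).
have : g1 c * (b - 0) < 0 by rewrite subr0 pmulr_llt0//; apply: g1neg => //; lra.
by rewrite -E; lra.
Qed.

(** The second derivative test on each line through [x]. *)
Lemma C2_min V f x v : open V -> V x -> C2 V f -> (forall y, V y -> f x <= f y) ->
  'D_v f x = 0 /\
  0 <= \sum_k \sum_l v ord0 k * v ord0 l * 'D_(basis_vec k) ('D_(basis_vec l) f) x.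
Proof.
move=> oV Vx [f1 f2] fmin.
have /nbhs_ballP[d /= d0 dP] := open_nbhs_nbhs (conj oV Vx).
pose e := d / (`|v| + 1).
have v1 : 0 < `|v| + 1 by rewrite ltr_wpDl.
have e0 : 0 < e by rewrite divr_gt0.
have inV (t : R) : `|t| < e -> V (t *: v + x).
  move=> te; apply: dP; rewrite -ball_normE /ball_ /= opprD addrCA subrr addr0.
  rewrite normrN normrZ; apply: (@le_lt_trans _ _ (`|t| * (`|v| + 1))).
    by rewrite ler_wpM2l// lerDl.
  by rewrite -ltr_pdivlMr.
pose g1 y := \sum_l v ord0 l * 'D_(basis_vec l) f y.
have [g10 g1d] : g1 (0 *: v + x) = 0 /\ 0 <= \sum_l v ord0 l * \sum_k v ord0 k * 'D_(basis_vec k) ('D_(basis_vec l) f) x.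
  apply: (@second_derivative_min (fun t => f (t *: v + x)) (fun t => g1 (t *: v + x)) _ e) => //.
  - move=> t te; apply: is_derive_line.
    by apply: (C1_is_derive _ oV _ f1); exact: inV.
  - apply: is_derive_line; rewrite scale0r add0r; apply: is_derive_fsum => l.
    exact: (is_deriveZ _ (C1_is_derive v oV Vx (f2 l))).
  - by move=> t /inV Vt; rewrite scale0r add0r; exact: fmin.
split.
  have [_ ->] := C1_is_derive v oV Vx f1.
  by rewrite -[RHS]g10 scale0r add0r.
rewrite (_ : \sum_k _ = \sum_l v ord0 l * \sum_k v ord0 k * 'D_(basis_vec k) ('D_(basis_vec l) f) x) //.
rewrite exchange_big /=; apply: eq_bigr => l _; rewrite big_distrr /=.
by apply: eq_bigr => k _; rewrite mulrA [v ord0 k * _]mulrC.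
Qed.

End Diff.

(** * Positive definite matrices *)

Section Trace.
Context {R : realType}.
Local Notation form := Defs.form.

Lemma formE m (G : 'M[R]_m) (u v : 'rV[R]_m) :
  form G u v = \sum_k \sum_l u ord0 k * v ord0 l * G k l.
Proof.
rewrite /form mxE exchange_big /=; apply: eq_bigr => l _.
rewrite !mxE big_distrl /=; apply: eq_bigr => k _.
by rewrite mulrAC.
Qed.

Lemma inner_product_unit m (G : 'M[R]_m) : inner_product G -> G \in unitmx.
Proof.
move=> [_ Gpos]; rewrite unitmxE unitfE; apply/negP => /det0P[v v0 vG].
by have := Gpos v v0; rewrite /form vG mul0mx mxE ltxx.
Qed.

Lemma inner_product_inv m (G : 'M[R]_m) : inner_product G -> inner_product (invmx G).
Proof.
move=> Gin; have Gu := inner_product_unit Gin; case: Gin => Gs Gpos; split.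
  by rewrite trmx_inv Gs.
move=> v v0; have := Gpos (v *m invmx G).
have -> : form G (v *m invmx G) (v *m invmx G) = form (invmx G) v v.
  by rewrite /form trmx_mul trmx_inv Gs mulmxKV// mulmxA.
apply; apply: contra v0 => /eqP E.
by rewrite -[v](mulmxKV Gu) E mul0mx.
Qed.

Lemma form_sub m (G : 'M[R]_m) (u v : 'rV[R]_m) (t : R) :
  form G (u - t *: v) (u - t *: v) =
  form G u u - t * (form G u v + form G v u) + t ^+ 2 * form G v v.
Proof.
rewrite !formE [X in t * X]addrC -!big_split /= !mulr_sumr -sumrB -big_split /=.
apply: eq_bigr => k _; rewrite -!big_split /= !mulr_sumr -sumrB -big_split /=.
by apply: eq_bigr => l _; rewrite !mxE; ring.
Qed.

(** Induction on the dimension: the Schur complement of the upper left entry is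
    positive definite, since its form at [w] is the value of the form of [G] at
    the vector with tail [w] that minimizes it. *)
Lemma inner_product_cholesky m (G : 'M[R]_m) : inner_product G ->
  exists C : 'M[R]_m, G = C^T *m C.
Proof.
elim: m G => [|m IH] G [Gs Gpos].
  by exists 0; apply/matrixP => -[].
rewrite -[m.+1]/(1 + m)%N in G Gs Gpos *.
pose a := ulsubmx G 0 0; pose b := ursubmx G; pose D := drsubmx G.
have GE : G = block_mx a%:M b b^T D.
  rewrite -[LHS]submxK; congr block_mx; first exact: mx11_scalar.
  by rewrite /b trmx_ursub Gs.
have Ds : D^T = D by rewrite /D trmx_drsub Gs.
have Gval (t : R) (w : 'rV[R]_m) : form G (row_mx t%:M w) (row_mx t%:M w) =
   a * t ^+ 2 + 2 * t * (w *m b^T) 0 0 + form D w w.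
  rewrite /form GE mul_row_block tr_row_mx mul_row_col !mulmxDl tr_scalar_mx.
  rewrite -scalar_mxM !mul_scalar_mx !mxE /=.
  have -> : \sum_(j < m) (t *: b) ord0 j * w^T j ord0 = t * \sum_(j < m) w 0 j * b^T j 0.
    by rewrite big_distrr /=; apply: eq_bigr => j _; rewrite !mxE; ring.
  rewrite big_ord1; have -> : (w *m b^T) ord0 0 = \sum_(j < m) w 0 j * b^T j 0 by rewrite mxE.
  by rewrite [t%:M _ _]mxE eqxx !mulr1n; ring.
have a0 : 0 < a.
  have := Gpos (row_mx 1%:M 0); rewrite Gval mul0mx mxE /form mul0mx mul0mx mxE.
  rewrite expr1n !mulr1 mulr0 !addr0; apply.
  apply/eqP => /rowP /(_ (lshift m ord0)) /eqP.
  by rewrite row_mxEl !mxE oner_eq0.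
have [Cs CsE] : exists Cs : 'M[R]_m, D - a^-1 *: (b^T *m b) = Cs^T *m Cs.
  apply: IH; split.
    by rewrite linearB /= linearZ /= trmx_mul trmxK Ds.
  move=> w w0.
  (* For a fixed tail w, the form of G is minimal at this value of the head. *)
  have := Gpos (row_mx (- (a^-1 * (w *m b^T) 0 0))%:M w).
  rewrite Gval; set beta := (w *m b^T) 0 0 => H.
  have -> : form (D - a^-1 *: (b^T *m b)) w w = form D w w - a^-1 * beta ^+ 2.
    rewrite /form mulmxBr mulmxBl [LHS]mxE; congr (_ + _).
    rewrite [LHS]mxE; congr (- _).
    have bw : b *m w^T = beta%:M.
      by rewrite -[b]trmxK -trmx_mul [w *m _]mx11_scalar tr_scalar_mx.
    rewrite -scalemxAr -scalemxAl -mulmxA -mulmxA bw mulmxA [w *m _]mx11_scalar -/beta -scalar_mxM.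
    by rewrite !mxE eqxx mulr1n expr2.
  have := H _; have -> : a * (- (a^-1 * beta)) ^+ 2 + 2 * (- (a^-1 * beta)) * beta = - (a^-1 * beta ^+ 2).
    by field; rewrite gt_eqF.
  rewrite addrC; apply.
  apply: contra w0 => /eqP/rowP E; apply/eqP/rowP => j.
  by have := E (rshift 1 j); rewrite row_mxEr !mxE.
exists (block_mx (Num.sqrt a)%:M ((Num.sqrt a)^-1 *: b) 0 Cs).
have sa : Num.sqrt a != 0 by rewrite gt_eqF ?sqrtr_gt0.
rewrite GE tr_block_mx mulmx_block !trmx0 tr_scalar_mx !mul0mx !addr0 !mulmx0 ?addr0.
rewrite -scalar_mxM -expr2 sqr_sqrtr ?ltW//; congr block_mx.
- by rewrite mul_scalar_mx scalerA divff// scale1r.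
- by rewrite linearZ /= mul_mx_scalar scalerA divff// scale1r.
- have -> : ((Num.sqrt a)^-1 *: b)^T = (Num.sqrt a)^-1 *: b^T by rewrite linearZ.
  rewrite -CsE -scalemxAl -scalemxAr scalerA -invfM -expr2 sqr_sqrtr ?ltW//.
  by rewrite addrC subrK.
Qed.

Lemma inner_product_det m (G : 'M[R]_m) : inner_product G -> 0 < \det G.
Proof.
move=> Gin; have [C GE] := inner_product_cholesky Gin.
have := inner_product_unit Gin; rewrite unitmxE unitfE lt0r => ->.
by rewrite GE det_mulmx det_tr -expr2 sqr_ge0.
Qed.

(** With [A = C^T *m C], the sum is the sum of the values of the form of [H] on
    the rows of [C]. *)
Lemma trace_form_ge0 m (A H : 'M[R]_m) : inner_product A ->
  (forall v : 'rV[R]_m, 0 <= form H v v) -> 0 <= \sum_k \sum_l A k l * H k l.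
Proof.
move=> /inner_product_cholesky[C ->] Hpos.
have -> : \sum_k \sum_l (C^T *m C) k l * H k l = \sum_p form H (row p C) (row p C).
  under [RHS]eq_bigr do rewrite formE.
  rewrite [RHS]exchange_big /=; apply: eq_bigr => k _.
  rewrite [RHS]exchange_big /=; apply: eq_bigr => l _.
  rewrite mxE big_distrl /=; apply: eq_bigr => p _.
  by rewrite !mxE.
by apply: sumr_ge0 => p _; exact: Hpos.
Qed.

(** The entries of [G] bound its form by [c * m] times the squared Euclidean norm.
    The bound for the inverse follows from the nonnegativity of the form of [G]
    at [v *m invmx G - t *: v], which plays the part of the Cauchy-Schwarz
    inequality; [t] is taken to be the inverse of [c * m]. *)
Lemma inner_product_inv_ge m (G : 'M[R]_m) (v : 'rV[R]_m) (c : R) : inner_product G ->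
  (forall k l, `|G k l| <= c) ->
  \sum_k v ord0 k ^+ 2 <= c * m%:R * form (invmx G) v v.
Proof.
move=> Gin Gc; have [->|v0] := eqVneq v 0.
  rewrite big1 ?/form ?mul0mx ?mxE ?mulr0// => k _; by rewrite mxE expr0n.
have Gu := inner_product_unit Gin.
set N := \sum_k _; set Q := form _ _ _.
have [Gs Gpos] := Gin.
pose P := form G v v.
have P0 : 0 < P by exact: Gpos.
have PN : P <= c * m%:R * N.
  rewrite /P formE.
  apply: (@le_trans _ _ (\sum_k \sum_l c * ((v ord0 k ^+ 2 + v ord0 l ^+ 2) / 2))).
    apply: ler_sum => k _; apply: ler_sum => l _.
    apply: le_trans (ler_norm _) _; rewrite normrM mulrC.
    apply: ler_pM => //.
    rewrite normrM -(real_normK (num_real (v ord0 k))) -(real_normK (num_real (v ord0 l))).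
    rewrite ler_pdivlMr//; have := sqr_ge0 (`|v ord0 k| - `|v ord0 l|); nra.
  under eq_bigr do rewrite -mulr_sumr -mulr_suml big_split /= sumr_const card_ord -/N.
  rewrite -mulr_sumr -mulr_suml big_split /= sumr_const card_ord sumrMnl -/N.
  by rewrite -[N *+ m]mulr_natl; lra.
have N0 : 0 <= N by apply: sumr_ge0 => k _; exact: sqr_ge0.
have cm : 0 < c * m%:R.
  have := lt_le_trans P0 PN; have [N0'|] := eqVneq N 0; first by rewrite N0' mulr0 ltxx.
  by move=> N0'; rewrite pmulr_lgt0// lt0r N0' N0.
have main (t : R) : 0 <= Q - 2 * t * N + t ^+ 2 * P.
  pose u := v *m invmx G - t *: v.
  have : 0 <= form G u u.
    have [->|u0] := eqVneq u 0; last by rewrite ltW// Gpos.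
    by rewrite /form !mul0mx mxE.
  rewrite form_sub.
  have N1 : (v *m v^T) ord0 ord0 = N.
    by rewrite mxE; apply: eq_bigr => k _; rewrite mxE expr2.
  have -> : form G (v *m invmx G) v = N by rewrite /form mulmxKV.
  have -> : form G v (v *m invmx G) = N.
    by rewrite /form trmx_mul trmx_inv Gs mulmxA mulmxK.
  have -> : form G (v *m invmx G) (v *m invmx G) = Q.
    by rewrite /form trmx_mul trmx_inv Gs mulmxKV// mulmxA.
  by rewrite -/P; lra.
have := main (c * m%:R)^-1.
set t := (_)^-1 => H.
have ct : c * m%:R * t = 1 by rewrite divff// gt_eqF.
have t0 : 0 < t by rewrite invr_gt0.
have : t ^+ 2 * P <= t * N.
  rewrite expr2 -mulrA ler_pM2l//; apply: le_trans (ler_wpM2l (ltW t0) PN) _.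
  by rewrite mulrA [t * _]mulrC ct mul1r.
move=> H2; have H3 : t * N <= Q by lra.
by have := ler_wpM2l (ltW cm) H3; rewrite mulrA ct mul1r.
Qed.

End Trace.

(** * Operators in divergence form and the comparison principle *)

Section Divergence.
Context {R : realType} {m : nat}.
Implicit Types (V : set 'rV[R]_m) (f g u : 'rV[R]_m -> R) (x y : 'rV[R]_m)
  (G : 'rV[R]_m -> 'M[R]_m) (X Y : 'rV[R]_m -> 'rV[R]_m).

(** Of the metric only the positivity of its determinant is kept, because this is
    an open condition: it is preserved near the boundary when the components are
    extended across it. *)
Definition C1_metric V G : Prop :=
  [/\ open V, forall k l, C1 V (fun x => G x k l) & forall x, V x -> 0 < \det (G x)].

Definition C1field V X : Prop := forall k, C1 V (fun x => X x ord0 k).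

(** The scalar product of the gradients of [u] and [f]. *)
Definition pairing G u f x : R :=
  \sum_k 'D_(basis_vec k) u x * gradient G f x ord0 k.

Lemma C1_vol V G : C1_metric V G -> C1 V (fun x => Num.sqrt (\det (G x))).
Proof. by move=> [oV GC Gd]; apply: C1_sqrt => //; exact: C1_det. Qed.

Lemma vol_gt0 V G x : C1_metric V G -> V x -> 0 < Num.sqrt (\det (G x)).
Proof. by move=> [oV GC Gd] Vx; rewrite sqrtr_gt0; exact: Gd. Qed.

Lemma C1_invmx_metric V G k l : C1_metric V G -> C1 V (fun x => invmx (G x) k l).
Proof.
move=> [oV GC Gd]; apply: C1_invmx => // x Vx.
by rewrite gt_eqF// Gd.
Qed.

Lemma C1_gradient V G u : C1_metric V G -> C2 V u -> C1field V (gradient G u).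
Proof.
move=> GV uV k; have oV : open V by case: GV.
rewrite (_ : (fun x => _) = fun x => \sum_(l < m) invmx (G x) k l * 'D_(basis_vec l) u x).
  by apply: C1_sum => // l _; apply: C1M => //; [exact: C1_invmx_metric|exact: C2_D].
by apply/funext => x; rewrite mxE.
Qed.

Lemma C1field_scale V f X : open V -> C1 V f -> C1field V X -> C1field V (fun y => f y *: X y).
Proof.
move=> oV fV XV k; rewrite (_ : (fun x => _) = fun x => f x * X x ord0 k).
  by apply: C1M => //; exact: XV.
by apply/funext => x; rewrite mxE.
Qed.

Lemma C1field_add V X Y : open V -> C1field V X -> C1field V Y -> C1field V (fun y => X y + Y y).
Proof.
move=> oV XV YV k; rewrite (_ : (fun x => _) = fun x => X x ord0 k + Y x ord0 k).
  by apply: C1D => //; exact: YV.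
by apply/funext => x; rewrite mxE.
Qed.

Lemma divergence_scale V G f X x : C1_metric V G -> C1 V f -> C1field V X -> V x ->
  divergence G (fun y => f y *: X y) x =
  f x * divergence G X x + \sum_k 'D_(basis_vec k) f x * X x ord0 k.
Proof.
move=> GV fV XV Vx; have oV : open V by case: GV.
have s0 := vol_gt0 GV Vx; have sV := C1_vol GV.
rewrite /divergence.
rewrite (eq_bigr (fun k => f x * 'D_(basis_vec k) (fun y => Num.sqrt (\det (G y)) * X y ord0 k) x +
    Num.sqrt (\det (G x)) * X x ord0 k * 'D_(basis_vec k) f x)); last first.
  move=> k _; have pV : C1 V (fun y => Num.sqrt (\det (G y)) * X y ord0 k) by apply: C1M => //; exact: XV.
  have -> : (fun y => Num.sqrt (\det (G y)) * (f y *: X y) ord0 k) =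
      fun y => f y * (Num.sqrt (\det (G y)) * X y ord0 k).
    by apply/funext => y; rewrite mxE mulrCA.
  exact: (derive_mul k fV pV Vx).
rewrite big_split /= mulrDr -mulr_sumr mulrCA; congr (_ + _).
rewrite mulr_sumr; apply: eq_bigr => k _.
by field; rewrite gt_eqF.
Qed.

Lemma divergence_add V G X Y x : C1_metric V G -> C1field V X -> C1field V Y -> V x ->
  divergence G (fun y => X y + Y y) x = divergence G X x + divergence G Y x.
Proof.
move=> GV XV YV Vx; have oV : open V by case: GV.
have sV := C1_vol GV.
rewrite /divergence -mulrDr -big_split /=; congr (_ * _); apply: eq_bigr => k _.
have C1p Z : C1field V Z -> C1 V (fun y => Num.sqrt (\det (G y)) * Z y ord0 k).
  by move=> ZV; apply: C1M => //; exact: ZV.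
have -> : (fun y => Num.sqrt (\det (G y)) * (X y + Y y) ord0 k) =
    fun y => Num.sqrt (\det (G y)) * X y ord0 k + Num.sqrt (\det (G y)) * Y y ord0 k.
  by apply/funext => y; rewrite mxE mulrDr.
exact: (derive_add k (C1p _ XV) (C1p _ YV) Vx).
Qed.

Lemma divergence_ext V G G' X Y x : open V -> {in V, G =1 G'} -> {in V, X =1 Y} -> V x ->
  divergence G X x = divergence G' Y x.
Proof.
move=> oV GG XY Vx; rewrite /divergence GG ?inE//; congr (_ * _); apply: eq_bigr => k _.
by apply: (derive_ext_on _ oV Vx) => y Vy; rewrite GG// XY.
Qed.

Lemma gradient_ext V G G' u f x : open V -> {in V, G =1 G'} -> {in V, u =1 f} -> V x ->
  gradient G u x = gradient G' f x.
Proof.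
move=> oV GG uf Vx; apply/rowP => k; rewrite !mxE; apply: eq_bigr => l _.
by rewrite GG ?inE// (derive_ext_on _ oV Vx uf).
Qed.

Lemma laplacian_ext V G G' u f x : open V -> {in V, G =1 G'} -> {in V, u =1 f} -> V x ->
  laplacian G u x = laplacian G' f x.
Proof.
move=> oV GG uf Vx; apply: (divergence_ext oV) => // y /set_mem Vy.
exact: (gradient_ext oV).
Qed.

Lemma pairing_ext V G G' u f u' f' x : open V -> {in V, G =1 G'} -> {in V, u =1 u'} -> {in V, f =1 f'} -> V x ->
  pairing G u f x = pairing G' u' f' x.
Proof.
move=> oV GG uu ff Vx; apply: eq_bigr => k _.
by rewrite (derive_ext_on _ oV Vx uu) (gradient_ext oV GG ff Vx).
Qed.

Lemma continuous_fsum (n : nat) (F : 'I_n -> 'rV[R]_m -> R) x :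
  (forall i, {for x, continuous (F i)}) -> {for x, continuous (fun y => \sum_(i < n) F i y)}.
Proof.
move=> FC; rewrite (_ : (fun y => _) = \sum_(i < n) F i); last first.
  by apply/funext => y; rewrite fct_sumE.
elim/big_ind : _ => [|f g fc gc|i _]; [exact: cst_continuous|exact: continuousD|exact: FC].
Qed.

Lemma continuous_divergence V G X x : C1_metric V G -> C1field V X -> V x ->
  {for x, continuous (divergence G X)}.
Proof.
move=> GV XV Vx; have oV : open V by case: GV.
have sV := C1_vol GV; have s0 := vol_gt0 GV Vx.
apply: continuousM.
  apply: (@continuousV _ _ (fun y => Num.sqrt (\det (G y)))); first by rewrite gt_eqF.
  exact: C1_continuous sV Vx.
apply: continuous_fsum => k.
have pV : C1 V (fun y => Num.sqrt (\det (G y)) * X y ord0 k) by apply: C1M => //; exact: XV.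
exact: C1_continuousD pV Vx.
Qed.

Lemma continuous_pairing V G u f x : C1_metric V G -> C1 V u -> C2 V f -> V x ->
  {for x, continuous (pairing G u f)}.
Proof.
move=> GV uV fV Vx; apply: continuous_fsum => k.
have gV := C1_gradient GV fV k.
have [_ _ cu] := C1E uV Vx; have [cg _ _] := C1E gV Vx.
exact: (continuousM (cu k) cg).
Qed.

Lemma pairing_sym G u f x : (G x)^T = G x -> pairing G u f x = pairing G f u x.
Proof.
move=> Gs; rewrite /pairing.
under eq_bigr do rewrite mxE mulr_sumr.
under [RHS]eq_bigr do rewrite mxE mulr_sumr.
rewrite exchange_big /=; apply: eq_bigr => l _; apply: eq_bigr => k _.
have -> : invmx (G x) k l = invmx (G x) l k by rewrite -[in LHS]Gs -trmx_inv mxE.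
by rewrite mulrC -mulrA mulrCA.
Qed.

Lemma gradientD V G u f x : open V -> C1 V u -> C1 V f -> V x ->
  gradient G (fun y => u y + f y) x = gradient G u x + gradient G f x.
Proof.
move=> oV uV fV Vx; apply/rowP => k; rewrite !mxE -big_split /=.
apply: eq_bigr => l _.
by rewrite (derive_add l uV fV Vx) mulrDr.
Qed.

Lemma gradientZ V G c u x : C1 V u -> V x ->
  gradient G (fun y => c * u y) x = c *: gradient G u x.
Proof.
move=> uV Vx; apply/rowP => k; rewrite !mxE mulr_sumr.
apply: eq_bigr => l _.
by rewrite (derive_scale c l uV Vx) mulrCA.
Qed.

Lemma gradient_comp G u (dphi phi : R -> R) x :
  (forall j, 'D_(basis_vec j) (fun y => phi (u y)) x = dphi (u x) * 'D_(basis_vec j) u x) ->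
  gradient G (fun y => phi (u y)) x = dphi (u x) *: gradient G u x.
Proof.
move=> H; apply/rowP => k; rewrite !mxE mulr_sumr.
by apply: eq_bigr => l _; rewrite H mulrCA.
Qed.

Lemma gradient_powR V G (rho : 'rV[R]_m -> R) p x : open V -> C1 V rho ->
  (forall x, V x -> 0 < rho x) -> V x ->
  gradient G (fun y => rho y `^ p) x = (p * rho x `^ (p - 1)) *: gradient G rho x.
Proof.
move=> oV rV r0 Vx; have [_ pD] := C1_powR p oV rV r0.
exact: (@gradient_comp G rho (fun t => p * t `^ (p - 1)) (fun t => t `^ p) x (fun j => pD x j Vx)).
Qed.

(** The gradient of [f] vanishes at [x], so that only the second-order part
    survives, namely [mu] times the trace of the product of the inverse metric and
    the Hessian of [f]; the latter is nonnegative at a minimum. *)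
Lemma divergence_min_ge0 V G mu f x : C1_metric V G -> inner_product (G x) -> C1 V mu -> 0 <= mu x ->
  C2 V f -> V x -> (\forall y \near x, f x <= f y) ->
  0 <= divergence G (fun y => mu y *: gradient G f y) x.
Proof.
move=> GV Gx muV mu0 fV Vx fmin; have oV : open V by case: GV.
have [W [oW Wx WV Wmin]] : exists W, [/\ open W, W x, W `<=` V & forall y, W y -> f x <= f y].
  exists (V `&` [set y | f x <= f y]°); split.
  - by apply: openI => //; exact: open_interior.
  - by split.
  - by move=> y [].
  - by move=> y [_ /nbhs_singleton].
have fW := C2_sub WV fV.
have D0 v : 'D_v f x = 0 by have [] := C2_min v oW Wx fW Wmin.
have H0 (v : 'rV[R]_m) : 0 <= \sum_k \sum_l v ord0 k * v ord0 l * 'D_(basis_vec k) ('D_(basis_vec l) f) x.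
  by have [] := C2_min v oW Wx fW Wmin.
rewrite (divergence_scale GV muV (C1_gradient GV fV) Vx).
have -> : \sum_k 'D_(basis_vec k) mu x * gradient G f x ord0 k = 0.
  apply: big1 => k _; rewrite mxE big1 ?mulr0// => l _.
  by rewrite D0 mulr0.
rewrite addr0 mulr_ge0//.
have s0 := vol_gt0 GV Vx; have sV := C1_vol GV.
rewrite /divergence; apply: mulr_ge0; first by rewrite invr_ge0 ltW.
(* The derivatives of the coefficients are multiplied by first derivatives of f,
   which vanish at x. *)
have -> : \sum_(k < m) 'D_(basis_vec k) (fun y => Num.sqrt (\det (G y)) * gradient G f y ord0 k) x =
   Num.sqrt (\det (G x)) * \sum_k \sum_l invmx (G x) k l * 'D_(basis_vec k) ('D_(basis_vec l) f) x.
  rewrite mulr_sumr; apply: eq_bigr => k _.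
  pose F l y := Num.sqrt (\det (G y)) * invmx (G y) k l.
  have FV l : C1 V (F l) by apply: C1M => //; exact: C1_invmx_metric.
  have -> : (fun y => Num.sqrt (\det (G y)) * gradient G f y ord0 k) =
     fun y => \sum_l F l y * 'D_(basis_vec l) f y.
    by apply/funext => y; rewrite mxE mulr_sumr; apply: eq_bigr => l _; rewrite mulrA.
  have Dl l : is_derive x (basis_vec k) (fun y => F l y * 'D_(basis_vec l) f y)
      (F l x * 'D_(basis_vec k) ('D_(basis_vec l) f) x).
    have [_ Fd _] := C1E (FV l) Vx; have [_ fd _] := C1E (C2_D l fV) Vx.
    have := is_deriveM (derivableP (Fd k)) (derivableP (fd k)).
    by move/is_derive_eq; apply; rewrite D0 scale0r addr0.
  have [_ ->] := is_derive_fsum Dl.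
  by rewrite mulr_sumr; apply: eq_bigr => l _; rewrite /F mulrA.
apply: mulr_ge0; first exact: ltW.
pose H : 'M[R]_m := \matrix_(k, l) 'D_(basis_vec k) ('D_(basis_vec l) f) x.
have HE k l : H k l = 'D_(basis_vec k) ('D_(basis_vec l) f) x by rewrite mxE.
have Hpos (v : 'rV[R]_m) : 0 <= Defs.form H v v.
  by rewrite formE; under eq_bigr do under eq_bigr do rewrite HE; exact: H0.
have := trace_form_ge0 (inner_product_inv Gx) Hpos.
by under eq_bigr do under eq_bigr do rewrite HE.
Qed.

(** At a point where [U - w] attains a negative minimum, [w > U >= 0]; there
    div(mu grad U) = E U <= |E| w < div(mu grad w), while at a minimum the
    divergence for [U - w] is nonnegative.  Since [U >= 0], the sign of [E] is
    immaterial: it suffices that [w] be a strict subsolution for the potential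
    |E|, and only where [w] is positive. *)
Lemma comparison V G mu (E U w : 'rV[R]_m -> R) (K : set 'rV[R]_m) :
  C1_metric V G -> (forall x, V x -> inner_product (G x)) ->
  C1 V mu -> (forall x, V x -> 0 <= mu x) -> C2 V U -> C2 V w ->
  (forall x, V x -> 0 <= U x) ->
  (forall x, V x -> divergence G (fun y => mu y *: gradient G U y) x = E x * U x) ->
  compact K -> {within K, continuous (fun x => U x - w x)} ->
  (forall x, K x -> w x <= U x \/
    [/\ V x, nbhs x K &
    (0 < w x -> `|E x| * w x < divergence G (fun y => mu y *: gradient G w y) x)]) ->
  forall x, K x -> w x <= U x.
Proof.
move=> GV Gin muV mu0 UV wV U0 Ueq cK cUw KP x Kx.
have [c cK' cmin] := compact_EVT_min (ex_intro _ x Kx) cK cUw.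
rewrite inE in cK'.
rewrite -subr_ge0; apply: (@le_trans _ _ (U c - w c)); last by apply: cmin; rewrite inE.
rewrite subr_ge0; have [//|[Vc nK Ec]] := KP c cK'.
rewrite leNgt; apply/negP => Uw.
have oV : open V by case: GV.
have w0 : 0 < w c by apply: le_lt_trans Uw; exact: U0.
have dV : C2 V (fun y => U y + -1 * w y) by apply: C2D => //; exact: C2Z.
have : 0 <= divergence G (fun y => mu y *: gradient G (fun y => U y + -1 * w y) y) c.
  apply: (divergence_min_ge0 GV (Gin _ Vc) muV (mu0 _ Vc) dV Vc).
  by apply: filterS nK => y Ky; rewrite !mulN1r; apply: cmin; rewrite inE.
rewrite (@divergence_ext V _ G _ (fun y => mu y *: gradient G U y + -1 *: (mu y *: gradient G w y)))//; last first.
  move=> y /set_mem Vy; rewrite (gradientD _ oV (C2_C1 UV) _ Vy); last by apply: C1Z => //; exact: C2_C1.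
  by rewrite (gradientZ _ _ (C2_C1 wV) Vy) scalerDr scalerA mulrC -scalerA.
have fU := C1field_scale oV muV (C1_gradient GV UV).
have fw := C1field_scale oV muV (C1_gradient GV wV).
rewrite (divergence_add GV fU _ Vc); last by apply: C1field_scale => //; exact: C1_cst.
rewrite (divergence_scale GV (C1_cst _ _) fw Vc) Ueq//.
rewrite big1 ?addr0; last by move=> k _; rewrite derive_cst mul0r.
have := Ec w0; have : `|E c| * U c <= `|E c| * w c by rewrite ler_wpM2l// ltW.
have : E c * U c <= `|E c| * U c by rewrite ler_wpM2r ?U0// ler_norm.
lra.
Qed.

End Divergence.

(** * The potential near the boundary *)

Section Conformal.
Context {R : realType} {n : nat}.

(** From [G = rho^2 gp] one gets sqrt(det gp) = rho^(-(n+1)) sqrt(det G) and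
    gp^-1 = rho^2 G^-1, so that the Laplacian of [gp] is rho^(n+1) times a
    divergence for [G] with the weight rho^(1-n); applied to rho^(n-s), the
    field is (n - s) rho^(-s) grad rho. *)
Lemma conformal_laplacian (V : set 'rV[R]_n.+1) (G gp : 'rV[R]_n.+1 -> 'M[R]_n.+1)
    (rho : 'rV[R]_n.+1 -> R) (s : R) x :
  C1_metric V G -> C2 V rho -> (forall x, V x -> 0 < rho x) ->
  (forall x, V x -> G x = rho x ^+ 2 *: gp x) -> V x -> pairing G rho rho x = 1 ->
  laplacian gp (fun y => rho y `^ (n%:R - s)) x =
  (n%:R - s) * (rho x `^ (n%:R - s + 1) * laplacian G rho x - s * rho x `^ (n%:R - s)).
Proof.
move=> GV rV r0 GE Vx rr; have oV : open V by case: GV.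
have gpE y : V y -> gp y = (rho y) ^- 2 *: G y.
  by move=> Vy; rewrite GE// scalerA mulVf ?scale1r// expf_neq0// gt_eqF// r0.
have detE y : V y -> Num.sqrt (\det (gp y)) = rho y `^ (- n.+1%:R) * Num.sqrt (\det (G y)).
  move=> Vy; have ry := r0 y Vy; have [_ _ /(_ y Vy) dy] := GV.
  rewrite gpE// detZ sqrtrM; last by rewrite exprn_ge0// invr_ge0 sqr_ge0.
  congr (_ * _); rewrite powRN powR_mulrn ?ltW// -exprVn -exprM mulnC exprM sqrtr_sqr ger0_norm ?exprVn//.
  by rewrite -exprVn exprn_ge0// invr_ge0 ltW.
have invE y : V y -> invmx (gp y) = rho y ^+ 2 *: invmx (G y).
  move=> Vy; have ry := r0 y Vy; have [_ _ /(_ y Vy) dy] := GV.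
  rewrite gpE// invmxZ ?invrK// unitmxE detZ unitfE mulf_neq0// ?gt_eqF//.
  by rewrite exprn_gt0// invr_gt0 exprn_gt0.
(* The densities under the two divergences agree, up to the factor n - s. *)
have fieldE : {in V, forall y, (fun k => Num.sqrt (\det (gp y)) * gradient gp (fun y => rho y `^ (n%:R - s)) y ord0 k) =1
   fun k => (n%:R - s) * (Num.sqrt (\det (G y)) * (rho y `^ (- s) *: gradient G rho y) ord0 k)}.
  move=> y /set_mem Vy k; have ry := r0 y Vy.
  rewrite detE//.
  have -> : gradient gp (fun y => rho y `^ (n%:R - s)) y = rho y ^+ 2 *: gradient G (fun y => rho y `^ (n%:R - s)) y.
    apply/rowP => i; rewrite !mxE mulr_sumr; apply: eq_bigr => l _.
    by rewrite invE// mxE mulrA.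
  rewrite (gradient_powR _ _ oV (C2_C1 rV) r0 Vy) scalerA !mxE.
  set gk := (\sum_(l < _) _).
  have -> : rho y `^ (- s) = rho y `^ (- n.+1%:R) * (rho y ^+ 2 * rho y `^ (n%:R - s - 1)).
    rewrite -powR_mulrn ?ltW// -!powRD; try by rewrite (gt_eqF ry) implybT.
    by congr (_ `^ _); rewrite -natr1; ring.
  by ring.
have pV := (C1_powR (- s) oV (C2_C1 rV) r0).
pose X y := rho y `^ (- s) *: gradient G rho y.
have XC : C1field V X by exact: (C1field_scale oV pV.1 (C1_gradient GV rV)).
have sumE : \sum_(k < n.+1) 'D_(basis_vec k) (fun y => Num.sqrt (\det (gp y)) *
      gradient gp (fun y => rho y `^ (n%:R - s)) y ord0 k) x =
    (n%:R - s) * \sum_(k < n.+1) 'D_(basis_vec k) (fun y => Num.sqrt (\det (G y)) * X y ord0 k) x.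
  rewrite mulr_sumr; apply: eq_bigr => k _.
  have XV : C1 V (fun y => Num.sqrt (\det (G y)) * X y ord0 k).
    by apply: C1M => //; exact: C1_vol.
  apply: etrans (derive_scale (n%:R - s) k XV Vx).
  apply: (derive_ext_on _ oV Vx) => y Vy; exact: fieldE.
have -> : laplacian gp (fun y => rho y `^ (n%:R - s)) x = (Num.sqrt (\det (gp x)))^-1 *
    ((n%:R - s) * \sum_(k < n.+1) 'D_(basis_vec k) (fun y => Num.sqrt (\det (G y)) * X y ord0 k) x).
  by rewrite -sumE.
rewrite detE//.
have := divergence_scale GV pV.1 (C1_gradient GV rV) Vx.
rewrite -/X -/(laplacian G rho x) => divE.
have {}divE : (Num.sqrt (\det (G x)))^-1 * \sum_(k < n.+1) 'D_(basis_vec k) (fun y => Num.sqrt (\det (G y)) * X y ord0 k) x = _ := divE.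
have s0 := vol_gt0 GV Vx; have rx := r0 x Vx.
rewrite invfM -mulrA [X in _ * X]mulrCA divE mulrCA; congr (_ * _).
have -> : \sum_k 'D_(basis_vec k) (fun y => rho y `^ (- s)) x * gradient G rho x ord0 k =
   - s * rho x `^ (- s - 1).
  transitivity (\sum_k (- s * rho x `^ (- s - 1)) * ('D_(basis_vec k) rho x * gradient G rho x ord0 k)).
    by apply: eq_bigr => k _; rewrite pV.2//; ring.
  by rewrite -mulr_sumr -/(pairing G rho rho x) rr mulr1.
rewrite -powRN opprK mulrDr mulrA; congr (_ * _ + _).
  rewrite -powRD; last by rewrite (gt_eqF rx) implybT.
  by congr (_ `^ _); rewrite -natr1; ring.
rewrite mulrCA mulNr; congr (- (_ * _)).
rewrite -powRD; last by rewrite (gt_eqF rx) implybT.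
by congr (_ `^ _); rewrite -natr1; ring.
Qed.

(** When |grad rho| = 1, the two terms of order rho^(n-s) cancel. *)
Lemma potential_formula (V : set 'rV[R]_n.+1) (G gp : 'rV[R]_n.+1 -> 'M[R]_n.+1)
    (rho : 'rV[R]_n.+1 -> R) (s : R) x :
  C1_metric V G -> C2 V rho -> (forall x, V x -> 0 < rho x) ->
  (forall x, V x -> G x = rho x ^+ 2 *: gp x) -> V x -> pairing G rho rho x = 1 ->
  rho x `^ (- 1 - s) * (- laplacian gp (fun y => rho y `^ (n%:R - s)) x
      - s * (n%:R - s) * rho x `^ (n%:R - s)) =
  - (n%:R - s) * (rho x `^ (n%:R - 2 * s) * laplacian G rho x).
Proof.
move=> GV rV r0 GE Vx rr; rewrite (conformal_laplacian _ GV rV r0 GE Vx rr).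
have -> : rho x `^ (n%:R - 2 * s) = rho x `^ (- 1 - s) * rho x `^ (n%:R - s + 1).
  rewrite -powRD; last by rewrite (gt_eqF (r0 x Vx)) implybT.
  by congr (_ `^ _); ring.
by ring.
Qed.

End Conformal.

(** * The squared Euclidean distance *)

Section Sqdist.
Context {R : realType} {m : nat}.
Implicit Types (V : set 'rV[R]_m) (x y : 'rV[R]_m).

Definition sqdist y x : R := \sum_k (x ord0 k - y ord0 k) ^+ 2.

Lemma sqdist_ge0 y x : 0 <= sqdist y x.
Proof. by apply: sumr_ge0 => k _; exact: sqr_ge0. Qed.

Lemma sqdistxx x : sqdist x x = 0.
Proof. by apply: big1 => k _; rewrite subrr expr0n. Qed.

Lemma C2_sqdist V y : open V -> C2 V (sqdist y).
Proof.
move=> oV; apply: C2_sum => // k _; have cV : C2 V (fun x => x ord0 k - y ord0 k).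
  by apply: C2B => //; [exact: C2_coord|exact: C2_cst].
rewrite (_ : (fun x => _) = fun x => (x ord0 k - y ord0 k) * (x ord0 k - y ord0 k)) //.
exact: C2M.
Qed.

Lemma continuous_sqdist y : continuous (sqdist y).
Proof.
by move=> x; apply: (@C1_continuous _ _ setT) => //; apply: C2_C1; apply: C2_sqdist; exact: openT.
Qed.

Lemma derive_sqdist y x j : 'D_(basis_vec j) (sqdist y) x = 2 * (x ord0 j - y ord0 j).
Proof.
have Dk k : is_derive x (basis_vec j) (fun x => (x ord0 k - y ord0 k) ^+ 2)
    (2 * (x ord0 k - y ord0 k) * (k == j)%:R).
  have H := is_deriveB (is_derive_coord x (basis_vec j) k) (is_derive_cst (y ord0 k) x (basis_vec j)).
  have := is_deriveX 2 H; move/is_derive_eq; apply.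
  by rewrite /= subr0 {1}/basis_vec mxE eqxx /= expr1.
have [_ ->] := is_derive_fsum Dk.
rewrite (bigD1 j)//= eqxx mulr1 big1 ?addr0// => k /negPf ->; by rewrite mulr0.
Qed.

Lemma norm_le_sqdist y x (d : R) : 0 <= d -> sqdist y x <= d ^+ 2 -> `|x - y| <= d.
Proof.
move=> d0 H; rewrite [leLHS]mx_normrE; apply/bigmax_leP; split => //= -[i k] _ /=.
rewrite (ord1 i) !mxE -(ler_pXn2r (n := 2))// ?nnegrE// real_normK ?num_real//.
apply: le_trans H; rewrite /sqdist (bigD1 k)//= lerDl.
by apply: sumr_ge0 => j _; exact: sqr_ge0.
Qed.

Lemma sqdist_triangle x y z : sqdist y z <= 2 * (sqdist x y + sqdist x z).
Proof.
rewrite -big_split /= mulr_sumr; apply: ler_sum => k _.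
have := sqr_ge0 (x ord0 k - y ord0 k + (x ord0 k - z ord0 k)).
by move: (x _ _) (y _ _) (z _ _) => u v w; nra.
Qed.

Lemma sqdist_segment (x0 x y : 'rV[R]_m) (t : R) : 0 <= t <= 1 ->
  sqdist x0 (x + t *: (y - x)) <= (1 - t) * sqdist x0 x + t * sqdist x0 y.
Proof.
move=> /andP[t0 t1]; rewrite !mulr_sumr -big_split /=; apply: ler_sum => k _.
rewrite !mxE; move: (x _ _) (y _ _) (x0 _ _) => u v w.
have : 0 <= t * (1 - t) * (u - v) ^+ 2 by rewrite mulr_ge0 ?sqr_ge0// mulr_ge0// subr_ge0.
nra.
Qed.

Lemma closed_sqdist y (r : R) : closed [set x | sqdist y x <= r].
Proof. by apply: (@closed_comp _ _ (sqdist y) [set t | t <= r]); [move=> x _; exact: continuous_sqdist|exact: closed_le]. Qed.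

Lemma compact_sqdist y (r : R) : compact [set x | sqdist y x <= r].
Proof.
apply: bounded_closed_compact; last exact: closed_sqdist.
exists (`|r| + 1 + `|y|); split; first exact: num_real.
move=> M rM x /= xr; apply: le_trans (ltW rM); rewrite -[x in `|x|](subrK y).
apply: le_trans (ler_normD _ _) _; rewrite lerD2r.
apply: norm_le_sqdist; first by rewrite addr_ge0.
apply: (le_trans xr); apply: (le_trans (ler_norm r)).
have := normr_ge0 r; set t := `|r|; nra.
Qed.

Lemma nbhs_sqdist_lt y x (r : R) : sqdist y x < r -> nbhs x [set z | sqdist y z < r].
Proof.
move=> xr; apply: open_nbhs_nbhs; split => //.
by apply: (@open_comp _ _ (sqdist y) [set t | t < r]); [move=> z _; exact: continuous_sqdist|exact: open_lt].
Qed.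

Lemma nbhs_sqdist_ball y (P : set 'rV[R]_m) : nbhs y P ->
  exists2 r : R, 0 < r & [set x | sqdist y x <= r] `<=` P.
Proof.
move=> /nbhs_ballP[d /= d0 dP]; exists ((d / 2) ^+ 2); first by rewrite exprn_gt0// divr_gt0.
move=> x /= xr; apply: dP; rewrite -ball_normE /ball_ /= distrC.
apply: (@le_lt_trans _ _ (d / 2)); last by rewrite ltr_pdivrMr// ltr_pMr// ltr1n.
by apply: norm_le_sqdist => //; rewrite divr_ge0// ltW.
Qed.

(** Continuity is asked at the points of [K] in the ambient space: this is the
    form in which it comes from the differentiability on a neighbourhood. *)
Lemma bounded_on_compact (K : set 'rV[R]_m) (f : 'rV[R]_m -> R) : compact K ->
  (forall x, K x -> {for x, continuous f}) -> exists2 c : R, 0 < c & forall x, K x -> `|f x| <= c.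
Proof.
move=> cK fc; have [->|/set0P[x Kx]] := eqVneq K set0; first by exists 1.
have cf : {within K, continuous (fun x => `|f x|)}.
  apply: continuous_in_subspaceT => y /set_mem Ky.
  by apply: (@continuous_comp _ _ _ f (fun t : R => `|t|)); [exact: fc|exact: norm_continuous].
have [c _ cmax] := compact_EVT_max (ex_intro _ x Kx) cK cf.
exists (`|f c| + 1) => [|y Ky]; first by rewrite ltr_wpDl.
by apply: (@le_trans _ _ `|f c|); [apply: cmax; rewrite inE|rewrite lerDl].
Qed.

End Sqdist.

(** * Propagation of positivity in the interior *)

Section InteriorBarrier.
Context {R : realType} {m : nat}.

(** The gradient of the squared distance to [y] does not degenerate away from
    [y]; this is what makes the exponential barrier a subsolution on an
    annulus. *)
Lemma pairing_sqdist_ge (G : 'rV[R]_m -> 'M[R]_m) (y x : 'rV[R]_m) (c : R) :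
  inner_product (G x) -> (forall k l, `|G x k l| <= c) ->
  4 * sqdist y x <= c * m%:R * pairing G (sqdist y) (sqdist y) x.
Proof.
move=> Gin Gc; have := inner_product_inv_ge (x - y) Gin Gc.
have -> : pairing G (sqdist y) (sqdist y) x = 4 * Defs.form (invmx (G x)) (x - y) (x - y).
  rewrite formE mulr_sumr; apply: eq_bigr => k _.
  rewrite derive_sqdist mxE !mulr_sumr; apply: eq_bigr => l _.
  by rewrite derive_sqdist !mxE; ring.
have -> : sqdist y x = \sum_k (x - y) ord0 k ^+ 2.
  by apply: eq_bigr => k _; rewrite !mxE.
by move=> H; rewrite mulrCA ler_pM2l.
Qed.

(** Hopf's barrier kap (e^(-al psi) - e^(-al r)), with psi the squared distance to
    [y], is a strict subsolution on the annulus between a small ball around [y],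
    where [U] is at least kap, and the sphere psi = r, where it vanishes.  As it is
    positive in the whole open ball, so is [U], without looking for a point where
    the zero set touches a ball. *)
Lemma positivity_ball (V : set 'rV[R]_m) (G : 'rV[R]_m -> 'M[R]_m) (mu E U : 'rV[R]_m -> R)
    (y : 'rV[R]_m) (r : R) :
  C1_metric V G -> (forall x, V x -> inner_product (G x)) ->
  C1 V mu -> (forall x, V x -> 0 < mu x) -> C2 V U ->
  (forall x, V x -> 0 <= U x) -> (forall x, V x -> {for x, continuous E}) ->
  (forall x, V x -> divergence G (fun y => mu y *: gradient G U y) x = E x * U x) ->
  [set x | sqdist y x <= r] `<=` V -> 0 < U y ->
  forall x, sqdist y x < r -> 0 < U x.
Proof.
move=> GV Gin muV mu0 UV U0 Ec Ueq KV Uy x xr.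
have oV : open V by case: GV.
set K := [set x | sqdist y x <= r] in KV.
have cK : compact K by exact: compact_sqdist.
have Kx : K x by exact: ltW.
have r0 : 0 < r by apply: le_lt_trans xr; exact: sqdist_ge0.
have Vy : V y by apply: KV; rewrite /K /= sqdistxx ltW.
have Vx : V x by exact: KV.
pose kap := U y / 2.
have kap0 : 0 < kap by rewrite divr_gt0.
have [rho1 rho10 Hrho1] : exists2 r1 : R, 0 < r1 & [set x | sqdist y x <= r1] `<=` [set x | kap <= U x].
  apply: nbhs_sqdist_ball.
  have /cvgrPdist_lt/(_ _ kap0) := C1_continuous (C2_C1 UV) Vy.
  by apply: filterS => z /=; rewrite ltr_norml /kap => /andP[_]; lra.
have psiV := C2_sqdist y oV.
have [C1b C1p HC1] := bounded_on_compact cK (fun x Kx => continuous_divergence GV (C1field_scale oV muV (C1_gradient GV psiV)) (KV x Kx)).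
have [C2b C2p HC2] := bounded_on_compact cK (fun x Kx => Ec x (KV x Kx)).
have [C3b C3p HC3] : exists2 c : R, 0 < c & forall x, K x -> (mu x)^-1 <= c.
  have [] := @bounded_on_compact _ _ K (fun x => (mu x)^-1) cK.
    move=> z Kz; apply: (@continuousV _ _ mu); first by rewrite gt_eqF// mu0//; exact: KV.
    exact: (C1_continuous muV (KV z Kz)).
  move=> c c0 H; exists c => // z Kz; apply: le_trans (ler_norm _) (H z Kz).
have [C4b C4p HC4] : exists2 c : R, 0 < c & forall x, K x -> forall k l, `|G x k l| <= c.
  have H (kl : 'I_m * 'I_m) : exists c : R, 0 < c /\ forall x, K x -> `|G x kl.1 kl.2| <= c.
    have [] := @bounded_on_compact _ _ K (fun x => G x kl.1 kl.2) cK.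
      move=> z Kz; have [_ GC _] := GV; exact: (C1_continuous (GC _ _) (KV z Kz)).
    by move=> c c0 Hc; exists c.
  have [F FP] := choice H.
  exists (1 + \sum_kl F kl) => [|z Kz k l].
    by rewrite ltr_pwDl// sumr_ge0// => kl _; have [/ltW] := FP kl.
  have [_ /(_ z Kz) /= H1] := FP (k, l).
  apply: (le_trans H1); rewrite (bigD1 (k, l))//= addrCA lerDl addr_ge0// sumr_ge0// => kl _.
  by have [/ltW] := FP kl.
(* The lower bound of mu |grad psi|^2 on the annulus; the successor of m keeps the
   denominator positive in every dimension. *)
pose lam := 4 * rho1 / ((C4b * m.+1%:R) * C3b).
have cm0 : 0 < C4b * m.+1%:R by rewrite mulr_gt0.
have lam0 : 0 < lam by rewrite divr_gt0 ?mulr_gt0.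
have lamP z : K z -> rho1 <= sqdist y z -> lam <= mu z * pairing G (sqdist y) (sqdist y) z.
  move=> Kz rz; have Vz := KV z Kz; have muz := mu0 z Vz.
  have Q := pairing_sqdist_ge y (Gin z Vz) (HC4 z Kz).
  set P := pairing _ _ _ _ in Q *.
  have P0 : 0 <= P.
    have : 0 < C4b * m%:R * P by apply: lt_le_trans Q; rewrite mulr_gt0//; exact: lt_le_trans rz.
    have cm : 0 <= C4b * m%:R by rewrite mulr_ge0// ltW.
    by move: cm; rewrite le_eqVlt => /orP[/eqP <-|cm]; [rewrite mul0r ltxx|rewrite pmulr_rgt0// => /ltW].
  have Q2 : 4 * rho1 <= C4b * m.+1%:R * P.
    apply: (@le_trans _ _ (4 * sqdist y z)); first by rewrite ler_pM2l.
    by apply: (le_trans Q); rewrite ler_wpM2r// ler_pM2l// ler_nat.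
  have M3 : 1 <= mu z * C3b by rewrite -(divff (lt0r_neq0 muz)) ler_pM2l// HC3.
  rewrite /lam ler_pdivrMr ?mulr_gt0//.
  apply: (le_trans Q2); rewrite -[leLHS]mulr1.
  have -> : mu z * P * (C4b * m.+1%:R * C3b) = (C4b * m.+1%:R * P) * (mu z * C3b) by ring.
  by rewrite ler_wpM2l// mulr_ge0// ltW.
(* In al^2 mu |grad psi|^2 - al div(mu grad psi) - |E|, the first term has to
   dominate. *)
pose al := 1 + (C1b + C2b) / lam.
have al1 : 1 <= al by rewrite lerDl divr_ge0 ?addr_ge0// ltW.
have alE : al * C1b + C2b < al ^+ 2 * lam.
  have E1 : al * lam = lam + (C1b + C2b) by rewrite /al mulrDl mul1r divfK// gt_eqF.
  rewrite expr2 -mulrA E1; nra.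
pose e z := expR (- al * sqdist y z).
have [e1 eD] : C1 V e /\ (forall x j, V x -> 'D_(basis_vec j) e x = e x * 'D_(basis_vec j) (fun z => - al * sqdist y z) x).
  by apply: C1_expR => //; apply: C1Z => //; exact: C2_C1.
have eV : C2 V e by apply: C2_expR => //; exact: C2Z.
pose w z := kap * (e z - expR (- al * r)).
have wV : C2 V w by apply: C2Z => //; apply: C2B => //; exact: C2_cst.
have gw z : V z -> gradient G w z = (- al * kap * e z) *: gradient G (sqdist y) z.
  move=> Vz; apply/rowP => k; rewrite !mxE mulr_sumr; apply: eq_bigr => l _.
  have eB : C1 V (fun z => e z + - expR (- al * r)) by apply: C1D => //; exact: C1_cst.
  rewrite (derive_scale kap l eB Vz) (derive_add l e1 (C1_cst _ _) Vz) derive_cst addr0.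
  by rewrite eD// (derive_scale _ _ (C2_C1 psiV) Vz); ring.
have divw z : V z -> divergence G (fun y => mu y *: gradient G w y) z =
    kap * e z * (al ^+ 2 * (mu z * pairing G (sqdist y) (sqdist y) z) -
      al * divergence G (fun x => mu x *: gradient G (sqdist y) x) z).
  move=> Vz.
  have cV : C1 V (fun z => - al * kap * e z) by exact: C1Z.
  rewrite (@divergence_ext _ _ V _ G _ (fun z => (- al * kap * e z) *: (mu z *: gradient G (sqdist y) z)))//; last first.
    by move=> t /set_mem Vt; rewrite gw// !scalerA mulrC.
  rewrite (divergence_scale GV cV (C1field_scale oV muV (C1_gradient GV psiV)) Vz).
  rewrite (eq_bigr (fun k => (kap * e z * al ^+ 2 * mu z) *
      ('D_(basis_vec k) (sqdist y) z * gradient G (sqdist y) z ord0 k))); last first.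
    move=> k _; rewrite (derive_scale _ _ e1 Vz) eD// (derive_scale _ _ (C2_C1 psiV) Vz).
    have -> : (mu z *: gradient G (sqdist y) z) ord0 k = mu z * gradient G (sqdist y) z ord0 k by rewrite [LHS]mxE.
    by ring.
  by rewrite -mulr_sumr -/(pairing _ _ _ _); ring.
have ele z : e z <= 1.
  by rewrite /e -[leRHS](@expR0 R) ler_expR mulNr oppr_le0 mulr_ge0 ?sqdist_ge0//; lra.
apply: (@lt_le_trans _ _ (w x)).
  rewrite /w mulr_gt0// subr_gt0 ltr_expR !mulNr ltrN2 ltr_pM2l//; lra.
apply: (comparison GV Gin muV (fun z Vz => ltW (mu0 z Vz)) UV wV U0 Ueq cK) Kx => //.
  apply: continuous_in_subspaceT => z /set_mem /KV Vz.
  by apply: (@continuousB _ _ _ U w); [exact: (C1_continuous (C2_C1 UV) Vz)|exact: (C1_continuous (C2_C1 wV) Vz)].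
move=> z Kz; have [zr1|zr1] := leP (sqdist y z) rho1.
  left; apply: (@le_trans _ _ kap); last exact: Hrho1.
  rewrite /w -[leRHS]mulr1 ler_pM2l//; have := ele z; have := expR_gt0 (- al * r); lra.
have [zr|zr] := leP r (sqdist y z).
  left; have -> : w z = 0; last by apply: U0; exact: KV.
  have -> : w z = kap * (expR (- al * sqdist y z) - expR (- al * r)) by [].
  by rewrite (_ : sqdist y z = r) ?subrr ?mulr0//; apply/eqP; rewrite eq_le zr andbT.
right; split; [exact: KV| |move=> _].
  by apply: filterS (nbhs_sqdist_lt zr) => t /= /ltW.
rewrite divw; last exact: KV.
have ez : 0 < e z by exact: expR_gt0.
have H1 : `|E z| * w z <= C2b * (kap * e z).
  apply: (@le_trans _ _ (`|E z| * (kap * e z))).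
    by rewrite ler_wpM2l// /w ler_pM2l//; have := expR_gt0 (- al * r); lra.
  by apply: ler_wpM2r; [rewrite mulr_ge0 ?ltW|exact: HC2].
apply: (le_lt_trans H1); rewrite mulrC ltr_pM2l ?mulr_gt0//.
have := lamP z Kz (ltW zr1); have /ler_normlP[_] := HC1 z Kz.
set D := divergence _ _ _; set P := mu z * _ => D1 P1.
have : al ^+ 2 * lam <= al ^+ 2 * P by rewrite ler_wpM2l// sqr_ge0.
have : al * D <= al * C1b by rewrite ler_wpM2l//; lra.
lra.
Qed.

End InteriorBarrier.

(** * The barrier at the boundary *)

Section BoundaryBarrier.
Context {R : realType} {m : nat}.

(** The absolute value takes care of negative [t], where the power is 1 by
    convention and would be discontinuous at 0. *)
Lemma continuous_norm_powR (p : R) : 0 < p -> continuous (fun t : R => `|t| `^ p).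
Proof.
move=> p0 t; have [->|t0] := eqVneq t 0.
  apply/cvgrPdist_lt => e e0; rewrite normr0 powR0 ?gt_eqF//.
  near=> u; rewrite sub0r normrN ger0_norm ?powR_ge0//.
  have -> : e = (e `^ p^-1) `^ p by rewrite -powRrM mulVf ?gt_eqF// powRr1// ltW.
  rewrite gt0_ltr_powR// ?nnegrE ?powR_ge0//.
  near: u; exact: (@nbhs0_lt R R _ (powR_gt0 p^-1 e0)).
apply: (@continuous_comp _ _ _ (fun t : R => `|t|) (fun t => t `^ p)); first exact: norm_continuous.
apply: differentiable_continuous; apply/derivable1_diffP.
by have [] := is_derive1_powR p (x := `|t|); rewrite ?normr_gt0.
Unshelve. all: by end_near. Qed.

Lemma within_continuous_comp (T : topologicalType) (Q : set T) (f : T -> R) (phi : R -> R) :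
  {within Q, continuous f} -> continuous phi -> {within Q, continuous (fun x => phi (f x))}.
Proof. by move=> fc pc x; apply: continuous_comp; [exact: fc|exact: pc]. Qed.

Lemma within_continuousM (T : topologicalType) (Q : set T) (f g : T -> R) :
  {within Q, continuous f} -> {within Q, continuous g} ->
  {within Q, continuous (fun x => f x * g x)}.
Proof. by move=> fc gc x; apply: cvgM; [exact: fc|exact: gc]. Qed.

Lemma within_continuousD (T : topologicalType) (Q : set T) (f g : T -> R) :
  {within Q, continuous f} -> {within Q, continuous g} ->
  {within Q, continuous (fun x => f x + g x)}.
Proof. by move=> fc gc x; apply: cvgD; [exact: fc|exact: gc]. Qed.

Lemma within_continuousB (T : topologicalType) (Q : set T) (f g : T -> R) :
  {within Q, continuous f} -> {within Q, continuous g} ->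
  {within Q, continuous (fun x => f x - g x)}.
Proof. by move=> fc gc x; apply: cvgB; [exact: fc|exact: gc]. Qed.

Lemma within_continuousC (T : topologicalType) (Q : set T) (c : R) :
  {within Q, continuous (fun=> c)}.
Proof. by move=> x; exact: cvg_cst. Qed.

(** The function [f] is only continuous relative to [Q], as the functions on the
    half-space are up to the boundary. *)
Lemma compact_sublevel (Q : set 'rV[R]_m) (f : 'rV[R]_m -> R) (A : set R) : compact Q -> closed Q ->
  {within Q, continuous f} -> closed A -> compact (Q `&` [set x | A (f x)]).
Proof.
move=> cQ clQ fc cA; have : closed ([set x | A (f x)] : set (subspace Q)).
  by apply: (@closed_comp _ _ (f : subspace Q -> R) A) => // x _; exact: fc.
move=> /closed_subspaceP[C cC CE]; rewrite setIC -CE setIC.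
exact: compact_closedI.
Qed.

(** The power rho^(2 gamma) solves the model equation; the term in [B] makes it a
    strict subsolution, and the term in [M] makes it nonpositive where [psi] is
    large. *)
Definition barrier (kap gamma B M : R) (rho psi : 'rV[R]_m -> R) (y : 'rV[R]_m) : R :=
  kap * (rho y `^ (2 * gamma) * (1 + (B * rho y - M * psi y))).

Lemma barrier_C2 V kap gamma B M (rho psi : 'rV[R]_m -> R) : open V -> C2 V rho -> C2 V psi ->
  (forall x, V x -> 0 < rho x) -> C2 V (barrier kap gamma B M rho psi).
Proof.
move=> oV rV pV r0; apply: (C2Z _ oV); apply: (C2M oV (C2_powR _ oV rV r0)).
exact: (C2D oV (C2_cst V 1) (C2B oV (C2Z B oV rV) (C2Z M oV pV))).
Qed.

(** As a + 2 gamma = 1, one has rho^a grad(rho^(2 gamma)) = 2 gamma grad rho and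
    rho^a rho^(2 gamma) = rho: the weighted gradient of the barrier is a
    combination of grad rho and grad psi whose coefficients are affine in [rho]
    and [psi], and no negative power of [rho] appears. *)
Lemma divergence_barrier V G kap gamma a B M (rho psi : 'rV[R]_m -> R) x :
  C1_metric V G -> C2 V rho -> C2 V psi ->
  (forall x, V x -> 0 < rho x) -> V x -> inner_product (G x) -> pairing G rho rho x = 1 ->
  a = 1 - 2 * gamma ->
  divergence G (fun y => (rho y `^ a) *: gradient G (barrier kap gamma B M rho psi) y) x =
  kap * ((B * (1 + 2 * gamma) * rho x + 2 * gamma * (1 - M * psi x)) * laplacian G rho x
    + B * (1 + 2 * gamma) - M * (1 + 2 * gamma) * pairing G rho psi x - M * rho x * laplacian G psi x).
Proof.
move=> GV rV pV r0 Vx Gx rr aE; have oV : open V by case: GV.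
have r1 := C2_C1 rV; have p1 := C2_C1 pV.
have [w1 wD] := C1_powR (2 * gamma) oV r1 r0.
have q1 : C1 V (fun y => B * rho y + - M * psi y).
  exact: (C1D oV (C1Z B oV r1) (C1Z (- M) oV p1)).
have qq1 : C1 V (fun y => 1 + (B * rho y + - M * psi y)).
  exact: (C1D oV (C1_cst V 1) q1).
have bE : barrier kap gamma B M rho psi = fun y => kap * (rho y `^ (2 * gamma) * (1 + (B * rho y + - M * psi y))).
  by apply/funext => y; rewrite /barrier mulNr.
pose c1 y := B * (1 + 2 * gamma) * rho y + (2 * gamma + (- (2 * gamma) * M) * psi y).
have c1V : C1 V c1.
  exact: (C1D oV (C1Z _ oV r1) (C1D oV (C1_cst V _) (C1Z _ oV p1))).
have c2V : C1 V (fun y => - M * rho y) by exact: C1Z.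
have XrV := C1_gradient GV rV; have XpV := C1_gradient GV pV.
have fE : {in V, (fun y => (rho y `^ a) *: gradient G (barrier kap gamma B M rho psi) y) =1
   (fun y => kap *: (c1 y *: gradient G rho y + (- M * rho y) *: gradient G psi y))}.
  move=> y /set_mem Vy; have ry := r0 y Vy; rewrite bE.
  have E1 : rho y `^ a * rho y `^ (2 * gamma) = rho y.
    rewrite -powRD; last by rewrite (gt_eqF ry) implybT.
    by rewrite aE subrK powRr1 ?ltW.
  have E2 : rho y `^ a * rho y `^ (2 * gamma - 1) = 1.
    rewrite -powRD; last by rewrite (gt_eqF ry) implybT.
    by rewrite (_ : a + _ = 0) ?powRr0// aE; ring.
  apply/rowP => k; rewrite !mxE !mulr_sumr -big_split /= mulr_sumr; apply: eq_bigr => l _.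
  rewrite (derive_scale kap l (C1M oV w1 qq1) Vy) (derive_mul l w1 qq1 Vy).
  rewrite (derive_add l (C1_cst V 1) q1 Vy) derive_cst add0r.
  rewrite (derive_add l (C1Z B oV r1) (C1Z (- M) oV p1) Vy) !(derive_scale _ l _ Vy)// wD//.
  set ra := rho y `^ a in E1 E2 *; set rg := rho y `^ (2 * gamma) in E1 *.
  set rg1 := rho y `^ _ in E2 *.
  set g := invmx _ _ _; set Dr := 'D__ rho y; set Dp := 'D__ psi y.
  transitivity (kap * g * ((ra * rg) * (B * Dr - M * Dp) + (ra * rg1) * (2 * gamma * (1 + (B * rho y - M * psi y)) * Dr))); first by ring.
  by rewrite E1 E2 /c1; ring.
rewrite (divergence_ext oV (fun _ _ => erefl) fE Vx).
have sV := C1field_add oV (C1field_scale oV c1V XrV) (C1field_scale oV c2V XpV).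
rewrite (divergence_scale GV (C1_cst V kap) sV Vx).
rewrite [X in _ + X]big1 ?addr0; last by move=> k _; rewrite derive_cst mul0r.
rewrite (divergence_add GV (C1field_scale oV c1V XrV) (C1field_scale oV c2V XpV) Vx).
rewrite (divergence_scale GV c1V XrV Vx) (divergence_scale GV c2V XpV Vx).
have Dc1 k : 'D_(basis_vec k) c1 x = B * (1 + 2 * gamma) * 'D_(basis_vec k) rho x - 2 * gamma * M * 'D_(basis_vec k) psi x.
  have pz : C1 V (fun y => (- (2 * gamma) * M) * psi y) by exact: C1Z.
  rewrite (derive_add k (C1Z _ oV r1) (C1D oV (C1_cst V _) pz) Vx) (derive_add k (C1_cst V _) pz Vx) derive_cst add0r.
  by rewrite !(derive_scale _ k _ Vx)//; ring.
have -> : \sum_k 'D_(basis_vec k) c1 x * gradient G rho x ord0 k =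
    B * (1 + 2 * gamma) * pairing G rho rho x - 2 * gamma * M * pairing G psi rho x.
  rewrite /pairing !mulr_sumr -sumrB; apply: eq_bigr => k _; rewrite Dc1; ring.
have -> : \sum_k 'D_(basis_vec k) (fun y => - M * rho y) x * gradient G psi x ord0 k = - M * pairing G rho psi x.
  by rewrite /pairing mulr_sumr; apply: eq_bigr => k _; rewrite (derive_scale _ k r1 Vx) mulrA.
rewrite (@pairing_sym _ _ G psi rho x) ?rr; last by case: Gx.
rewrite /laplacian /c1; set L1 := divergence G (gradient G rho) x.
set L2 := divergence G (gradient G psi) x; set P := pairing _ _ _ _.
by ring.
Qed.

(** The inequality that makes the barrier a strict subsolution.  Here [rz], [L],
    [P] and [Ls] stand for [rho], its Laplacian, the pairing of [rho] with [psi]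
    and the Laplacian of [psi] at one point, and [t] for [M * psi].  The term
    B (1 + 2 gamma) dominates: one half of it absorbs B (1 + 2 gamma) rho L, as
    rho |L| <= 1/2, and the other half exceeds the sum of the bounds of the other
    terms, by the choice of [B]. *)
Lemma barrier_scalar (gamma b C M B rz L P Ls t : R) :
  0 < gamma -> 0 <= b -> 0 < C -> 0 < M ->
  B = 2 * (2 * gamma * C + M * (1 + 2 * gamma) * C + M * C + 2 * b * C) + 1 ->
  0 < rz -> rz <= 1 -> rz * C <= 2^-1 -> B * rz <= 1 -> 0 <= t -> t <= 2 ->
  `|L| <= C -> `|P| <= C -> `|Ls| <= C ->
  b * `|L| * (1 + (B * rz - t)) <
  (B * (1 + 2 * gamma) * rz + 2 * gamma * (1 - t)) * L + B * (1 + 2 * gamma)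
  - M * (1 + 2 * gamma) * P - M * rz * Ls.
Proof.
move=> g0 b0 C0 M0 Bd rz0 rz1 rC Brho t0 t2 LC PC PsC.
have gC : 0 < gamma * C by rewrite mulr_gt0.
have MC : 0 < M * C by rewrite mulr_gt0.
have MgC : 0 < M * gamma * C by rewrite mulr_gt0// mulr_gt0.
have bC : 0 <= b * C by rewrite mulr_ge0// ltW.
have B1 : 1 <= B by rewrite Bd; lra.
have bL : 0 <= b * `|L| by rewrite mulr_ge0.
have bLC : b * `|L| <= b * C by rewrite ler_wpM2l.
have H0 : b * `|L| * (1 + (B * rz - t)) <= 2 * (b * C).
  apply: (@le_trans _ _ (b * `|L| * 2)); last by lra.
  by rewrite ler_wpM2l//; lra.
move: LC PC PsC; rewrite !ler_norml => /andP[L1 L2] /andP[P1 P2] /andP[S1 S2].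
have Ha : - (2^-1 * (B * (1 + 2 * gamma))) <= B * (1 + 2 * gamma) * rz * L.
  have rL : - 2^-1 <= rz * L.
    have : rz * (- C) <= rz * L by rewrite ler_wpM2l// ltW.
    lra.
  have Bg : 0 <= B * (1 + 2 * gamma) by rewrite mulr_ge0//; lra.
  by have := ler_wpM2l Bg rL; lra.
have Hb : - (2 * (gamma * C)) <= 2 * gamma * (1 - t) * L.
  have : - C <= (1 - t) * L.
    by nra.
  move=> H1; have := ler_wpM2l (ltW g0) H1; lra.
have Mg : 0 <= M * (1 + 2 * gamma) by rewrite mulr_ge0//; lra.
have Hc := ler_wpM2l Mg P2.
have Hd : M * rz * Ls <= M * C.
  rewrite -mulrA ler_pM2l//; apply: (@le_trans _ _ (rz * C)); first by rewrite ler_pM2l.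
  by rewrite ler_piMl// ltW.
have HB : B <= B * (1 + 2 * gamma) by rewrite ler_peMr//; lra.
rewrite mulrDl; lra.
Qed.

(** Comparison on the part of the half ball [Q] where [rho <= delta].  On its
    boundary, the barrier vanishes where [rho = 0]; it is nonpositive on the
    lateral side [sqdist x0 x = r], by the choice [M = 2 / r] and since
    [B * rho <= 1]; and on the top [rho = delta] it is at most the minimum of [U]
    over the compact set where [rho >= delta], by the choice of [kap].  The
    potential is of order rho^(-2 gamma), so that E times the barrier is
    bounded. *)
Lemma boundary_barrier V G (rho E U : 'rV[R]_m -> R) (H : set 'rV[R]_m) x0 (r gamma a b C : R) :
  let Q := H `&` [set x | sqdist x0 x <= r] in
  0 < r -> 0 < gamma -> a = 1 - 2 * gamma -> 0 <= b -> 0 < C ->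
  C1_metric V G -> (forall x, V x -> inner_product (G x)) ->
  C2 V rho -> (forall x, V x -> 0 < rho x) -> (forall x, V x -> pairing G rho rho x = 1) ->
  C2 V U -> (forall x, V x -> 0 <= U x) ->
  (forall x, V x -> divergence G (fun y => (rho y `^ a) *: gradient G U y) x = E x * U x) ->
  (forall x, V x -> E x = - b * (rho x `^ (- (2 * gamma)) * laplacian G rho x)) ->
  closed H -> {within Q, continuous rho} -> {within Q, continuous U} ->
  (forall x, Q x -> rho x = 0 /\ 0 <= U x \/
     [/\ V x, nbhs x H, 0 < U x & [/\ `|laplacian G rho x| <= C, `|pairing G rho (sqdist x0) x| <= C
        & `|laplacian G (sqdist x0) x| <= C]]) ->
  exists kap delta : R, [/\ 0 < kap, 0 < delta &
    forall x, Q x -> rho x <= delta ->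
     kap * (rho x `^ (2 * gamma) * (1 - 2 / r * sqdist x0 x)) <= U x].
Proof.
have aux1 (u v : R) : u <= 1 -> 2 <= v -> 1 + (u - v) <= 0 by lra.
have aux2 (u v : R) : u <= 1 -> 0 <= v -> 1 + (u - v) <= 2 by lra.
move=> Q r0 g0 aE b0 C0 GV Gin rV rho0 rr UV U0 Ueq EE clH rc Uc QP.
have oV : open V by case: GV.
pose M := 2 / r; have M0 : 0 < M by rewrite divr_gt0.
pose B := 2 * (2 * gamma * C + M * (1 + 2 * gamma) * C + M * C + 2 * b * C) + 1.
have gC : 0 < gamma * C by rewrite mulr_gt0.
have MC : 0 < M * C by rewrite mulr_gt0.
have MgC : 0 < M * gamma * C by rewrite mulr_gt0// mulr_gt0.
have bC : 0 <= b * C by rewrite mulr_ge0// ltW.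
have B1 : 1 <= B by rewrite /B; lra.
(* This choice gives del <= 1, del * C <= 1 / 2 and B * del <= 1. *)
pose del := (1 + 2 * C + B)^-1.
have iB : 0 < 1 + 2 * C + B by lra.
have del0 : 0 < del by rewrite invr_gt0.
have delE : del * (1 + 2 * C + B) = 1 by rewrite mulVf// gt_eqF.
have Bd : B = 2 * (2 * gamma * C + M * (1 + 2 * gamma) * C + M * C + 2 * b * C) + 1 by [].
have Mr : M * r = 2 by rewrite /M divfK// gt_eqF.
clearbody del B.
have dC : 0 < del * C by rewrite mulr_gt0.
have dB : 0 < del * B by rewrite mulr_gt0//; lra.
have del1 : del <= 1 by lra.
have delC : del * C <= 2^-1 by lra.
have delB : B * del <= 1 by lra.
have B0 : 0 <= B by lra.
have cQ : compact Q.
  rewrite /Q setIC; apply: compact_closedI => //; exact: compact_sqdist.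
have clQ : closed Q by apply: closedI => //; exact: closed_sqdist.
have rhoge x : Q x -> 0 <= rho x by move=> /QP[[->]//|[/rho0/ltW]].
have [kap0 kap00 topP] : exists2 k : R, 0 < k & forall x, Q x -> del <= rho x -> k <= U x.
  have cTop : compact (Q `&` [set x | [set t | del <= t] (rho x)]).
    by apply: compact_sublevel => //; exact: closed_ge.
  have [E0|/set0P[z Tz]] := eqVneq (Q `&` [set x | [set t | del <= t] (rho x)]) set0.
    exists 1 => // x Qx dx; suff : set0 x by [].
    by rewrite -E0; split.
  have [] := @compact_EVT_min _ R U _ (ex_intro _ z Tz) cTop.
    by apply: continuous_subspaceW Uc; exact: subIsetl.
  move=> c /set_mem[Qc dc] cmin; exists (U c).
    have [[rc0 _]|[_ _ //]] := QP c Qc.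
    by move: dc => /=; rewrite rc0 leNgt del0.
  by move=> x Qx dx; apply: cmin; rewrite inE; split.
have dp0 : 0 < del `^ (2 * gamma) by exact: powR_gt0.
(* The barrier is at most kap * 2 * del^(2 gamma) on the top of the domain, as
   B * del <= 1. *)
pose kap := kap0 / (2 * del `^ (2 * gamma)).
have kp : 0 < kap by rewrite divr_gt0// mulr_gt0.
have kapE : kap0 = kap * (del `^ (2 * gamma) * 2) by rewrite /kap; field; rewrite gt_eqF.
exists kap, del; split => // x Qx xd; rewrite -/M.
clearbody M kap.
pose w := barrier kap gamma B M rho (sqdist x0).
have psi0 := @sqdist_ge0 R m x0.
apply: (@le_trans _ _ (w x)).
  rewrite /w /barrier ler_pM2l// ler_wpM2l ?powR_ge0// lerD2l lerBrDr addrC subrr.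
  by rewrite mulr_ge0 ?rhoge.
pose K := Q `&` [set x | [set t | t <= del] (rho x)].
have cK : compact K by apply: compact_sublevel => //; exact: closed_le.
have psiV := C2_sqdist x0 oV.
have wV : C2 V w by exact: barrier_C2.
have muV := (C1_powR a oV (C2_C1 rV) rho0).1.
have KQ : K `<=` Q by exact: subIsetl.
apply: (@comparison _ _ V G (fun y => rho y `^ a) E U w K) => //.
- by move=> z Vz; exact: powR_ge0.
- have Uc' : {within K, continuous U} by exact: continuous_subspaceW Uc.
  have rc' : {within K, continuous rho} by exact: continuous_subspaceW rc.
  (* On K, rho is nonnegative, so that the absolute value does not change w. *)
  have wc : {within K, continuous (fun y => kap * (`|rho y| `^ (2 * gamma) * (1 + (B * rho y - M * sqdist x0 y))))}.
    have pc : {within K, continuous (sqdist x0)} by apply: continuous_subspaceT; exact: continuous_sqdist.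
    have rp : {within K, continuous (fun y => `|rho y| `^ (2 * gamma))}.
      by apply: (within_continuous_comp rc' (@continuous_norm_powR (2 * gamma) _)); rewrite mulr_gt0.
    have cst c := @within_continuousC _ K c.
    have lin := within_continuousB (within_continuousM (cst B) rc') (within_continuousM (cst M) pc).
    exact: (within_continuousM (cst kap) (within_continuousM rp (within_continuousD (cst 1) lin))).
  have Uw := within_continuousB Uc' wc.
  apply: subspace_eq_continuous Uw => y /set_mem /KQ Qy /=.
  by rewrite /from_subspace /w /barrier ger0_norm ?rhoge.
- move=> z [Qz /= zd].
  have [[rz Uz]|[Vz nH Uz [LC PC PsC]]] := QP z Qz.
    left; rewrite /w /barrier rz powR0 ?mul0r ?mulr0//.
    by rewrite mulf_neq0// gt_eqF.
  have rz := rho0 z Vz.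
  have Brho : B * rho z <= 1.
    by apply: le_trans delB; rewrite ler_wpM2l.
  have [pr|pr] := leP r (sqdist x0 z).
    left; apply: (@le_trans _ _ 0); last exact: ltW.
    rewrite /w /barrier pmulr_rle0// pmulr_rle0 ?powR_gt0//.
    by apply: aux1 => //; rewrite -Mr ler_wpM2l// ltW.
  have Mpsi0 : 0 <= M * sqdist x0 z by rewrite mulr_ge0// ltW.
  have Mpsi2 : M * sqdist x0 z <= 2 by rewrite -Mr ler_wpM2l// ltW.
  have [dz|dz] := leP del (rho z).
    left; apply: (le_trans _ (topP z Qz dz)).
    rewrite kapE.
    rewrite /w /barrier ler_pM2l// (_ : rho z = del); last by apply/eqP; rewrite eq_le zd.
    by rewrite ler_pM2l//; exact: aux2.
  right; split => //.
    have nr : nbhs z [set t | rho t < del].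
      have dz0 : 0 < del - rho z by rewrite subr_gt0.
      have /cvgrPdist_lt/(_ _ dz0) := C1_continuous (C2_C1 rV) Vz.
      by apply: filterS => t /=; rewrite ltr_norml => /andP[+ _]; rewrite ltrNl opprB ltrBlDr subrK.
    apply: filterS (filterI (filterI nH (nbhs_sqdist_lt pr)) nr).
    by move=> t [[Ht /ltW tr] /ltW td].
  move=> _; rewrite (divergence_barrier kap B M GV rV psiV rho0 Vz (Gin z Vz) (rr z Vz) aE).
  move: LC PC PsC; set L := laplacian G rho z; set P := pairing _ _ _ _; set Ls := laplacian _ _ _.
  move=> LC PC PsC.
  have Ew : `|E z| * w z = kap * (b * `|L| * (1 + (B * rho z - M * sqdist x0 z))).
    rewrite EE// /w /barrier -/L; move: (L) => l; rewrite !normrM normrN (ger0_norm b0) (ger0_norm (powR_ge0 _ _)).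
    have E1 : rho z `^ (- (2 * gamma)) * rho z `^ (2 * gamma) = 1.
      by rewrite powRN mulVf// gt_eqF// powR_gt0.
    set r1 := rho z `^ (- _) in E1 *; set r2 := rho z `^ _ in E1 *.
    move: (1 + _) => q; transitivity ((r1 * r2) * (kap * (b * `|l| * q))); first by ring.
    by rewrite E1 mul1r.
  rewrite Ew ltr_pM2l//.
  apply: (barrier_scalar g0 b0 C0 M0 Bd) => //.
  - exact: le_trans zd del1.
  - by apply: le_trans delC; rewrite ler_wpM2r// ltW.
Qed.

End BoundaryBarrier.

(** * Charts with boundary *)

Section Local.
Context {R : realType} {m : nat}.
Implicit Types (V : set 'rV[R]_m) (f g : 'rV[R]_m -> R) (x : 'rV[R]_m).

Lemma C1_local V f : (forall x, V x -> exists W, W x /\ C1 W f) -> C1 V f.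
Proof. by move=> H; split=> x Vx; have [W [Wx [fW]]] := H x Vx; exact: fW. Qed.

Lemma C2_local V f : (forall x, V x -> exists W, W x /\ C2 W f) -> C2 V f.
Proof.
move=> H; split.
  by apply: C1_local => x /H[W [Wx fW]]; exists W; split => //; exact: C2_C1.
by move=> j; apply: C1_local => x /H[W [Wx fW]]; exists W; split => //; exact: C2_D.
Qed.

Lemma smooth_on_C2 (B : set 'rV[R]_m) V f : open V -> V `<=` B -> smooth_on B f -> C2 V f.
Proof.
move=> oV VB fB; apply: C2_local => x Vx; have [W [g [oW Wx gW fg]]] := fB x (VB x Vx).
exists (W `&` V); split => //.
apply: (@C2_ext _ _ _ g).
- exact: openI.
- move=> y /set_mem[Wy Vy]; rewrite fg// inE; split => //; exact: VB.
- apply: (C2_sub (V := W)); [exact: subIsetl|exact: Ck_C2].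
Qed.

End Local.

Section HalfSpace.
Context {R : realType} {n : nat}.
Implicit Types (x y : 'rV[R]_n.+1) (f : 'rV[R]_n.+1 -> R).

Lemma open_pos_half : open [set x : 'rV[R]_n.+1 | 0 < x ord0 ord0].
Proof.
apply: (@open_comp _ _ (fun x : 'rV[R]_n.+1 => x ord0 ord0) [set t : R | 0 < t]).
  by move=> x _; exact: coord_continuous.
exact: open_gt.
Qed.

Lemma closed_half_space : closed (@half_space R n).
Proof.
apply: (@closed_comp _ _ (fun x : 'rV[R]_n.+1 => x ord0 ord0) [set t : R | 0 <= t]).
  by move=> x _; exact: coord_continuous.
exact: closed_ge.
Qed.

Lemma pd_interior j f x : 0 < x ord0 ord0 -> pd j f x = 'D_(basis_vec j) f x.
Proof.
move=> x0; rewrite /pd /derive.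
have -> : within [set t : R | half_space (x + t *: basis_vec j)] 0^' = 0^'.
  rewrite eqEsubset; split=> P HP; last exact: (cvg_within _ HP).
  have : \forall t \near 0^', half_space (x + t *: basis_vec j).
    apply: nbhs_dnbhs.
    have ct : {for (0 : R), continuous (fun t : R => x + t *: basis_vec j)}.
      apply: continuousD; first exact: cst_continuous.
      by apply: scalel_continuous.
    have := ct [set y | 0 < y ord0 ord0] _; rewrite scale0r addr0.
    have nx : nbhs x [set y : 'rV[R]_n.+1 | 0 < y ord0 ord0].
      by apply: open_nbhs_nbhs; split => //; exact: open_pos_half.
    by move=> /(_ nx); apply: filterS => t /ltW.
  have HP' : \forall t \near 0^', half_space (x + t *: basis_vec j) -> P t := HP.
  by apply: filterS2 HP' => t + H; apply; exact: H.
have -> : (fun t : R => t^-1 * (f (x + t *: basis_vec j) - f x)) =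
    (fun h : R => h^-1 *: ((f \o shift x) (h *: basis_vec j) - f x)).
  by apply/funext => t /=; rewrite [x + _]addrC.
by [].
Qed.

End HalfSpace.

Local Notation coord := Defs.coord.
Local Notation point := Defs.point.

Section Charts.
Context {R : realType} {n : nat} {T : topologicalType} (A : bmanifold R n T).
Implicit Types (i j : chart A) (p q : T).

Lemma coord_half i p : dom i p -> half_space (coord i p).
Proof.
move=> ip; have [B oB E] := coord_open i.
by have [] : (B `&` @half_space R n) (coord i p) by rewrite -E; exists p.
Qed.

Lemma coord_ge0 i p : dom i p -> 0 <= coord i p ord0 ord0.
Proof. exact: coord_half. Qed.

Lemma coord_at i p : dom i p -> {for p, continuous (coord i)}.
Proof.
move=> ip; have := @Defs.coord_continuous _ _ _ A i.
rewrite continuous_open_subspace; last exact: dom_open.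
by apply; rewrite inE.
Qed.

(** The chart is open onto its image, which is relatively open in the
    half-space. *)
Lemma chart_nbhs i p (W : set T) : dom i p -> nbhs p W ->
  \forall y \near coord i p, half_space y -> exists2 q, dom i q /\ W q & y = coord i q.
Proof.
move=> ip pW; have [B oB E] := coord_open i.
have Bp : B (coord i p) by have [] : (B `&` @half_space R n) (coord i p) by rewrite -E; exists p.
have imp : (coord i @` dom i) (coord i p) by exists p.
have pc := @point_continuous _ _ _ A i (coord i p).
have Wn : nbhs (point i (coord i p)) W by rewrite coordK.
have wn : within (coord i @` dom i) (nbhs (coord i p)) [set y | W (point i y)].
  by rewrite (nbhs_subspace_in imp); exact: (pc W Wn).
near=> y => Hy.
have [q iq qy] : (coord i @` dom i) y.
  by rewrite E; split => //; near: y; exact: open_nbhs_nbhs.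
exists q => //; split => //.
rewrite -(coordK iq) qy.
have : (coord i @` dom i) y by exists q.
by near: y.
Unshelve. all: by end_near. Qed.

Lemma inner_coord_gt0 i p : dom i p -> inner A p -> 0 < coord i p ord0 ord0.
Proof.
move=> ip np; rewrite lt0r coord_ge0// andbT; apply/eqP => p0.
by apply: np; exists i.
Qed.

Lemma open_chart_image i (W : set T) : open W -> W `<=` inner A ->
  open (coord i @` (dom i `&` W)).
Proof.
move=> oW Win; rewrite openE => _ [p [ip Wp] <-].
have := chart_nbhs ip (open_nbhs_nbhs (conj oW Wp)).
have np : nbhs (coord i p) [set y | 0 < y ord0 ord0].
  by apply: open_nbhs_nbhs; split; [exact: open_pos_half|apply: inner_coord_gt0 => //; exact: Win].
move=> H; apply: filterS2 H np => y yH /ltW /yH[q [iq Wq] ->].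
by exists q.
Qed.

Section Rho.
Variables (rho : T -> R) (hrho : defining_function A rho).

(** Near [p], [u] is the composite of the chart and a smooth function defined on
    an open set. *)
Lemma smooth_fun_continuous (u : T -> R) : smooth_fun A [set: T] u -> continuous u.
Proof.
move=> uS p; have [i ip] := dom_cover A p.
have [|V [g [oV Vp gV ug]]] := uS i (coord i p); first by exists p.
have cg : {for coord i p, continuous g}.
  by have [] := gV 0%N [::] (coord i p) isT Vp.
have cgp : {for p, continuous (g \o coord i)} by apply: continuous_comp; [exact: coord_at|exact: cg].
have E : \near p, (g \o coord i) p = u p.
  have n1 : nbhs p (dom i) by apply: open_nbhs_nbhs; split => //; exact: dom_open.
  have n2 : nbhs p [set q | V (coord i q)] by apply: (coord_at ip); exact: open_nbhs_nbhs.
  apply: filterS2 n1 n2 => q iq Vq /=; rewrite -ug ?inE /= ?coordK//; split => //.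
  by exists q.
rewrite /continuous_at -(nbhs_singleton E).
exact: (cvg_trans (near_eq_cvg E) cgp).
Qed.

Lemma rho_continuous : continuous rho.
Proof. by apply: smooth_fun_continuous; case: hrho. Qed.

Lemma rho_bdry p : bdry A p -> rho p = 0.
Proof. by case: hrho => _ _ + _; apply. Qed.

Lemma rho_inner p : inner A p -> 0 < rho p.
Proof. by case: hrho => _ + _ _; apply. Qed.

Lemma rho_ge0 p : 0 <= rho p.
Proof.
by have [/rho_bdry ->//|/rho_inner/ltW] := pselect (bdry A p).
Qed.

Lemma inner_rho p : 0 < rho p -> inner A p.
Proof. by move=> p0 /rho_bdry E; rewrite E ltxx in p0. Qed.

Lemma open_inner : open (inner A).
Proof.
rewrite (_ : inner A = [set p | 0 < rho p]).
  by apply: (@open_comp _ _ rho [set t : R | 0 < t]); [move=> p _; exact: rho_continuous|exact: open_gt].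
by rewrite eqEsubset; split => p; [exact: rho_inner|exact: inner_rho].
Qed.

(** The invariance of the boundary under the changes of charts: if the normal
    coordinate of [p] were positive in one chart, then [rho] would have an interior
    minimum at [p] in this chart, against the nonvanishing of its
    differential. *)
Lemma bdry_coord0 i p : dom i p -> bdry A p -> coord i p ord0 ord0 = 0.
Proof.
move=> ip bp; apply/eqP; rewrite eq_le coord_ge0// andbT leNgt; apply/negP => x0.
have [sm _ _ /(_ i p ip bp)[k]] := hrho.
rewrite pd_interior//; apply/negP; rewrite negbK; apply/eqP.
have [|V [g [oV Vp gV rg]]] := sm i (coord i p); first by exists p.
have pT : nbhs p setT by exact: filterT.
have H := chart_nbhs ip pT.
pose W := V `&` [set y | 0 < y ord0 ord0] `&` (coord i @` dom i)°.
have W1 : (coord i @` dom i)° (coord i p).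
  have nx : nbhs (coord i p) [set y : 'rV[R]_n.+1 | 0 < y ord0 ord0].
    by apply: open_nbhs_nbhs; split => //; exact: open_pos_half.
  by apply: filterS2 H nx => y + /ltW => /[apply] -[q [iq _] ->]; exists q.
have oW : open W.
  apply: openI; last exact: open_interior.
  by apply: openI => //; exact: open_pos_half.
have Wp : W (coord i p) by split.
have rE : {in W, g =1 rho \o point i}.
  move=> y /set_mem[[Vy y0] /interior_subset[q iq E]]; rewrite rg ?inE//; split => //.
  by exists q.
(* On the open set W, rho is minimal at p. *)
have rC : C2 W (rho \o point i).
  apply: (C2_ext oW rE); apply: (C2_sub (V := V)); last exact: Ck_C2.
  by move=> y [[]].
have [|] := @C2_min _ _ W (rho \o point i) (coord i p) (basis_vec k) oW Wp rC _; last by [].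
by move=> y _ /=; rewrite coordK// rho_bdry//; exact: rho_ge0.
Qed.

Lemma coord_gt0_inner i p : dom i p -> 0 < coord i p ord0 ord0 -> inner A p.
Proof. by move=> ip p0 /(bdry_coord0 ip) E; rewrite E ltxx in p0. Qed.

End Rho.
End Charts.

(** * The geodesic collar *)

Section Collar.
Context {R : realType} {n : nat} {T : topologicalType} (A : bmanifold R n T).
Implicit Types (i j : chart A) (p q : T).
Variables (gp gbar : chart A -> 'rV[R]_n.+1 -> 'M[R]_n.+1)
  (hhat : chart A -> 'rV[R]_n.+1 -> 'M[R]_n) (rho : T -> R) (eps : R)
  (Phi : T -> R -> T) (h : R -> chart A -> 'rV[R]_n.+1 -> 'M[R]_n).
Hypothesis hg : geodesic_defining_function gp hhat rho gbar eps Phi h.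

Local Notation e0 := (basis_vec (ord0 : 'I_n.+1)).

Let rhoP : defining_function A rho. Proof. by case: hg => -[]. Qed.

Lemma collar_coord_split i q t : dom i q -> bdry A q ->
  (coord i q + t *: e0) ord0 ord0 = t.
Proof. by move=> iq bq; rewrite !mxE /= (bdry_coord0 rhoP iq bq) mulr1 add0r. Qed.

Lemma collar_coordE i j q t : dom i q -> bdry A q ->
  collar_coord Phi i j (coord i q + t *: e0) = coord j (Phi q t).
Proof.
by move=> iq bq; rewrite /collar_coord collar_coord_split// addrK coordK.
Qed.

Lemma collar_rho q t : strip A eps (q, t) -> rho (Phi q t) = t.
Proof. by case: hg => _ _ [_ +] _ _; apply. Qed.

Lemma near_line (y v : 'rV[R]_n.+1) (P : set 'rV[R]_n.+1) : (\forall z \near y, P z) ->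
  \forall s \near (0 : R), P (s *: v + y).
Proof.
have ct : {for (0 : R), continuous (fun t : R => t *: v + y)}.
  by apply: continuousD; [exact: scalel_continuous|exact: cst_continuous].
by move=> yP; apply: (ct P); rewrite scale0r add0r.
Qed.

(** The product coordinates are open at the interior points of the collar: the
    projection of a nearby point to M and its height are continuous. *)
Lemma collar_nbhs i j q t : strip A eps (q, t) -> 0 < t -> dom i q -> dom j (Phi q t) ->
  \forall y \near coord i q + t *: e0, exists q' t',
    [/\ strip A eps (q', t') /\ 0 < t', dom i q', dom j (Phi q' t') & y = coord i q' + t' *: e0].
Proof.
move=> st t0 iq jq; have bq : bdry A q by case: st.
have te : t < eps by case: st => _ /andP[].
have [_ [_ Pc _ _ _] _ _ _] := hg.
have nj : nbhs (Phi q t) (dom j) by apply: open_nbhs_nbhs; split => //; exact: dom_open.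
have [[N1 N2] /= [N1q N2t] N12] : within (strip A eps) (nbhs (q, t)) [set z | dom j (Phi z.1 z.2)].
  by rewrite (nbhs_subspace_in st); exact: (Pc (q, t) _ nj).
have iN := chart_nbhs iq N1q.
(* The coordinates of the projection to M. *)
pose pr (y : 'rV[R]_n.+1) := y - y ord0 ord0 *: (e0 : 'rV[R]_n.+1).
have prE : pr (coord i q + t *: e0) = coord i q by rewrite /pr collar_coord_split// addrK.
have prc : continuous pr.
  move=> y; apply: (@cvgB _ _ _ (nbhs y) _ id (fun y : 'rV[R]_n.+1 => y ord0 ord0 *: (e0 : 'rV[R]_n.+1))); first exact: cvg_id.
  apply: (@continuous_comp _ _ _ (fun y : 'rV[R]_n.+1 => y ord0 ord0) (fun k : R => k *: (e0 : 'rV[R]_n.+1))).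
    exact: coord_continuous.
  exact: scalel_continuous.
have prn : \forall y \near coord i q + t *: e0, half_space (pr y) -> exists2 q', dom i q' /\ N1 q' & pr y = coord i q'.
  by have := prc (coord i q + t *: e0); rewrite /continuous_at prE => pc; exact: (pc _ iN).
have cc : {for coord i q + t *: e0, continuous (fun y : 'rV[R]_n.+1 => y ord0 ord0)} by exact: coord_continuous.
pose y00 (y : 'rV[R]_n.+1) := y ord0 ord0.
have tn : \forall y \near coord i q + t *: e0, [/\ N2 (y00 y), 0 < y00 y & y00 y < eps].
  apply: (cc (fun u : R => [/\ N2 u, 0 < u & u < eps])); rewrite collar_coord_split//.
  have n0 : nbhs t [set u : R | 0 < u] by apply: open_nbhs_nbhs; split => //; exact: open_gt.
  have n1 : nbhs t [set u : R | u < eps] by apply: open_nbhs_nbhs; split => //; exact: open_lt.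
  by apply: filterS (filterI N2t (filterI n0 n1)) => u [? [? ?]].
apply: filterS2 prn tn => y yp [y2 y0 ye].
have pr0 : (pr y) ord0 ord0 = 0 by rewrite /pr !mxE /= mulr1 subrr.
have [|q' [iq' N1q'] E] := yp; first by rewrite /half_space /= pr0.
have bq' : bdry A q' by exists i => //; rewrite -E.
have sq' : strip A eps (q', y ord0 ord0) by split => //=; rewrite ltW.
exists q', (y ord0 ord0); split => //.
- exact: (N12 (q', y ord0 ord0)).
- by rewrite -E /pr subrK.
Qed.

(** Smoothness on the domain of the product coordinates is smoothness in the usual
    sense near the points of positive height, which are interior. *)
Lemma collar_C2 i j q t : strip A eps (q, t) -> 0 < t -> dom i q -> dom j (Phi q t) ->
  exists W, [/\ open W, W (coord i q + t *: e0) & forall k, C2 W (fun y => collar_coord Phi i j y ord0 k)].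
Proof.
move=> st t0 iq jq; have := collar_nbhs st t0 iq jq.
set y0 := coord i q + t *: e0 => cn.
exists [set y | collar_dom Phi eps i j y]°; split; first exact: open_interior.
  apply: filterS cn => y [q' [t' [[s' _] iq' jq' ->]]]; exists q', t'; split => //.
move=> k; apply: smooth_on_C2; first exact: open_interior.
  exact: interior_subset.
by case: hg => _ [_ _ _ _ +] _ _ _; apply.
Qed.

Lemma collar_derive i j q t (V : set 'rV[R]_n.+1) (F : 'rV[R]_n.+1 -> R) (l : 'I_n.+1) :
  strip A eps (q, t) -> 0 < t -> dom i q -> dom j (Phi q t) ->
  open V -> V (coord j (Phi q t)) -> C1 V F ->
  is_derive (0 : R) 1 (fun s => F (collar_coord Phi i j (s *: basis_vec l + (coord i q + t *: e0))))
    (\sum_k jac (collar_coord Phi i j) (coord i q + t *: e0) k l *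
       'D_(basis_vec k) F (coord j (Phi q t))).
Proof.
move=> st t0 iq jq oV Vx FV; have bq : bdry A q by case: st.
set y := coord i q + t *: e0.
have y00 : y ord0 ord0 = t by exact: collar_coord_split.
have yE : collar_coord Phi i j (0 *: basis_vec l + y) = coord j (Phi q t).
  by rewrite scale0r add0r collar_coordE.
pose dc : 'rV[R]_n.+1 := \row_k jac (collar_coord Phi i j) y k l.
have := @C1_is_derive_curve _ _ V F (fun s => collar_coord Phi i j (s *: basis_vec l + y)) 0 dc oV.
rewrite yE => /(_ Vx FV) H.
rewrite (eq_bigr (fun k => dc ord0 k * 'D_(basis_vec k) F (coord j (Phi q t)))); last first.
  by move=> k _; rewrite /dc [in RHS]mxE.
apply: H => k.
have [W [oW Wy CW]] := collar_C2 st t0 iq jq.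
have := C1_is_derive (basis_vec l) oW Wy (C2_C1 (CW k)).
have -> : dc ord0 k = 'D_(basis_vec l) (fun y => collar_coord Phi i j y ord0 k) y.
  by rewrite !mxE pd_interior// y00.
move=> [D _]; apply: (@is_derive_line _ _ (fun y => collar_coord Phi i j y ord0 k)).
by rewrite scale0r add0r; apply/derivableP.
Qed.

Lemma riem_inner j p : dom j p -> inner_product (gbar j (coord j p)).
Proof. by move=> jp; have [[_ [[_ gin _] _]] _ _ _ _] := hg; apply: gin. Qed.

(** Let [J] be the Jacobian matrix of the product coordinates and [dr] the row of
    the partial derivatives of [rho].  As [rho] is the height, [dr *m J = e0]; the
    pullback of [gbar] by [J] is block diagonal, with the entry 1 for the height.
    Hence dr gbar^-1 dr^T = e0 (J^T gbar J)^-1 e0^T = 1. *)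
Lemma collar_gradient_norm i j q t : strip A eps (q, t) -> 0 < t -> dom i q -> dom j (Phi q t) ->
  pairing (gbar j) (rho \o point j) (rho \o point j) (coord j (Phi q t)) = 1.
Proof.
move=> st t0 iq jq; have bq : bdry A q by case: st.
have ip : inner A (Phi q t) by apply: (inner_rho rhoP); rewrite collar_rho.
set x := coord j (Phi q t); set y := coord i q + t *: e0.
pose V := coord j @` (dom j `&` inner A).
have oV : open V by apply: open_chart_image => //; exact: (open_inner rhoP).
have Vx : V x by exists (Phi q t).
have rV : C2 V (rho \o point j).
  apply: smooth_on_C2 oV _ _; last by case: rhoP => + _ _ _; apply.
  by move=> z [p [jp _] <-]; exists p.
pose J := jac (collar_coord Phi i j) y.
pose dr : 'rV[R]_n.+1 := \row_k 'D_(basis_vec k) (rho \o point j) x.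
have drJ : dr *m J = e0.
  apply/rowP => l; rewrite mxE.
  have D1 := collar_derive l st t0 iq jq oV Vx (C2_C1 rV).
  have D2 : is_derive (0 : R) 1 (fun s : R => (s *: basis_vec l + y) ord0 ord0) ((basis_vec l : 'rV[R]_n.+1) ord0 ord0).
    apply: (@is_derive_line _ _ (fun z => z ord0 ord0)); exact: is_derive_coord.
  have E : \forall s \near (0 : R), (rho \o point j) (collar_coord Phi i j (s *: basis_vec l + y)) = (s *: basis_vec l + y) ord0 ord0.
    have := near_line (basis_vec l) (collar_nbhs st t0 iq jq).
    apply: filterS => s [q' [t' [[st' t0'] iq' jq' ->]]].
    have bq' : bdry A q' by case: st'.
    by rewrite collar_coordE// collar_coord_split//= coordK// collar_rho.
  have [_ D3] := near_eq_is_derive E D1.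
  transitivity (\sum_k jac (collar_coord Phi i j) y k l * 'D_(basis_vec k) (rho \o point j) x).
    by apply: eq_bigr => k _; rewrite mxE mulrC.
  rewrite -D3; have [_ ->] := D2.
  by rewrite /basis_vec !mxE [l == ord0]eq_sym.
have [_ _ _ [hR _] pull] := hg.
have JGJ : J^T *m gbar j x *m J = lift0_mx (h t i (coord i q)).
  exact: (pull i j q t st iq jq).
have hin : inner_product (h t i (coord i q)).
  have te : 0 <= t < eps by case: st.
  by have [_ hin' _] := hR t te; apply: hin'.
have hu := inner_product_unit hin.
have Gu := inner_product_unit (riem_inner jq).
(* J is invertible because the pullback of gbar is. *)
have Bu : lift0_mx (h t i (coord i q)) \in unitmx.
  by rewrite unitmxE /lift0_mx det_ublock det1 mul1r -unitmxE.
have Ju : J \in unitmx.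
  by move: Bu; rewrite -JGJ !unitmx_mul => /andP[_ ->].
have Jtu : J^T \in unitmx by rewrite unitmx_tr.
have e0B : e0 *m lift0_mx (h t i (coord i q)) = e0.
  rewrite -rowE; apply/rowP => l; rewrite [LHS]mxE /lift0_mx.
  have -> : (ord0 : 'I_n.+1) = lshift n (ord0 : 'I_1) by exact: val_inj.
  have [k ->|k ->] := split_ordP (l : 'I_(1 + n)).
    by rewrite (@block_mxEul _ 1 n 1 n) /basis_vec !mxE (ord1 k) !eqxx.
  by rewrite (@block_mxEur _ 1 n 1 n) /basis_vec !mxE.
have -> : pairing (gbar j) (rho \o point j) (rho \o point j) x = (dr *m invmx (gbar j x) *m dr^T) ord0 ord0.
  rewrite -/(Defs.form _ _ _) formE; apply: eq_bigr => k _.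
  rewrite !mxE mulr_sumr; apply: eq_bigr => l _; rewrite !mxE; ring.
have drE : dr = e0 *m invmx J by rewrite -drJ mulmxK.
have e0J : e0 *m invmx (lift0_mx (h t i (coord i q))) = e0.
  by rewrite -[in LHS]e0B mulmxK.
have -> : dr *m invmx (gbar j x) *m dr^T = e0 *m invmx (lift0_mx (h t i (coord i q))) *m e0^T.
  rewrite drE trmx_mul !mulmxA; congr (_ *m _); rewrite -!mulmxA; congr (_ *m _).
  rewrite -[LHS](mulKmx Bu); rewrite -[in lift0_mx _ *m _]JGJ trmx_inv -[RHS]mulmx1; congr (_ *m _).
  by rewrite -!mulmxA (mulKVmx Ju) (mulKVmx Gu) mulmxV.
rewrite e0J mxE (bigD1 ord0)//= big1 ?addr0; last first.
  by move=> k k0; rewrite !mxE (negPf k0) mulr0.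
by rewrite [_^T _ _]mxE /basis_vec !mxE !eqxx mulr1.
Qed.

Definition collar_inner : set T :=
  inner A `&` ((fun z : T * R => Phi z.1 z.2) @` strip A eps).

Lemma collar_innerP q t : strip A eps (q, t) -> 0 < t -> collar_inner (Phi q t).
Proof.
move=> st t0; split; last by exists (q, t).
by apply: (inner_rho rhoP); rewrite collar_rho.
Qed.

Lemma collar_inner_ex p : collar_inner p -> exists q t, [/\ strip A eps (q, t), 0 < t & p = Phi q t].
Proof.
move=> [ip [[q t] st pE]]; exists q, t; split => //.
by have := rho_inner rhoP ip; rewrite -pE /= collar_rho.
Qed.

Lemma open_collar_inner : open collar_inner.
Proof. by apply: openI; [exact: (open_inner rhoP)|case: hg => _ []]. Qed.

Variables (gamma a s : R) (f U : T -> R).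
Hypotheses (hs : s = n%:R / 2 + gamma) (hU : solution gp gbar rho a s f U)
  (hU0 : forall p, 0 <= U p).

Section InChart.
Variable j : chart A.
Let V : set 'rV[R]_n.+1 := coord j @` (dom j `&` collar_inner).
Let r := rho \o point j.

Lemma chart_open : open V.
Proof. by apply: open_chart_image; [exact: open_collar_inner|move=> p []]. Qed.

Lemma chart_subset : V `<=` coord j @` (dom j `&` [set: T]).
Proof. by move=> _ [p [jp _] <-]; exists p. Qed.

Lemma chart_rho : C2 V r.
Proof.
apply: smooth_on_C2; [exact: chart_open|exact: chart_subset|].
by case: rhoP => + _ _ _; apply.
Qed.

Lemma chart_rho_gt0 x : V x -> 0 < r x.
Proof. by move=> [p [jp [ip _]] <-]; rewrite /r /= coordK//; exact: (rho_inner rhoP). Qed.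

Lemma chart_inner_product x : V x -> inner_product (gbar j x).
Proof. by move=> [p [jp _] <-]; exact: riem_inner. Qed.

Lemma chart_metric : C1_metric V (gbar j).
Proof.
split; first exact: chart_open.
  move=> k l; apply: C2_C1; apply: smooth_on_C2; [exact: chart_open|exact: chart_subset|].
  by have [[_ [[sm _ _] _]] _ _ _ _] := hg; exact: sm.
by move=> x Vx; apply: inner_product_det; exact: chart_inner_product.
Qed.

Lemma chart_norm x : V x -> pairing (gbar j) r r x = 1.
Proof.
move=> [p [jp pO] <-]; have [q [t [st t0 pE]]] := collar_inner_ex pO.
have bq : bdry A q by case: st.
have [i iq _] := bq; subst p; exact: (collar_gradient_norm st t0 iq jp).
Qed.

Lemma chart_U : C2 V (U \o point j).
Proof.
have [_ Uk _ _] := hU; apply: C2_sub (Ck_C2 (Uk j)).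
by move=> _ [p [jp [ip _]] <-]; exists p.
Qed.

Lemma chart_U_ge0 x : 0 <= (U \o point j) x. Proof. exact: hU0. Qed.

Lemma chart_potential x : V x ->
  Erho gp rho s j x = - (n%:R - s) * (r x `^ (- (2 * gamma)) * laplacian (gbar j) r x).
Proof.
move=> Vx; have -> : - (2 * gamma) = n%:R - 2 * s by rewrite hs; field.
apply: (potential_formula (gp := gp j) s chart_metric chart_rho chart_rho_gt0 _ Vx (chart_norm Vx)).
move=> y [p [jp [ip _]] <-]; rewrite /r /= coordK//.
by have [[_ [_ ext]] _ _ _ _] := hg; exact: ext.
Qed.

Lemma chart_equation x : V x ->
  divergence (gbar j) (fun y => (r y `^ a) *: gradient (gbar j) (U \o point j) y) x =
  Erho gp rho s j x * (U \o point j) x.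
Proof.
move=> [p [jp [ip _]] <-]; have [_ _ eqn _] := hU.
have := eqn j p jp ip; rewrite /= coordK// => H.
by apply/eqP; rewrite -subr_eq0 -oppr_eq0 opprB addrC; apply/eqP.
Qed.

Lemma chart_potential_continuous x : V x ->
  {for x, continuous (fun x => - (n%:R - s) * (r x `^ (- (2 * gamma)) * laplacian (gbar j) r x))}.
Proof.
move=> Vx; apply: continuousM; first exact: cst_continuous.
apply: continuousM.
  have [c1 _] := C1_powR (- (2 * gamma)) chart_open (C2_C1 chart_rho) chart_rho_gt0.
  exact: (C1_continuous c1 Vx).
exact: (continuous_divergence chart_metric (C1_gradient chart_metric chart_rho) Vx).
Qed.

Lemma chart_positivity y (d : R) : [set x | sqdist y x <= d] `<=` V -> 0 < U (point j y) ->
  forall x, sqdist y x < d -> 0 < U (point j x).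
Proof.
have [c1 _] := C1_powR a chart_open (C2_C1 chart_rho) chart_rho_gt0.
apply: (positivity_ball chart_metric chart_inner_product c1 _ chart_U (fun x _ => chart_U_ge0 x) chart_potential_continuous).
  by move=> x Vx; apply: powR_gt0; exact: chart_rho_gt0.
by move=> x Vx; rewrite chart_equation// chart_potential.
Qed.

End InChart.

(** In a chart, all the points of a small ball lie in a larger ball centred at any
    one of them and still contained in the image of the chart. *)
Lemma local_positivity p : collar_inner p -> exists N, [/\ nbhs p N &
  forall p1 p2, N p1 -> N p2 -> 0 < U p1 -> 0 < U p2].
Proof.
move=> pO; have [j jp] := dom_cover A p.
pose V := coord j @` (dom j `&` collar_inner).
have Vp : V (coord j p) by exists p.
have [d d0 dV] := nbhs_sqdist_ball (open_nbhs_nbhs (conj (@chart_open j) Vp)).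
(* For squared distances the triangle inequality loses a factor 2: two points at
   squared distance less than c of p are at less than 4 c of each other, and the
   ball of squared radius 4 c around any of them is in that of squared radius
   10 c around p. *)
pose c := d / 10.
have c0 : 0 < c by rewrite divr_gt0.
exists (dom j `&` [set q | sqdist (coord j p) (coord j q) < c]); split.
  apply: filterI; first by apply: open_nbhs_nbhs; split => //; exact: dom_open.
  have nc : nbhs (coord j p) [set z | sqdist (coord j p) z < c].
    by apply: nbhs_sqdist_lt; rewrite sqdistxx.
  exact: (coord_at jp nc).
move=> p1 p2 [j1 /= d1] [j2 /= d2] U1.
rewrite -(coordK j2); apply: (@chart_positivity j (coord j p1) (4 * c)).
- move=> z /= z1; apply: dV => /=.
  have := sqdist_triangle (coord j p1) (coord j p) z.
  have : sqdist (coord j p1) (coord j p) = sqdist (coord j p) (coord j p1).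
    by apply: eq_bigr => k _; rewrite -sqrrN opprB.
  by rewrite /c in d1 z1 *; lra.
- by rewrite coordK.
- by have := sqdist_triangle (coord j p) (coord j p1) (coord j p2); lra.
Qed.

Lemma U_continuous : continuous U. Proof. by case: hU. Qed.

(** By the local statement, the points of [S] where U > 0 form a subset which is
    both open and closed in [S]. *)
Lemma connected_positivity (S : set T) p1 p2 : connected S -> S `<=` collar_inner ->
  S p1 -> S p2 -> 0 < U p1 -> 0 < U p2.
Proof.
move=> cS SO S1 S2 U1.
pose B := S `&` [set p | 0 < U p].
have -> // : B = S -> 0 < U p2 by move=> BS; have [] : B p2 by rewrite BS.
apply: cS.
- by exists p1.
- exists [set p | 0 < U p] => //.
  by apply: (@open_comp _ _ U [set t : R | 0 < t]); [move=> p _; exact: U_continuous|exact: open_gt].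
- exists (~` ([set p | U p = 0])°); first by apply: open_closedC; exact: open_interior.
  rewrite eqEsubset; split => p [Sp]; last first.
    move=> nz; split => //=; rewrite lt0r hU0 andbT; apply/eqP => Up; apply: nz.
    have [N [pN HN]] := local_positivity (SO p Sp).
    have Np := nbhs_singleton pN; apply: filterS pN => p' Np'; apply/eqP; rewrite eq_le hU0 andbT leNgt; apply/negP => U'.
    by have := HN p' p Np' Np U'; rewrite Up ltxx.
  by move=> /= Up; split => // /interior_subset /= E; rewrite E ltxx in Up.
Qed.

End Collar.

(** * Continuity along curves and functions of one variable *)

Lemma within_comp (X Y Z : topologicalType) (D : set X) (S : set Y) (F : Y -> Z) (g : X -> Y) :
  {within S, continuous F} -> continuous g -> (forall x, D x -> S (g x)) ->
  {within D, continuous (fun x => F (g x))}.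
Proof.
move=> Fc gc DS; rewrite continuous_subspace_in => x /set_mem Dx P HP.
have Sg := DS x Dx.
have HS : within S (nbhs (g x)) (fun y => P (F y)).
  by rewrite (nbhs_subspace_in Sg); exact: (Fc (g x) P HP).
have HD : \forall y \near x, D y -> P (F (g y)).
  have HS' : nbhs x [set y | S (g y) -> P (F (g y))] := gc x _ HS.
  by apply: filterS HS' => y H Dy; apply: H; exact: DS.
have : within D (nbhs x) (fun y => P (F (g y))) := HD.
by rewrite (nbhs_subspace_in Dx).
Qed.

Lemma continuous_pair (X Y Z : topologicalType) (g1 : X -> Y) (g2 : X -> Z) :
  continuous g1 -> continuous g2 -> continuous (fun x => (g1 x, g2 x)).
Proof.
move=> c1 c2 x P [[N1 N2] /= [n1 n2] N12].
have m1 : nbhs x (g1 @^-1` N1) := c1 x _ n1.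
have m2 : nbhs x (g2 @^-1` N2) := c2 x _ n2.
by apply: filterS2 m1 m2 => y y1 y2; apply: N12.
Qed.

Section OneDim.
Context {R : realType}.

(** If [L] were nonpositive, then the derivative of
    u(t) - (kap / 2) t^(2 gamma) would be negative near 0, since the weighted
    derivative of its second term is the constant kap gamma; this function would
    be negative, below the lower bound (kap / 2) t^(2 gamma). *)
Lemma weighted_limit_pos (u : R -> R) (gamma a L kap eta : R) :
  0 < gamma -> a = 1 - 2 * gamma -> 0 < kap -> 0 < eta -> u 0 = 0 ->
  {within `[0, eta[, continuous u} ->
  (forall t, 0 < t < eta -> derivable u t 1) ->
  (forall t, 0 < t < eta -> kap * t `^ (2 * gamma) <= u t) ->
  t `^ a * derive1 u t @[t --> 0^'+] --> L -> 0 < L.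
Proof.
move=> g0 aE k0 e0 u0 uc ud uge uL; rewrite ltNge; apply/negP => L0.
have kg : 0 < kap * gamma by rewrite mulr_gt0.
have [d /= d0 dP] : \forall t \near (0 : R)^'+, t `^ a * derive1 u t < kap * gamma.
  have /cvgrPdist_lt/(_ _ kg) := uL.
  by apply: filterS => t; rewrite ltr_norml => /andP[+ _]; lra.
pose b := Num.min d eta / 2.
have m0 : 0 < Num.min d eta by rewrite lt_min d0.
have b0 : 0 < b by rewrite divr_gt0.
have [bd be] : b < d /\ b < eta.
  have : Num.min d eta <= d /\ Num.min d eta <= eta by rewrite !ge_min !lexx orbT.
  by rewrite /b; move: m0; move: (Num.min d eta) => mm; lra.
have p0 : 0 < 2 * gamma by rewrite mulr_gt0.
pose g t := u t - kap / 2 * t `^ (2 * gamma).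
have gd t : t \in `]0, b[%R -> is_derive t 1 g (derive1 u t - kap / 2 * (2 * gamma * t `^ (2 * gamma - 1))).
  rewrite in_itv/= => /andP[t0 tb].
  have ut : is_derive t 1 u (derive1 u t).
    by rewrite derive1E; apply/derivableP; apply: ud; rewrite t0 (lt_trans tb).
  exact: (is_deriveB ut (is_deriveZ (kap / 2) (is_derive1_powR (2 * gamma) t0))).
have gc : {within `[0, b], continuous g}.
  have sub : `[0, b]%classic `<=` `[0, eta[%classic.
    by move=> t /=; rewrite !in_itv/= => /andP[-> /le_lt_trans]; apply.
  have uc' := continuous_subspaceW sub uc.
  have pc : {within `[0, b], continuous (fun t : R => `|t| `^ (2 * gamma))}.
    by apply: continuous_subspaceT; exact: continuous_norm_powR.
  have gc' := within_continuousB uc' (within_continuousM (@within_continuousC _ _ `[0, b]%classic (kap / 2)) pc).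
  apply: subspace_eq_continuous gc' => t; rewrite inE /= in_itv/= => /andP[t0 _].
  change (u t - kap / 2 * `|t| `^ (2 * gamma) = u t - kap / 2 * t `^ (2 * gamma)).
  by rewrite ger0_norm.
have [c] := MVT b0 gd gc; rewrite in_itv/= => /andP[c0 cb].
rewrite {2}/g u0 powR0 ?gt_eqF// mulr0 !subr0 => E.
have : g b < 0.
  rewrite E pmulr_llt0//.
  have : c `^ a * derive1 u c < kap * gamma.
    by apply: dP => //=; rewrite sub0r normrN gtr0_norm//; exact: lt_trans bd.
  have ca : 0 < c `^ a by exact: powR_gt0.
  have E1 : c `^ a * c `^ (2 * gamma - 1) = 1.
    rewrite -powRD; last by rewrite (gt_eqF c0) implybT.
    by rewrite (_ : a + _ = 0) ?powRr0// aE; ring.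
  rewrite -(pmulr_rlt0 _ ca) mulrBr.
  have -> : c `^ a * (kap / 2 * (2 * gamma * c `^ (2 * gamma - 1))) = kap * gamma * (c `^ a * c `^ (2 * gamma - 1)) by field.
  by rewrite E1 mulr1 subr_lt0.
have := uge b; rewrite b0 be => /(_ isT); rewrite /g.
have : 0 < kap * b `^ (2 * gamma) by rewrite mulr_gt0// powR_gt0.
by rewrite mulrAC; move: (kap * _) => X; lra.
Qed.

Lemma within_near_right (Z : topologicalType) (eps : R) (F : R -> Z) (N : set Z) : 0 < eps ->
  {within `[0, eps[, continuous F} -> nbhs (F 0) N ->
  exists eta : R, [/\ 0 < eta, eta <= eps & forall t, 0 <= t < eta -> N (F t)].
Proof.
move=> e0 Fc FN.
have D0 : `[0, eps[%classic (0 : R) by rewrite /= in_itv/= lexx.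
have : within `[0, eps[%classic (nbhs (0 : R)) (fun t => N (F t)).
  by rewrite (nbhs_subspace_in D0); exact: (Fc 0 N FN).
move=> [d /= d0 dP]; exists (Num.min d eps); split.
- by rewrite lt_min d0.
- by rewrite ge_min lexx orbT.
- move=> t /andP[t0]; rewrite lt_min => /andP[td te]; apply: dP => /=.
    by rewrite sub0r normrN ger0_norm.
  by rewrite in_itv/= t0.
Qed.

Lemma continuous_bounded_near m (f : 'rV[R]_m -> R) x : {for x, continuous f} ->
  \forall y \near x, `|f y| <= `|f x| + 1.
Proof.
move=> /cvgrPdist_lt/(_ _ ltr01); apply: filterS => y.
rewrite distrC => H; rewrite -[f y](subrK (f x)) addrC.
by apply: (le_trans (ler_normD _ _)); rewrite addrC [leRHS]addrC lerD2r ltW.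
Qed.

Lemma continuous_bounded_near3 m (f1 f2 f3 : 'rV[R]_m -> R) x :
  {for x, continuous f1} -> {for x, continuous f2} -> {for x, continuous f3} ->
  exists2 C : R, 0 < C & \forall y \near x, [/\ `|f1 y| <= C, `|f2 y| <= C & `|f3 y| <= C].
Proof.
move=> c1 c2 c3; exists (`|f1 x| + `|f2 x| + `|f3 x| + 1).
  by rewrite ltr_wpDl// !addr_ge0.
have n1 := continuous_bounded_near c1; have n2 := continuous_bounded_near c2.
have n3 := continuous_bounded_near c3.
apply: filterS3 n1 n2 n3 => y b1 b2 b3.
have := normr_ge0 (f1 x); have := normr_ge0 (f2 x); have := normr_ge0 (f3 x).
by split; lra.
Qed.

End OneDim.

(** * Curves in the boundary *)

Section Curves.
Context {R : realType} {n : nat} {T : topologicalType} (A : bmanifold R n T).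

(** Otherwise the times at which the curve is in the closure of [B] would form a
    subset of the unit segment which is both open and closed, and contains 0 but
    not 1. *)
Lemma frontier_on_curve (B : set T) (c : R -> T) : continuous c ->
  (forall t, bdry A (c t)) -> B (c 0) -> ~ closure B (c 1) ->
  exists2 t : R, 0 <= t <= 1 & bdry_frontier A B (c t).
Proof.
move=> cc cb B0 B1; apply: contrapT => nf.
pose S := `[0, 1]%classic `&` (c @^-1` closure B).
have SE : S = `[0, 1]%classic `&` (c @^-1` (~` closure (bdry A `\` B))).
  rewrite eqEsubset; split => t [t01 ct]; split => //=.
    by move=> ct'; apply: nf; exists t.
  apply: contrapT => nB; apply: ct; apply: subset_closure; split => //.
  by move=> Bc; apply: nB; exact: subset_closure.
have : S = `[0, 1]%classic.
  apply: (@segment_connected R 0 1).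
  - exists 0; split; first by rewrite /= in_itv/= lexx ler01.
    exact: subset_closure.
  - exists (c @^-1` (~` closure (bdry A `\` B))) => //.
    apply: open_comp; first by move=> t _; exact: cc.
    by apply: closed_openC; exact: closed_closure.
  - exists (c @^-1` closure B) => //.
    by apply: closed_comp; [move=> t _; exact: cc|exact: closed_closure].
move=> E; have : S 1 by rewrite E /= in_itv/= lexx ler01.
by move=> [].
Qed.

(** The constant curve has length 0. *)
Lemma center_in_ball (hm : chart A -> 'rV[R]_n.+1 -> 'M[R]_n) p (r : R) :
  bdry A p -> 0 < r -> geodesic_ball hm p r p.
Proof.
move=> bp r0; split => //.
apply: (@le_lt_trans _ _ 0%E); last by rewrite lte_fin.
apply: ereal_inf_lbound; exists (fun=> p).
  split => //; split => //; first exact: cst_continuous.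
  move=> i t k ip; split; first exact: derivable_cst.
  rewrite (_ : derive1 _ = fun=> 0); first exact: cst_continuous.
  by apply/funext => u; rewrite derive1_cst.
rewrite /curve_length; apply: integral0_eq => t _.
congr (_%:E); rewrite /speed.
case: xgetP => [y yE [i ip]|//].
have -> : velocity (fun=> p) i t = 0.
  by apply/rowP => k; rewrite !mxE derive1_cst.
by rewrite /Defs.form mul0mx mul0mx mxE sqrtr0.
Qed.

End Curves.

(** * The Hopf lemma at the boundary *)

Section Main.
Context {R : realType} {n : nat} {T : topologicalType} (A : bmanifold R n T).
Implicit Types (i j : chart A) (p q : T).
Variables (gp gbar : chart A -> 'rV[R]_n.+1 -> 'M[R]_n.+1)
  (hhat : chart A -> 'rV[R]_n.+1 -> 'M[R]_n) (rho : T -> R) (eps : R)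
  (Phi : T -> R -> T) (h : R -> chart A -> 'rV[R]_n.+1 -> 'M[R]_n).
Hypothesis hg : geodesic_defining_function gp hhat rho gbar eps Phi h.
Variables (gamma a s : R) (f U : T -> R).
Hypotheses (hn : (3 <= n)%N) (hgamma : 0 < gamma < 1) (ha : a = 1 - 2 * gamma)
  (hs : s = n%:R / 2 + gamma) (hU : solution gp gbar rho a s f U)
  (hU0 : forall p, 0 <= U p).

Local Notation e0 := (basis_vec (ord0 : 'I_n.+1)).

Let rhoP : defining_function A rho. Proof. by case: hg => -[]. Qed.
Let Uc : continuous U := U_continuous hU.
Let g0 : 0 < gamma. Proof. by case/andP: hgamma. Qed.
Let eps0 : 0 < eps. Proof. by case: hg => _ []. Qed.
Let Phi0 q : bdry A q -> Phi q 0 = q. Proof. by case: hg => _ _ [+ _] _ _; apply. Qed.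
Let Phic : {within strip A eps, continuous (fun z => Phi z.1 z.2)}.
Proof. by case: hg => _ []. Qed.

Lemma continuous_collar_normal q : bdry A q ->
  {within `[0, eps[, continuous (fun t => Phi q t)}.
Proof.
move=> bq; apply: (within_comp (g := fun t : R => (q, t)) Phic).
  by apply: continuous_pair; [exact: cst_continuous|move=> t; exact: cvg_id].
by move=> t /=; rewrite in_itv/= => te; split.
Qed.

Lemma collar_near q N : bdry A q -> nbhs q N ->
  exists eta : R, [/\ 0 < eta, eta <= eps & forall t, 0 <= t < eta -> N (Phi q t)].
Proof.
move=> bq qN; apply: (within_near_right (F := Phi q) eps0 (continuous_collar_normal bq)).
by rewrite Phi0.
Qed.

Lemma continuous_collar_normal_at q t : bdry A q -> 0 < t < eps ->
  {for t, continuous (fun t => Phi q t)}.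
Proof.
move=> bq te P HP; have D : `[0, eps[%classic t by case/andP: te => t0 t1; rewrite /= in_itv/= ltW.
have H : within `[0, eps[%classic (nbhs t) (fun t => P (Phi q t)).
  by rewrite (nbhs_subspace_in D); exact: (continuous_collar_normal bq HP).
have H' : \forall u \near t, `[0, eps[%classic u -> P (Phi q u) := H.
have n1 : nbhs t `]0, eps[%classic.
  by apply: open_nbhs_nbhs; split; [exact: itv_open|rewrite /= in_itv/=].
apply: filterS2 H' n1 => u + /=; rewrite in_itv/= => + /andP[u0 u1]; apply.
by rewrite in_itv/= ltW.
Qed.

(** The normal geodesic is the first coordinate line of the product
    coordinates. *)
Lemma derivable_collar_normal q t : bdry A q -> 0 < t < eps ->
  derivable (fun t => U (Phi q t)) t 1.
Proof.
move=> bq te; have [t0 t1] := andP te.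
have st : strip A eps (q, t) by split => //=; rewrite ltW.
have [i iq _] := bq; have [j jp] := dom_cover A (Phi q t).
have Vx : (coord j @` (dom j `&` collar_inner A eps Phi)) (coord j (Phi q t)).
  by exists (Phi q t) => //; split => //; exact: (collar_innerP hg).
have oV : open (coord j @` (dom j `&` collar_inner A eps Phi)) by exact: (chart_open hg).
have D := collar_derive hg ord0 st t0 iq jp oV Vx (C2_C1 (chart_U eps Phi hU j)).
have E : \forall u \near (0 : R), (U \o point j) (collar_coord Phi i j (u *: e0 + (coord i q + t *: e0))) =
   U (Phi q (u *: 1 + t)).
  have nj : nbhs (Phi q t) (dom j) by apply: open_nbhs_nbhs; split => //; exact: dom_open.
  have n1 : nbhs t [set u | dom j (Phi q u)] by exact: (continuous_collar_normal_at bq te nj).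
  have ct : {for (0 : R), continuous (fun u : R => u *: (1 : R) + t)}.
    by apply: continuousD; [exact: scalel_continuous|exact: cst_continuous].
  have n2 : nbhs (0 : R) [set u : R | dom j (Phi q (u *: 1 + t))].
    by apply: (ct [set u | dom j (Phi q u)]); rewrite scale0r add0r.
  apply: filterS n2 => u ju.
  have -> : u *: e0 + (coord i q + t *: e0) = coord i q + (u *: 1 + t) *: e0.
    by rewrite addrCA -scalerDl [u *: 1]mulr1.
  by rewrite (collar_coordE hg)//= coordK.
have [D2 _] := near_eq_is_derive E D.
by apply/derivable1P.
Qed.

(** The barrier is used in a small half ball centred at [q0] in a chart.  Its
    hypotheses are bounds, up to the boundary, of the Laplacians of [rho] and
    [psi] and of their pairing, which come from smooth extensions across it, and
    the positivity of [U] in the open half ball, which propagates from the normal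
    geodesic of [q0] since the half ball is convex. *)
Lemma boundary_lower_bound q0 : bdry A q0 ->
  (exists2 eta : R, 0 < eta & forall t, 0 < t < eta -> 0 < U (Phi q0 t)) ->
  exists kap eta : R, [/\ 0 < kap, 0 < eta, eta <= eps &
    forall t, 0 < t < eta -> kap * t `^ (2 * gamma) <= U (Phi q0 t)].
Proof.
move=> bq [eta1 eta10 Upos].
have [j jq jq0] := bq.
set x0 := coord j q0.
have Ax0 : (coord j @` (dom j `&` [set: T])) x0 by exists q0.
pose V := coord j @` (dom j `&` collar_inner A eps Phi).
pose r := rho \o point j.
have oV : open V by exact: (chart_open hg).
have Vin : V `<=` coord j @` (dom j `&` [set: T]) by exact: chart_subset.
have [[_ [[smG _ _] _]] _ _ _ _] := hg.
(* The components of gbar and the function rho are extended across the boundary,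
   to Gt and rt; the bounds near x0 are those of the continuous functions B1, B2
   and B3 built from the extensions. *)
have extG (kl : 'I_n.+1 * 'I_n.+1) : exists Vg : set 'rV[R]_n.+1 * ('rV[R]_n.+1 -> R),
    [/\ open Vg.1, Vg.1 x0, (forall k, Ck k Vg.1 Vg.2) &
      {in Vg.1 `&` (coord j @` (dom j `&` [set: T])), (fun x => gbar j x kl.1 kl.2) =1 Vg.2}].
  by have [W [g [? ? ? ?]]] := smG j kl.1 kl.2 x0 Ax0; exists (W, g).
have [ext extP] := choice extG.
have [smr _ _ _] := rhoP.
have [Vr [rt [oVr Vrx rtC rE]]] := smr j x0 Ax0.
pose Gt (x : 'rV[R]_n.+1) : 'M[R]_n.+1 := \matrix_(k, l) (ext (k, l)).2 x.
pose W1 := [set x | forall kl, (ext kl).1 x]°.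
have W1x : W1 x0.
  have near_kl kl : nbhs x0 (ext kl).1.
    by have [op1 op2 _ _] := extP kl; exact: open_nbhs_nbhs.
  exact: (@filter_forall _ _ (fun kl => (ext kl).1) (nbhs x0) _ near_kl).
have W1ext kl : W1 `<=` (ext kl).1 by move=> x /interior_subset; apply.
have oW1 : open W1 by exact: open_interior.
have GtC1 k l : C1 W1 (fun x => Gt x k l).
  rewrite (_ : (fun x => Gt x k l) = (ext (k, l)).2); last by apply/funext => x; rewrite mxE.
  apply: C1_sub (@W1ext (k, l)) _; apply: Ck_C1.
  by have [_ _ + _] := extP (k, l); apply.
have GtE x : W1 x -> (coord j @` (dom j `&` [set: T])) x -> gbar j x = Gt x.
  move=> Wx Ax; apply/matrixP => k l; rewrite mxE.
  have [_ _ _ E] := extP (k, l); apply: (E x); rewrite inE; split => //.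
  exact: (W1ext (k, l)).
have detC := C1_continuous (C1_det oW1 GtC1) W1x.
have det0 : 0 < \det (Gt x0).
  by rewrite -GtE//; apply: inner_product_det; exact: (riem_inner hg).
pose W2 := (W1 `&` Vr `&` [set x | 0 < \det (Gt x)])°.
have oW2 : open W2 by exact: open_interior.
have W2x : W2 x0.
  apply: filterI; first by apply: filterI; exact: open_nbhs_nbhs.
  by apply: (detC [set t : R | 0 < t]); apply: open_nbhs_nbhs; split => //; exact: open_gt.
have W21 : W2 `<=` W1 by move=> x /interior_subset[[]].
have W2r : W2 `<=` Vr by move=> x /interior_subset[[]].
have GtM : C1_metric W2 Gt.
  split=> // [k l|x /interior_subset[]//]; exact: (C1_sub W21).
have rtC2 : C2 W2 rt by apply: (C2_sub W2r); exact: Ck_C2.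
have psiC := C2_sqdist x0 oW2.
pose B1 := laplacian Gt rt; pose B2 := pairing Gt rt (sqdist x0); pose B3 := laplacian Gt (sqdist x0).
have B1c : {for x0, continuous B1} by exact: (continuous_divergence GtM (C1_gradient GtM rtC2) W2x).
have B2c : {for x0, continuous B2} by exact: (continuous_pairing GtM (C2_C1 rtC2) psiC W2x).
have B3c : {for x0, continuous B3} by exact: (continuous_divergence GtM (C1_gradient GtM psiC) W2x).
have [C C0 Bnear] := continuous_bounded_near3 B1c B2c B3c.
have imO : open ((fun z : T * R => Phi z.1 z.2) @` strip A eps) by case: hg => _ [].
have qim : ((fun z : T * R => Phi z.1 z.2) @` strip A eps) q0.
  by exists (q0, 0); [split => //=; rewrite lexx|rewrite /= Phi0].
have cn := chart_nbhs jq (open_nbhs_nbhs (conj imO qim)).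
have [d d0 dP] := nbhs_sqdist_ball (filterI (open_nbhs_nbhs (conj oW2 W2x)) (filterI Bnear cn)).
(* The half ball Q consists of coordinates of points of the collar. *)
pose Q := @half_space R n `&` [set x | sqdist x0 x <= d].
have Qim x : Q x -> exists2 q, dom j q /\ ((fun z : T * R => Phi z.1 z.2) @` strip A eps) q & x = coord j q.
  by move=> [Hx xd]; have [_ [_ +]] := dP x xd; apply.
have QV x : Q x -> 0 < x ord0 ord0 -> V x.
  move=> /Qim[q [jq' qi] ->] x00; exists q => //; split => //; split => //.
  exact: (coord_gt0_inner rhoP jq').
have QA : Q `<=` coord j @` dom j by move=> x /Qim[q [jq' _] ->]; exists q.
have pointc : {within Q, continuous (point j)}.
  by apply: continuous_subspaceW QA _; exact: point_continuous.
(* Where psi < d / 4, the factor 1 - (2 / d) psi of the lower bound is at least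
   1 / 2. *)
have nN : nbhs q0 (dom j `&` [set p | sqdist x0 (coord j p) < d / 4]).
  apply: filterI; first by apply: open_nbhs_nbhs; split => //; exact: dom_open.
  have nc : nbhs (coord j q0) [set z | sqdist x0 z < d / 4].
    by apply: nbhs_sqdist_lt; rewrite sqdistxx divr_gt0.
  exact: (coord_at jq nc).
have [eta2 [eta20 eta2e Hnear]] := collar_near bq nN.
have Qnear t : 0 < t < eta2 -> [/\ dom j (Phi q0 t), sqdist x0 (coord j (Phi q0 t)) < d / 4,
    Q (coord j (Phi q0 t)) & strip A eps (q0, t)].
  move=> /andP[t0 t1]; have [|jt dt] := Hnear t; first by rewrite ltW.
  split => //; last by split => //=; rewrite ltW//= (lt_le_trans t1).
  by split; [exact: coord_half|rewrite /=; move: dt => /=; lra].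
have Qpos x : Q x -> 0 < x ord0 ord0 -> 0 < U (point j x).
  move=> Qx x00; pose t := Num.min eta1 eta2 / 2.
  have m0 : 0 < Num.min eta1 eta2 by rewrite lt_min eta10.
  have [te1 te2] : 0 < t < eta1 /\ 0 < t < eta2.
    have : Num.min eta1 eta2 <= eta1 /\ Num.min eta1 eta2 <= eta2 by rewrite !ge_min !lexx orbT.
    rewrite /t; move: m0; move: (Num.min eta1 eta2) => mm m0 [m1 m2].
    by split; apply/andP; split; lra.
  have [jt _ Qt stt] := Qnear t te2.
  have t0 : 0 < t by case/andP: te1.
  have It : inner A (Phi q0 t) by have [] := collar_innerP hg stt t0.
  have z00 := inner_coord_gt0 jt It.
  set z0 := coord j (Phi q0 t) in Qt z00.
  (* The segment from a point of the normal geodesic to x. *)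
  pose sg (v : R) := z0 + v *: (x - z0).
  have sgQ v : `[0, 1]%classic v -> Q (sg v) /\ 0 < (sg v) ord0 ord0.
    rewrite /= in_itv/= => /andP[v0 v1].
    have pos : 0 < (sg v) ord0 ord0.
      rewrite /sg !mxE; move: (x _ _) (z0 _ _) x00 z00 => X Z X0 Z0.
      by have [->|v0'] := eqVneq v 0; [lra|have : 0 < v * X; [rewrite mulr_gt0// lt0r v0'|nra]].
    split => //; split; first exact: ltW.
    rewrite /=; apply: le_trans (sqdist_segment _ _ _ _) _; first by rewrite v0.
    move: Qt Qx => [_ /= zd] [_ /= xd]; move: (sqdist _ _) (sqdist x0 x) zd xd => X Y X1 Y1; nra.
  have sgc : continuous sg.
    by move=> v; apply: cvgD; [exact: cvg_cst|exact: scalel_continuous].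
  have pc : {within `[0, 1], continuous (fun v => point j (sg v))}.
    by apply: (within_comp pointc sgc) => v /sgQ[].
  have conS := connected_continuous_connected (@segment_connected R 0 1) pc.
  apply: (connected_positivity hg hs hU hU0 conS _ (p1 := Phi q0 t)).
  - by move=> _ [v /sgQ[Qv v0] <-]; have [q [jq' qi] <-] := QV _ Qv v0; rewrite coordK.
  - exists 0; first by rewrite /= in_itv/= lexx ler01.
    by rewrite /sg scale0r addr0 coordK.
  - exists 1; first by rewrite /= in_itv/= lexx ler01.
    by rewrite /sg scale1r addrC subrK.
  - exact: Upos.
have b0 : 0 <= n%:R - s.
  have : (3 : R) <= n%:R by rewrite (ler_nat R 3 n).
  by rewrite hs; have /andP[_] := hgamma; lra.
have VW x : V x -> W2 x -> [/\ laplacian (gbar j) r x = B1 x, pairing (gbar j) r (sqdist x0) x = B2 x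
    & laplacian (gbar j) (sqdist x0) x = B3 x].
  move=> Vx Wx; have oVW : open (V `&` W2) by exact: openI.
  have VWx : (V `&` W2) x by [].
  have GE : {in V `&` W2, gbar j =1 Gt}.
    by move=> y /set_mem[Vy Wy]; apply: GtE; [exact: W21|exact: Vin].
  have rEq : {in V `&` W2, r =1 rt}.
    by move=> y /set_mem[Vy Wy]; apply: rE; rewrite inE; split; [exact: W2r|exact: Vin].
  split; [exact: (laplacian_ext oVW GE rEq)|exact: (pairing_ext oVW GE rEq)|exact: (laplacian_ext oVW GE)].
have Vr0 x : V x -> 0 < r x by exact: (chart_rho_gt0 hg).
have QP x : Q x -> r x = 0 /\ 0 <= U (point j x) \/
    [/\ V x, nbhs x (@half_space R n), 0 < U (point j x) & [/\ `|laplacian (gbar j) r x| <= C,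
       `|pairing (gbar j) r (sqdist x0) x| <= C & `|laplacian (gbar j) (sqdist x0) x| <= C]].
  move=> Qx; have [x00|x00] := eqVneq (x ord0 ord0) 0.
    left; split; last exact: hU0.
    have [q [jq' _] xE] := Qim x Qx; rewrite /r /= xE coordK//.
    by apply: (rho_bdry rhoP); exists j => //; rewrite -xE.
  right; have xp : 0 < x ord0 ord0 by rewrite lt0r x00; case: Qx.
  have Vx := QV x Qx xp; have [Wx [[b1 b2 b3] _]] := dP x Qx.2.
  have [-> -> ->] := VW x Vx Wx; split => //.
    apply: filterS (open_nbhs_nbhs (conj (@open_pos_half R n) xp)) => y; exact: ltW.
  exact: Qpos.
have [kap [del [kap0 del0 main]]] := @boundary_barrier R n.+1 V (gbar j) r (Erho gp rho s j) (U \o point j)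
  (@half_space R n) x0 d gamma a (n%:R - s) C d0 g0 ha b0 C0
  (chart_metric hg j) (fun x Vx => chart_inner_product hg Vx) (chart_rho hg j) Vr0
  (fun x Vx => chart_norm hg Vx) (chart_U eps Phi hU j) (fun x _ => hU0 (point j x))
  (fun x Vx => chart_equation hU Vx) (fun x Vx => chart_potential hg hs Vx)
  (@closed_half_space R n)
  (fun x => continuous_comp (pointc x) (@rho_continuous _ _ _ _ _ rhoP _))
  (fun x => continuous_comp (pointc x) (@Uc _)) QP.
exists (kap / 2), (Num.min eta2 del); split.
- by rewrite divr_gt0.
- by rewrite lt_min eta20.
- by rewrite ge_min eta2e.
move=> t /andP[t0]; rewrite lt_min => /andP[te td].
have [|jt dt Qt stt] := Qnear t; first by rewrite t0.
have := main _ Qt; rewrite /r /= coordK// (collar_rho hg)// => /(_ (ltW td)).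
apply: le_trans; rewrite -mulrA ler_pM2l// mulrC ler_wpM2l ?powR_ge0//.
have : 2 / d * sqdist x0 (coord j (Phi q0 t)) <= 2 / d * (d / 4).
  by rewrite ler_wpM2l ?divr_ge0// ltW.
have -> : 2 / d * (d / 4) = 2^-1 by field; rewrite gt_eqF.
move: (2 / d * _) => X; lra.
Qed.

(** Let [c tau] be a point of the frontier on a curve from [p0] to [q0].  At a
    small height [t], U > 0 above [c tau] by continuity, hence above [q0] by
    propagation along the curve [fun u => Phi (c u) t]. *)
Lemma hopf_boundary (p0 : T) (r0 : R) (q0 : T) (L : R) : bdry A p0 -> 0 < r0 ->
  (geodesic_ball hhat p0 r0 `\` closure (geodesic_ball hhat p0 (r0 / 2))) q0 ->
  U q0 = 0 ->
  (forall q, bdry_frontier A (geodesic_ball hhat p0 (r0 / 2)) q -> 0 < U q) ->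
  t `^ a * derive1 (fun t' => U (Phi q0 t')) t @[t --> 0^'+] --> L ->
  0 < L.
Proof.
move=> bp0 r00 [[bq0 dist] ncl] Uq0 Ufr UL.
have r20 : 0 < r0 / 2 by rewrite divr_gt0.
have [_ [c [[cb cc _] c0 c1] _] _] := ereal_inf_lt dist.
have [] := @frontier_on_curve _ _ _ A (geodesic_ball hhat p0 (r0 / 2)) c cc cb.
- by rewrite c0; exact: center_in_ball.
- by rewrite c1.
move=> tau /andP[tau0 tau1] fr.
have Uq1 := Ufr _ fr.
have nU : nbhs (c tau) [set p | 0 < U p].
  by apply: (@Uc (c tau) [set t : R | 0 < t]); apply: open_nbhs_nbhs; split => //; exact: open_gt.
have [eta [eta0 etae Hpos]] := collar_near (cb tau) nU.
have Upos t : 0 < t < eta -> 0 < U (Phi q0 t).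
  move=> /andP[t0 t1].
  have st u : strip A eps (c u, t) by split; [exact: cb|rewrite /= ltW//= (lt_le_trans t1)].
  have pc : {within `[0, 1], continuous (fun u => Phi (c u) t)}.
    apply: (within_comp (g := fun u : R => (c u, t)) Phic).
      by apply: continuous_pair; [exact: cc|exact: cst_continuous].
    by move=> u _; exact: st.
  have conS := connected_continuous_connected (@segment_connected R 0 1) pc.
  apply: (connected_positivity hg hs hU hU0 conS _ (p1 := Phi (c tau) t)).
  - by move=> _ [u _ <-]; exact: (collar_innerP hg).
  - by exists tau => //; rewrite /= in_itv/= tau0.
  - by exists 1; [rewrite /= in_itv/= lexx ler01|rewrite c1].
  - by apply: Hpos; rewrite ltW.
have [|kap [eta2 [kap0 eta20 eta2e low]]] := @boundary_lower_bound q0 bq0; first by exists eta.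
apply: (weighted_limit_pos (u := fun t => U (Phi q0 t)) g0 ha kap0 eta20 _ _ _ low UL).
- by rewrite Phi0.
- have sub : `[0, eta2[%classic `<=` `[0, eps[%classic.
    by move=> t /=; rewrite !in_itv/= => /andP[-> /lt_le_trans]; apply.
  have := continuous_subspaceW sub (continuous_collar_normal bq0) => H t.
  by apply: continuous_comp; [exact: H|exact: Uc].
- move=> t /andP[t0 t1]; apply: derivable_collar_normal => //.
  by rewrite t0 (lt_le_trans t1).
Qed.

End Main.

Unset Implicit Arguments.

Theorem proposition1p2 (R : realType) (n : nat) (hn : (3 <= n)%N)
    (gamma a s : R) (hgamma : 0 < gamma < 1)
    (ha : a = 1 - 2 * gamma) (hs : s = n%:R / 2 + gamma)
    (T : topologicalType) (A : bmanifold R n T)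
    (hM : compact (bdry A))
    (gp gbar : chart A -> 'rV[R]_n.+1 -> 'M[R]_n.+1)
    (hAH : asymptotically_hyperbolic gp)
    (hhat : chart A -> 'rV[R]_n.+1 -> 'M[R]_n)
    (hinf : conformal_infinity gp hhat)
    (rho : T -> R) (eps : R) (Phi : T -> R -> T)
    (h : R -> chart A -> 'rV[R]_n.+1 -> 'M[R]_n)
    (hrho : geodesic_defining_function gp hhat rho gbar eps Phi h)
    (f U : T -> R) (hU : solution gp gbar rho a s f U)
    (hU0 : forall p, 0 <= U p)
    (p0 : T) (hp0 : bdry A p0) :
  \forall r0 \near (0 : R)^'+,
    forall (q0 : T) (L : R),
      (geodesic_ball hhat p0 r0 `\` closure (geodesic_ball hhat p0 (r0 / 2))) q0 ->
      U q0 = 0 ->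
      (forall q, bdry_frontier A (geodesic_ball hhat p0 (r0 / 2)) q -> 0 < U q) ->
      t `^ a * derive1 (fun t' => U (Phi q0 t')) t @[t --> 0^'+] --> L ->
      0 < L.
Proof.
near=> r0 => q0 L ball0 Uq0 Upos UL.
have r00 : 0 < r0 by [].
exact: (hopf_boundary hrho hn hgamma ha hs hU hU0 hp0 r00 ball0 Uq0 Upos UL).
Unshelve. all: by end_near. Qed.
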